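(* Let $n\ge 2$, $s\in(0,1)$, let $f$ be a continuous, integrable nonlinearity, and let $\Omega=B_1(0)\subset\mathbb{R}^n$ or $\Omega=\mathbb{R}^n_{1,+}=\{x\in\mathbb{R}^n\mid x_1>0\}$. If $p<0$, then the problem $$\begin{cases}\frac{\partial u}{\partial t}(x,t)+(-\Delta)^s u(x,t)=x_1u^p(x,t)+f(u(x,t)),\quad u>0, & (x,t)\in \Omega\times\mathbb{R},\\ u(x,t)\equiv 0, & (x,t)\in \Omega^c\times\mathbb{R}\end{cases}$$ has no classical solution on $\Omega\times\mathbb{R}$.
   Context: For $x\in\mathbb{R}^n$, $x_1$ denotes its first coordinate; $B_1(0)$ is the unit ball. The fractional Laplacian acts in the spatial variable: $$(-\Delta)^{s}u(x,t):=C_{n,s}\,\mathrm{P.V.}\int_{\mathbb{R}^{n}}\frac{u(x,t)-u(y,t)}{|x-y|^{n+2s}}\,dy,$$ where P.V. is the Cauchy principal value and $C_{n,s}>0$ is the usual normalizing constant; it is well-defined when $u(\cdot,t)\in L_{2s}\cap C^{1,1}_{\mathrm{loc}}$, where $L_{2s}:=\{v\in L^1_{\mathrm{loc}}(\mathbb{R}^n)\mid \int_{\mathbb{R}^n}\frac{|v(x)|}{1+|x|^{n+2s}}dx<+\infty\}$. A classical solution is one satisfying the equation pointwise. The nonlinearity $f$ is a continuous, integrable real-valued function of a real variable, entering the equation as $f(u(x,t))$. *)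

(* Defs.v *)
From HB Require Import structures.
From mathcomp Require Import all_boot all_order all_algebra.
From mathcomp Require Import all_classical all_reals all_analysis.

Set Implicit Arguments.
Unset Strict Implicit.
Unset Printing Implicit Defensive.

Import Order.TTheory GRing.Theory Num.Theory.
Import numFieldNormedType.Exports.

Local Open Scope classical_set_scope.
Local Open Scope ring_scope.

(* Points of R^n are row vectors 'rV[R]_n.  The library's norm on 'rV[R]_n is
   the sup norm, hence enorm below; the sup norm is only used for topological
   and (local) Lipschitz notions, which do not depend on the choice of norm. *)
Definition enorm (R : realType) (n : nat) (x : 'rV[R]_n) : R :=
  Num.sqrt (\sum_(i < n) x ord0 i ^+ 2).

Definition coord1 (R : realType) (n : nat) (hn : (2 <= n)%N)
  (x : 'rV[R]_n) : R := x ord0 (Ordinal (ltnW hn)).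

Definition unit_ball (R : realType) (n : nat) : set 'rV[R]_n :=
  [set x | enorm x < 1].

Definition right_half_space (R : realType) (n : nat) (hn : (2 <= n)%N) :
  set 'rV[R]_n := [set x | 0 < coord1 hn x].

(* The sigma-algebra on R^n is the one generated by the coordinates, i.e. the
   Borel sigma-algebra. *)
Definition rV_display : measure_display -> measure_display.
Proof. exact. Qed.

Section rV_measurable.
Context (R : realType) (n : nat).

Let coors : 'I_n -> 'rV[R]_n -> measurableTypeR R := fun i x => x ord0 i.

Let rV_set0 : g_sigma_preimage coors set0.
Proof. exact: sigma_algebra0. Qed.

Let rV_setC A : g_sigma_preimage coors A -> g_sigma_preimage coors (~` A).
Proof. exact: sigma_algebraC. Qed.

Let rV_bigcup (F : _^nat) : (forall i, g_sigma_preimage coors (F i)) ->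
  g_sigma_preimage coors (\bigcup_i (F i)).
Proof. exact: sigma_algebra_bigcup. Qed.

HB.instance Definition _ := @isMeasurable.Build (rV_display default_measure_display)
  'rV[R]_n (g_sigma_preimage coors) rV_set0 rV_setC rV_bigcup.

Lemma measurable_fun_rV d (T : measurableType d) (f : T -> 'rV[R]_n) :
  (forall i, measurable_fun setT (fun t => f t ord0 i : measurableTypeR R)) ->
  measurable_fun setT f.
Proof.
move=> mf _ A mA; rewrite setTI.
suff : g_sigma_preimage coors `<=` [set B | measurable (f @^-1` B)] by apply.
apply: smallest_sub.
  split => /=.
  - by rewrite preimage_set0.
  - by move=> B mB; rewrite setTD preimage_setC; exact: measurableC.
  - by move=> F mF; rewrite preimage_bigcup; exact: bigcup_measurable.
move=> B; rewrite -bigcup_seq => -[i _ [C mC <-]] /=; rewrite setTI.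
by have := mf i measurableT C mC; rewrite setTI.
Qed.

End rV_measurable.

Section lebesgue_rV.
Context (R : realType).

Definition rV_cons (n : nat) (p : measurableTypeR R * 'rV[R]_n) : 'rV[R]_n.+1 :=
  row_mx (p.1 : R)%:M p.2.

Lemma measurable_coord (n : nat) (i : 'I_n) :
  measurable_fun setT (fun x : 'rV[R]_n => x ord0 i : measurableTypeR R).
Proof.
move=> _ Y mY; rewrite setTI; apply: sub_sigma_algebra => /=.
rewrite -bigcup_seq/=; exists i => /=; first by rewrite mem_index_enum.
by exists Y => //; rewrite setTI.
Qed.

Lemma measurable_rV_cons (n : nat) : measurable_fun setT (@rV_cons n).
Proof.
apply: measurable_fun_rV => i.
case: (@split_ordP 1 n i) => j ->.
  rewrite (_ : (fun t => _) = fst); first exact: measurable_fst.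
  apply/funext => -[a b]; apply: (etrans (row_mxEl _ _ _ _)).
  by rewrite mxE (ord1 j) eqxx mulr1n.
rewrite (_ : (fun t => _) = (fun x : 'rV[R]_n => x ord0 j) \o snd).
  by apply: measurableT_comp; [exact: measurable_coord|exact: measurable_snd].
by apply/funext => -[a b]; exact: (row_mxEr _ _ ord0 j).
Qed.

Section lebesgue_rV_step.
Context (n : nat) (m : {measure set 'rV[R]_n -> \bar R}).

Definition lebesgue_rV_step : set 'rV[R]_n.+1 -> \bar R :=
  pushforward (lebesgue_measure \x^ m)%E (@rV_cons n).

Let step0 : lebesgue_rV_step set0 = 0%E.
Proof. by rewrite /lebesgue_rV_step /pushforward preimage_set0 measure0. Qed.

Let step_ge0 A : (0 <= lebesgue_rV_step A)%E.
Proof. by have mcons := @measurable_rV_cons n; exact: measure_ge0. Qed.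

Let step_sigma_additive : semi_sigma_additive lebesgue_rV_step.
Proof.
have mcons := @measurable_rV_cons n.
exact: (@measure_semi_sigma_additive _ _ _ (pushforward _ _)).
Qed.

HB.instance Definition _ := isMeasure.Build _ _ _ lebesgue_rV_step
  step0 step_ge0 step_sigma_additive.

End lebesgue_rV_step.

(* Lebesgue measure on R^n: the n-fold product of lebesgue_measure (the unit
   mass at the only point when n = 0). *)
Fixpoint lebesgue_rV (n : nat) : {measure set 'rV[R]_n -> \bar R} :=
  match n with
  | 0 => dirac (0 : 'rV[R]_0)
  | n'.+1 => lebesgue_rV_step (lebesgue_rV n')
  end.

End lebesgue_rV.

Section fractional_laplacian.
Context (R : realType) (n : nat).
Local Notation mu := (@lebesgue_rV R n).

(* C_{n,s} = (\int_{R^n} (1 - cos z_1) / |z|^{n+2s} dz)^{-1} *)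
Definition frac_lap_const (hn : (2 <= n)%N) (s : R) : R :=
  (\int[mu]_z ((1 - cos (coord1 hn z)) / enorm z `^ (n%:R + 2 * s)))^-1.

(* The principal value is the limit, as the radius eps of the excised ball
   tends to 0, of absolutely convergent integrals. *)
Definition frac_lap (hn : (2 <= n)%N) (s : R) (v : 'rV[R]_n -> R)
    (x : 'rV[R]_n) : R :=
  frac_lap_const hn s *
  lim ((\int[mu]_(y in [set y | eps < enorm (x - y)])
          ((v x - v y) / enorm (x - y) `^ (n%:R + 2 * s)))
       @[eps --> 0^'+]).

Definition L1loc (v : 'rV[R]_n -> R) : Prop :=
  forall K : set 'rV[R]_n, compact K -> mu.-integrable K (EFin \o v).

Definition L2s (s : R) (v : 'rV[R]_n -> R) : Prop :=
  L1loc v /\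
  (\int[mu]_x (`|v x| / (1 + enorm x `^ (n%:R + 2 * s)))%:E < +oo)%E.

Definition grad (v : 'rV[R]_n -> R) (x : 'rV[R]_n) : 'rV[R]_n :=
  \row_i 'D_(delta_mx ord0 i) v x.

(* C^{1,1}_loc on the whole of R^n, like L2s. *)
Definition C11loc (v : 'rV[R]_n -> R) : Prop :=
  (forall x, differentiable v x) /\
  (forall K : set 'rV[R]_n, compact K -> [lipschitz grad v x | x in K]).

End fractional_laplacian.

(* L_{2s} \cap C^{1,1}_loc is the class of functions on R^n for which (-Delta)^s
   is defined pointwise, so that the limit in frac_lap exists. *)
Record classical_solution (R : realType) (n : nat) (hn : (2 <= n)%N) (s p : R)
    (f : R -> R) (Omega : set 'rV[R]_n) (u : 'rV[R]_n -> R -> R) : Prop := {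
  solution_L2s : forall t, L2s s (u ^~ t) ;
  solution_C11loc : forall t, C11loc (u ^~ t) ;
  solution_derivable : forall x t, Omega x -> derivable (u x) t 1 ;
  solution_eq : forall x t, Omega x ->
    derive1 (u x) t + frac_lap hn s (u ^~ t) x =
    coord1 hn x * u x t `^ p + f (u x t) ;
  solution_gt0 : forall x t, Omega x -> 0 < u x t ;
  solution_eq0 : forall x t, ~ Omega x -> u x t = 0
}.

(* Main.v *)
(* A solution is C^{1,1} across the boundary and vanishes outside Omega, so at
   time t it is at most N r^2 at distance r from the boundary; by Baire's
   theorem N can be chosen uniformly for t in some interval.  In the ball, and
   in the half-space when p < -1/2, x_1 u^p tends to +oo at a boundary point,
   hence so does u_t, which is impossible for a bounded function.

   In the half-space with p > -1, let V(r) be the infimum of u over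
   {x_1 >= r} x R, and let Phi be its quadratic inf-convolution capped at M.
   Testing the equation at almost minimal points of u + A ((r - x_1)^+)^2 gives
   k0 Lam(r) + c r (M + 1)^p + f(Phi(r)) <= small wherever Phi(r) < M, where Lam
   is the nonlocal operator applied to Phi.  Integrated against dPhi the
   nonlocal term vanishes, because it is antisymmetric in pairs of points, and
   there remains c' (M + 1)^p (M - 2) <= \int |f| + 4 for all large M, which is
   false for p > -1.  That V is continuous, so that Phi(r) approximates the
   value of u at the contact point, follows from the same test.

   As u is only differentiable in t at each fixed x, such points need not exist
   unless u(., t) is lower semicontinuous in t from the right, uniformly in x on
   compact sets (no_dip).  On time intervals without dips a barrier gives
   u(x, t) >= u(x, a) - C (t - a) with C depending only on the regularity at
   time a.  An L^2 energy estimate extends this to the case where a itself may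
   be a dip, and Baire's theorem then excludes dips altogether. *)

Require Import Defs.
From HB Require Import structures.
From mathcomp Require Import all_boot all_order all_algebra.
From mathcomp Require Import all_classical all_reals all_analysis.
From mathcomp Require Import measurable_realfun.
From mathcomp Require Import ring lra.

Set Implicit Arguments.
Unset Strict Implicit.
Unset Printing Implicit Defensive.

Import Order.TTheory GRing.Theory Num.Theory.
Import numFieldNormedType.Exports.

Local Open Scope classical_set_scope.
Local Open Scope ring_scope.


(** * Lebesgue measure on R^n *)

(** Every estimate is one-sided. Nothing bounds [u] from above uniformly in [x] and [t], and the
    [C^{1,1}] constants at different times are unrelated. But [u >= 0] makes the far part of
    [-(-Delta)^s u] at least [-C u(x)], and [x_1 u^p >= 0] in the half-space, so [u_t] is bounded
    below wherever a smooth function touches [u] from below. Upper regularity of [u] serves only to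
    make the principal value converge. Infima over all [x] and [t] need not be attained. A point
    that is minimal up to [sig^2] is therefore compared with a barrier of slope [sig] on a time
    window of length [sig]: the gain [sig^2] forces a nearby contact point with [u_t <= sig]. The
    cap at [M] makes the nonlocal operator of [Phi] finite and the measure [dPhi] of mass at most
    [M], so that errors of size [1/M] at each level add up to a constant. The nonlinearity enters
    only through its modulus of continuity on bounded sets and the integral of its absolute value.
    In the half-space the two methods overlap: [r (N r^2)^p] blows up for [p < -1/2], while
    [M^(p+1)] is unbounded for [p > -1]. The cases are separated at [-1/2]. *)

Section affine_change_of_variable.
Context (R : realType).
Implicit Types (l v : R).

Lemma measurable_affine l v :
  measurable_fun setT (fun x : measurableTypeR R => l * x + v : measurableTypeR R).
Proof.
by apply: measurable_funD => //; apply: measurable_funM.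
Qed.

Lemma lebesgue_measure_affine l v (A : set (measurableTypeR R)) : l != 0 ->
  measurable A ->
  lebesgue_measure A =
  ((`|l|%R)%:E * lebesgue_measure ((fun x : R => (l * x + v)%R) @^-1` A))%E.
Proof.
move=> l0 mA.
have mf := measurable_affine l v.
pose m : {measure set (measurableTypeR R) -> \bar R} :=
  mscale (NngNum (normr_ge0 l)) (pushforward lebesgue_measure
     (fun x : measurableTypeR R => l * x + v : measurableTypeR R)).
have : forall X, ocitv X -> lebesgue_measure X = m mf X.
  move=> _ [[a b]] _ <- /=; rewrite /m /mscale /= /pushforward.
  have [l_gt0|l_lt0|/esym/eqP] := ltgtP 0 l; last by rewrite (negbTE l0).
    have -> : (fun x : R => l * x + v) @^-1` `]a, b]%classic =
        `](a - v) / l, (b - v) / l]%classic.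
      apply/seteqP; split => x /=; rewrite !in_itv/= ltr_pdivrMr// ler_pdivlMr//;
        rewrite ltrBlDr lerBrDr mulrC//.
    rewrite !lebesgue_measure_itv/= !lte_fin ltr_pM2r ?invr_gt0// ltrD2r.
    case: ifP => _; rewrite ?mule0// -!EFinB -EFinM gtr0_norm//.
    by congr (_%:E); field.
  (* For [l < 0] the preimage is closed on the left instead, with the same measure. *)
  have -> : (fun x : R => l * x + v) @^-1` `]a, b]%classic =
      `[(b - v) / l, (a - v) / l[%classic.
    apply/seteqP; split => x /=; rewrite !in_itv/= ltr_ndivlMr// ler_ndivrMr//;
      rewrite ltrBlDr lerBrDr [x * l]mulrC andbC//.
  rewrite !lebesgue_measure_itv/= !lte_fin ltr_nM2r ?invr_lt0// ltrD2r.
  case: ifP => _; rewrite ?mule0// -!EFinB -EFinM ltr0_norm//.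
  by congr (_%:E); field.
by move=> /lebesgue_measure_unique /(_ A mA) ->.
Qed.

Lemma ge0_integral_affine l v (g : R -> \bar R) : l != 0 ->
  measurable_fun setT (g : measurableTypeR R -> \bar R) -> (forall x, 0 <= g x)%E ->
  (\int[lebesgue_measure]_x g x =
   (`|l|%R)%:E * \int[lebesgue_measure]_x g (l * x + v)%R)%E.
Proof.
move=> l0 mg g0.
have mf := measurable_affine l v.
pose p : {measure set (measurableTypeR R) -> \bar R} :=
  pushforward lebesgue_measure
     (fun x : measurableTypeR R => l * x + v : measurableTypeR R).
transitivity (\int[mscale (NngNum (normr_ge0 l)) (p mf)]_x g x)%E.
  apply: eq_measure_integral => //= A mA _.
  by rewrite (lebesgue_measure_affine v l0 mA).
rewrite ge0_integral_mscale//= ge0_integral_pushforward//.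
Qed.

End affine_change_of_variable.

Section lebesgue_rV_theory.
Context (R : realType).

Definition cube n (k : R) : set 'rV[R]_n := [set x | forall i, - k <= x ord0 i <= k].

Lemma measurable_cube n k : measurable (@cube n k).
Proof.
have -> : @cube n k = \bigcap_(i in [set: 'I_n])
    ((fun x : 'rV[R]_n => x ord0 i) @^-1` `[-k, k]%classic).
  apply/seteqP; split => x /=.
    by move=> h i _ /=; rewrite in_itv/=.
  by move=> h i; have := h i Logic.I; rewrite /= in_itv/=.
apply: fin_bigcap_measurable; first exact: finite_finset.
move=> i _; rewrite -[X in measurable X]setTI.
exact: (@measurable_coord R n i _ _ (measurable_itv _)).
Qed.

Lemma rV_cons_preimage_cube n k : 0 <= k ->
  @rV_cons R n @^-1` cube k = (`[-k, k]%classic : set R) `*` cube k.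
Proof.
move=> k0; apply/seteqP; split => -[a y] /=.
  move=> h; split.
    have := h (lshift n ord0 : 'I_(1 + n)); rewrite /rV_cons (row_mxEl a%:M y ord0 ord0).
    by rewrite mxE eqxx mulr1n in_itv.
  by move=> i; have := h (rshift 1 i); rewrite /rV_cons (row_mxEr a%:M y ord0 i).
move=> [+ h] i; rewrite in_itv/= => ha.
case: (@split_ordP 1 n i) => j ->.
  by rewrite /rV_cons (row_mxEl a%:M y ord0 j) mxE (ord1 j) eqxx mulr1n.
by rewrite /rV_cons (row_mxEr a%:M y ord0 j).
Qed.

Lemma lebesgue_rV_cube n k : 0 <= k ->
  lebesgue_rV R n (cube k) = ((k *+ 2) ^+ n)%:E.
Proof.
move=> k0; elim: n => [|n IH] /=.
  by rewrite expr0 diracE mem_set// => i; case: i.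
rewrite /lebesgue_rV_step /pushforward rV_cons_preimage_cube//.
rewrite product_measure2E//; [|exact: measurable_cube].
have h : lebesgue_measure (`[- k, k]%classic : set R) = (k *+ 2)%:E.
  rewrite lebesgue_measure_itv/= lte_fin.
  case: ltP => h; first by rewrite -EFinB opprK -mulr2n.
  have -> : k = 0 by lra.
  by rewrite mul0rn.
by rewrite exprS EFinM; congr (_ * _)%E.
Qed.

Lemma lebesgue_rV_sigma_finite n : sigma_finite setT (lebesgue_rV R n).
Proof.
exists (fun k : nat => cube k%:R); last first.
  move=> k; split; first exact: measurable_cube.
  by rewrite lebesgue_rV_cube// ltry.
apply/esym/seteqP; split => // x _ /=.
have [k hk] : exists k : nat, \sum_(i < n) `|x ord0 i| <= k%:R.
  exists (Num.truncn (\sum_(i < n) `|x ord0 i|)).+1.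
  exact/ltW/truncnS_gt.
exists k => // i; rewrite -ler_norml; apply: le_trans hk.
by rewrite (bigD1 i)//= lerDl sumr_ge0.
Qed.

(** A name for the underlying set function, to which the sigma-finite structure required by
    Tonelli's theorem can be attached. *)
Definition lebesgue_rVs n : set 'rV[R]_n -> \bar R := lebesgue_rV R n.

HB.instance Definition _ n :=
  Measure.copy (@lebesgue_rVs n) (Measure.sort (lebesgue_rV R n)).

HB.instance Definition _ n := Measure_isSigmaFinite.Build _ _ _ (@lebesgue_rVs n)
  (@lebesgue_rV_sigma_finite n).

Local Open Scope ereal_scope.

Lemma ge0_integral_rV_cons n (g : 'rV[R]_n.+1 -> \bar R) :
  measurable_fun setT g -> (forall x, 0 <= g x) ->
  \int[lebesgue_rV R n.+1]_x g x =
  \int[lebesgue_rV R n]_y \int[lebesgue_measure]_a g (rV_cons (a, y)).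
Proof.
move=> mg g0.
have mcons := @measurable_rV_cons R n.
have -> : \int[lebesgue_rV R n.+1]_x g x =
    \int[pushforward (lebesgue_measure \x^ lebesgue_rV R n) (@rV_cons R n)]_x g x by [].
rewrite ge0_integral_pushforward// preimage_setT.
transitivity (\int[lebesgue_measure \x @lebesgue_rVs n]_x (g \o @rV_cons R n) x).
  (* The products taken in the two orders agree on rectangles, hence everywhere. *)
  apply: eq_measure_integral => /= A mA _; apply/esym.
  apply: (@product_measure_unique _ _ _ _ _ lebesgue_measure (@lebesgue_rVs n)
    (lebesgue_measure \x^ lebesgue_rV R n)) => // A1 A2 mA1 mA2.
  by rewrite /= product_measure2E.
rewrite fubini_tonelli2//; last by move=> x; exact: g0.
exact: (measurableT_comp mg mcons).
Qed.

Lemma measurable_affine_rV n (l : R) (v : 'rV[R]_n) :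
  measurable_fun setT (fun z : 'rV[R]_n => l *: z + v)%R.
Proof.
apply: measurable_fun_rV => i.
rewrite (_ : (fun t => _) = (fun x : R => l * x + v ord0 i)%R \o (fun x : 'rV[R]_n => x ord0 i)).
  by apply: measurableT_comp; [exact: measurable_affine|exact: measurable_coord].
by apply/funext => z /=; rewrite !mxE.
Qed.

(** Induction on the dimension: each coordinate contributes one factor [|l|]. Dilations give the
    scaling of the kernel integrals, [l = 1] translations and [l = -1] reflections. *)
Lemma ge0_integral_rV_affine n (l : R) (v : 'rV[R]_n) (g : 'rV[R]_n -> \bar R) :
  (l != 0)%R -> measurable_fun setT g -> (forall x, 0 <= g x) ->
  \int[lebesgue_rV R n]_x g x =
  (`|l| ^+ n)%R%:E * \int[lebesgue_rV R n]_x g (l *: x + v)%R.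
Proof.
move=> l0; elim: n v g => [|n IH] v g mg g0.
  rewrite expr0 mul1e; apply: eq_integral => x _; congr g.
  by apply/rowP => -[].
rewrite ge0_integral_rV_cons//.
have mcons := @measurable_rV_cons R n.
have mga : measurable_fun setT (fun z : 'rV[R]_n.+1 => g (l *: z + v)%R).
  by apply: (measurableT_comp mg); exact: measurable_affine_rV.
rewrite [in RHS]ge0_integral_rV_cons//.
pose va := v ord0 (lshift n ord0 : 'I_(1 + n)).
pose vy : 'rV[R]_n := (\row_j v ord0 (rshift 1 j : 'I_(1 + n)))%R.
pose G (y : 'rV[R]_n) := \int[lebesgue_measure]_a g (rV_cons (a, y)).
have mG : measurable_fun setT G.
  apply: (@measurable_fun_fubini_tonelli_G _ _ _ _ _ lebesgue_measure
    (g \o @rV_cons R n)); first exact: (measurableT_comp mg mcons).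
  by move=> x; exact: g0.
have G0 y : 0 <= G y by exact: integral_ge0.
rewrite (IH vy G mG G0).
rewrite exprSr EFinM -muleA; congr (_ * _).
rewrite -ge0_integralZl//; last first.
- by move=> y _; exact: integral_ge0.
- apply: (@measurable_fun_fubini_tonelli_G _ _ _ _ _ lebesgue_measure
    ((fun z : 'rV[R]_n.+1 => g (l *: z + v)%R) \o @rV_cons R n)).
    exact: (measurableT_comp mga mcons).
  by move=> x; exact: g0.
apply: eq_integral => y _; rewrite /G.
rewrite (ge0_integral_affine va l0)//.
  congr (_ * _); apply: eq_integral => a _; congr g; apply/rowP => i.
  rewrite [RHS]mxE [X in _ = (X + _)%R]mxE.
  case: (@split_ordP 1 n i) => j ->.
    rewrite /rV_cons (row_mxEl (l * a + va)%:M (l *: y + vy) ord0 j).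
    rewrite (row_mxEl a%:M y ord0 j) !mxE (ord1 j) eqxx !mulr1n //.
  rewrite /rV_cons (row_mxEr (l * a + va)%:M (l *: y + vy) ord0 j).
  by rewrite (row_mxEr a%:M y ord0 j) !mxE.
apply: (measurableT_comp mg).
apply: (measurableT_comp (@measurable_rV_cons R n)).
exact: measurable_pair2.
Qed.

End lebesgue_rV_theory.

Section isometric_change_of_variable.
Context (R : realType) (n : nat).
Local Notation mu := (lebesgue_rV R n).
Local Open Scope ereal_scope.
Implicit Types (l : R) (v : 'rV[R]_n) (D : set 'rV[R]_n).

Lemma measurable_preimage_affine_rV l v D : measurable D ->
  measurable ((fun z => (l *: z + v)%R) @^-1` D).
Proof.
move=> mD; have := @measurable_affine_rV R n l v measurableT D mD.
by rewrite setTI.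
Qed.

Lemma ge0_integral_rV_affine_in l v D (g : 'rV[R]_n -> \bar R) :
  (l != 0)%R -> measurable D -> measurable_fun D g ->
  (forall x, D x -> 0 <= g x) ->
  \int[mu]_(x in D) g x =
  (`|l| ^+ n)%R%:E *
  \int[mu]_(x in (fun z => (l *: z + v)%R) @^-1` D) g (l *: x + v)%R.
Proof.
move=> l0 mD mg g0; rewrite integral_mkcond (ge0_integral_rV_affine v l0); last 2 first.
- exact/(measurable_restrictT _ mD).
- by move=> x; rewrite /patch; case: ifPn => //; rewrite inE; exact: g0.
by rewrite [in RHS]integral_mkcond; congr (_ * _); apply: eq_integral.
Qed.

(** With [|l| = 1] there is no Jacobian, so the positive and negative parts can be subtracted
    without any integrability assumption. *)
Lemma integral_rV_isometry l v D (f : 'rV[R]_n -> \bar R) :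
  `|l|%R = 1%R -> measurable D -> measurable_fun D f ->
  \int[mu]_(x in D) f x =
  \int[mu]_(x in (fun z => (l *: z + v)%R) @^-1` D) f (l *: x + v)%R.
Proof.
move=> l1 mD mf.
have l0 : (l != 0)%R by rewrite -normr_gt0 l1.
rewrite integralE [RHS]integralE.
rewrite (@ge0_integral_rV_affine_in l v D f^\+)//; last exact: measurable_funepos.
rewrite (@ge0_integral_rV_affine_in l v D f^\-)//; last exact: measurable_funeneg.
by rewrite l1 expr1n !mul1e; congr (_ - _); apply: eq_integral => x _; rewrite ?funeposE ?funenegE.
Qed.

Lemma measurable_fun_rV_affine l v D (f : 'rV[R]_n -> \bar R) :
  measurable D -> measurable_fun D f ->
  measurable_fun ((fun z => (l *: z + v)%R) @^-1` D) (fun x => f (l *: x + v)%R).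
Proof.
move=> mD mf; apply: (measurable_comp mD _ mf).
  by move=> x [y hy <-].
by apply: measurable_funS (measurable_affine_rV l v).
Qed.

Lemma integrable_rV_isometry l v D (f : 'rV[R]_n -> \bar R) :
  `|l|%R = 1%R -> measurable D -> mu.-integrable D f ->
  mu.-integrable ((fun z => (l *: z + v)%R) @^-1` D) (fun x => f (l *: x + v)%R).
Proof.
move=> l1 mD /integrableP[mf foo]; apply/integrableP; split.
  exact: measurable_fun_rV_affine.
move: foo; rewrite (integral_rV_isometry v l1)//.
exact: measurableT_comp.
Qed.

Lemma tonelli_rV (f : 'rV[R]_n * 'rV[R]_n -> \bar R) :
  measurable_fun setT f -> (forall x, 0 <= f x) ->
  \int[mu]_x \int[mu]_y f (x, y) = \int[mu]_y \int[mu]_x f (x, y).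
Proof.
move=> mf f0.
exact: (@fubini_tonelli _ _ _ _ R (@lebesgue_rVs R n) (@lebesgue_rVs R n)).
Qed.

Lemma measurable_tonelli_rV (f : 'rV[R]_n * 'rV[R]_n -> \bar R) :
  measurable_fun setT f -> (forall x, 0 <= f x) ->
  measurable_fun setT (fun x => \int[mu]_y f (x, y)).
Proof.
move=> mf f0.
exact: (@measurable_fun_fubini_tonelli_F _ _ _ _ R (@lebesgue_rVs R n) f mf f0).
Qed.

End isometric_change_of_variable.

Lemma ge0_le_integral_setU d (T : measurableType d) (R : realType)
    (mu : {measure set T -> \bar R}) (A B : set T) (g : T -> \bar R) :
  measurable A -> measurable B -> measurable_fun setT g ->
  (forall x, 0 <= g x)%E ->
  (\int[mu]_(x in A `|` B) g x <=
   \int[mu]_(x in A) g x + \int[mu]_(x in B) g x)%E.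
Proof.
move=> mA mB mg g0.
have mr D : measurable D -> measurable_fun setT (g \_ D).
  by move=> mD; apply/(measurable_restrictT _ mD); exact: measurable_funTS.
have r0 D x : (0 <= (g \_ D) x)%E by rewrite /patch; case: ifPn.
rewrite (integral_mkcond (A `|` B)) (integral_mkcond A) (integral_mkcond B).
rewrite -ge0_integralD//; [|exact: mr..].
apply: ge0_le_integral => //.
- by apply: mr; exact: measurableU.
- by apply: emeasurable_funD; exact: mr.
- move=> x _; rewrite /patch in_setU.
  by case: (x \in A); case: (x \in B); rewrite /= ?adde0 ?add0e ?leeDl.
Qed.

Section homogeneous_integral.
Context (R : realType) (n : nat).
Local Notation mu := (lebesgue_rV R n).
Local Open Scope ereal_scope.

(* The ratio [q < 1] of consecutive shells makes the integral a convergent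
   geometric series, without any formula for the volume of a ball. *)
Lemma homogeneous_integral_le (g : 'rV[R]_n -> \bar R) (S : (set 'rV[R]_n)^nat)
    (l q I1 : R) :
  (0 < l)%R -> (0 <= q < 1)%R -> (0 <= I1)%R ->
  measurable_fun setT g -> (forall x, 0 <= g x) ->
  (forall x, (l ^+ n)%R%:E * g (l *: x)%R = q%:E * g x) ->
  (forall m, measurable (S m)) -> nondecreasing_seq S ->
  S 0%N = set0 ->
  (forall m x, S m.+1 x -> S 1%N x \/ S m (l^-1 *: x)%R) ->
  \int[mu]_(x in S 1%N) g x <= I1%:E ->
  \int[mu]_(x in \bigcup_m S m) g x <= (I1 / (1 - q))%:E.
Proof.
move=> l0 /andP[q0 q1] I10 mg g0 gl mS ndS S0 Sl gI1.
(* [I1 / (1 - q)] is the fixed point of [K |-> I1 + q K], the recursion between consecutive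
   [S m]. *)
have bnd m : \int[mu]_(x in S m) g x <= (I1 / (1 - q))%:E.
  elim: m => [|m IH].
    by rewrite S0 integral_set0 lee_fin divr_ge0// subr_ge0 ltW.
  pose T := (fun z : 'rV[R]_n => l^-1 *: z + 0)%R @^-1` S m.
  have mT : measurable T by exact: measurable_preimage_affine_rV.
  have : \int[mu]_(x in S m.+1) g x <= \int[mu]_(x in S 1%N `|` T) g x.
    apply: ge0_subset_integral => //; [exact: measurableU|exact: measurable_funTS|].
    by move=> x /Sl[]; [left|right; rewrite /T /= addr0].
  move=> /le_trans; apply; apply: le_trans (ge0_le_integral_setU _ _ _ _ _) _ => //.
  have -> : \int[mu]_(x in T) g x = q%:E * \int[mu]_(x in S m) g x.
    rewrite (ge0_integral_rV_affine_in (l := l) 0%R) ?gt_eqF//; last exact: measurable_funTS.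
    rewrite gtr0_norm// -ge0_integralZl//; [|exact: measurable_preimage_affine_rV| |]; last 2 first.
    - apply: measurable_fun_rV_affine => //; exact: measurable_funTS.
    - by rewrite lee_fin exprn_ge0// ltW.
    rewrite -ge0_integralZl//; last by exact: measurable_funTS.
    have -> : (fun z : 'rV[R]_n => l *: z + 0)%R @^-1` T = S m.
      apply/seteqP; split => z /=; rewrite /T /= !addr0 scalerA mulVf ?gt_eqF// scale1r//.
    by apply: eq_integral => x _; rewrite addr0 gl.
  have : \int[mu]_(x in S 1%N) g x + q%:E * \int[mu]_(x in S m) g x <=
      I1%:E + q%:E * (I1 / (1 - q))%:E.
    by apply: leeD => //; apply: lee_wpmul2l => //; rewrite lee_fin.
  move=> /le_trans; apply; rewrite -EFinM -EFinD lee_fin le_eqVlt; apply/orP; left.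
  by apply/eqP; field; rewrite gt_eqF// subr_gt0.
have /cvg_lim <- // := @ge0_nondecreasing_set_cvg_integral _ _ _ S g mu ndS mS
  (fun i => measurable_funTS mg) (fun i x _ => g0 x).
apply: lime_le; last by near=> k; exact: bnd.
exact: (cvgP _ (@ge0_nondecreasing_set_cvg_integral _ _ _ S g mu ndS mS
  (fun i => measurable_funTS mg) (fun i x _ => g0 x))).
Unshelve. all: by end_near. Qed.

End homogeneous_integral.

(** * The kernel of the fractional Laplacian *)

Section euclidean_norm.
Context (R : realType) (n : nat).
Implicit Types (z : 'rV[R]_n).

Lemma enorm_ge0 z : 0 <= enorm z.
Proof. exact: sqrtr_ge0. Qed.

Lemma sqr_enorm z : enorm z ^+ 2 = \sum_(i < n) z ord0 i ^+ 2.
Proof. by rewrite sqr_sqrtr// sumr_ge0// => i _; exact: sqr_ge0. Qed.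

Lemma enormZ (l : R) z : enorm (l *: z) = `|l| * enorm z.
Proof.
rewrite /enorm -sqrtr_sqr -sqrtrM ?sqr_ge0//; congr Num.sqrt.
by rewrite mulr_sumr; apply: eq_bigr => i _; rewrite mxE exprMn.
Qed.

Lemma enormN z : enorm (- z) = enorm z.
Proof. by rewrite -scaleN1r enormZ normrN1 mul1r. Qed.

Lemma enorm0 : enorm (0 : 'rV[R]_n) = 0.
Proof. by rewrite -(scale0r (0 : 'rV[R]_n)) enormZ normr0 mul0r. Qed.

Lemma coord_le_enorm z (i : 'I_n) : `|z ord0 i| <= enorm z.
Proof.
rewrite -sqrtr_sqr ler_wsqrtr// (bigD1 i)//= lerDl sumr_ge0// => j _.
exact: sqr_ge0.
Qed.

Lemma enorm_delta (i : 'I_n) : enorm (delta_mx ord0 i : 'rV[R]_n) = 1.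
Proof.
apply/eqP; rewrite -(@eqrXn2 _ 2)// ?enorm_ge0// expr1n sqr_enorm.
rewrite (bigD1 i)//= big1 ?addr0; first by rewrite mxE !eqxx !expr1n.
by move=> j /negbTE h; rewrite mxE eqxx h expr0n.
Qed.

Lemma norm_le_enorm z : `|z| <= enorm z.
Proof.
rewrite [`|z|]mx_normrE; apply: bigmax_le => [|[i j] _ /=]; first exact: enorm_ge0.
by rewrite (ord1 i) coord_le_enorm.
Qed.

Lemma coord_le_norm z (i : 'I_n) : `|z ord0 i| <= `|z|.
Proof.
rewrite [`|z|]mx_normrE.
exact: (le_bigmax _ (fun ij : 'I_1 * 'I_n => `|z ij.1 ij.2|) (ord0, i)).
Qed.

Lemma enorm_le_norm z : enorm z <= n%:R * `|z|.
Proof.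
have h : 0 <= n%:R * `|z| by rewrite mulr_ge0.
rewrite -(ler_pXn2r (_ : (0 < 2)%N)) ?nnegrE ?enorm_ge0// sqr_enorm.
apply: (@le_trans _ _ (\sum_(i < n) `|z| ^+ 2)).
  apply: ler_sum => i _; rewrite -real_normK ?num_real//.
  by rewrite ler_pXn2r ?nnegrE// coord_le_norm.
rewrite sumr_const card_ord exprMn -[_ *+ n]mulr_natl ler_wpM2r ?sqr_ge0//.
by rewrite -natrX ler_nat; case: (n) => // m; rewrite expnS expn1 leq_pmulr.
Qed.

Lemma enorm_eq0 z : enorm z = 0 -> z = 0.
Proof.
move=> h; apply/rowP => i; rewrite mxE; apply/eqP; rewrite -normr_eq0.
by rewrite eq_le normr_ge0 andbT -h coord_le_enorm.
Qed.

Lemma measurable_coordR (i : 'I_n) : measurable_fun setT (fun z : 'rV[R]_n => z ord0 i).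
Proof. exact: measurable_coord. Qed.

Lemma measurable_enorm : measurable_fun setT (fun z => enorm z).
Proof.
have ms : measurable_fun setT (@Num.sqrt R).
  by apply: continuous_measurable_fun; exact: sqrt_continuous.
apply: (measurableT_comp ms).
apply/measurable_EFinP; rewrite (_ : _ \o _ =
    fun z : 'rV[R]_n => (\sum_(i < n) (z ord0 i ^+ 2)%:E)%E); last first.
  by apply/funext => z /=; rewrite sumEFin.
apply: emeasurable_sum => i; apply/measurable_EFinP.
by apply: measurable_funX; exact: measurable_coordR.
Qed.

Lemma measurable_enorm_gt (e : R) : measurable [set z : 'rV[R]_n | e < enorm z].
Proof.
have := measurable_enorm measurableT (measurable_itv `]e, +oo[).
by rewrite setTI; congr measurable; apply/seteqP; split => z /=; rewrite in_itv/= andbT.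
Qed.

Lemma measurable_enorm_le (e : R) : measurable [set z : 'rV[R]_n | enorm z <= e].
Proof.
have := measurable_enorm measurableT (measurable_itv `]-oo, e]).
by rewrite setTI; congr measurable; apply/seteqP; split => z /=; rewrite in_itv/=.
Qed.

Lemma measurable_coord_gt (i : 'I_n) (e : R) :
  measurable [set z : 'rV[R]_n | e < z ord0 i].
Proof.
have := @measurable_coord R n i measurableT _ (measurable_itv `]e, +oo[).
by rewrite setTI; congr measurable; apply/seteqP; split => z /=; rewrite in_itv/= andbT.
Qed.

End euclidean_norm.

Section kernel.
Context (R : realType) (n : nat) (s : R) (s01 : 0 < s < 1).
Local Notation mu := (lebesgue_rV R n).
Implicit Types (z : 'rV[R]_n).

(** The singularity is harmless in the code: for a positive exponent [kern 0 = 0]. *)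
Definition kern z : R := (enorm z `^ (n%:R + 2 * s))^-1.

Lemma kern_ge0 z : 0 <= kern z.
Proof. by rewrite invr_ge0 powR_ge0. Qed.

Lemma kernN z : kern (- z) = kern z.
Proof. by rewrite /kern enormN. Qed.

Lemma kernZ (l : R) z : kern (l *: z) = `|l| `^ (- (n%:R + 2 * s)) * kern z.
Proof. by rewrite /kern enormZ powRM ?enorm_ge0// invfM powRN. Qed.

Let q_gt0 : 0 < n%:R + 2 * s.
Proof. by case/andP: s01 => ? _; rewrite ltr_wpDl// mulr_gt0. Qed.

Lemma kern_le1 z : 1 <= enorm z -> kern z <= 1.
Proof.
move=> h; rewrite /kern invf_le1 ?powR_gt0 ?(lt_le_trans ltr01)//.
by rewrite -[leLHS](powRr0 (enorm z)) ler_powR// ltW.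
Qed.

Lemma le_kern z (r : R) : 0 < enorm z <= r -> (r `^ (n%:R + 2 * s))^-1 <= kern z.
Proof.
move=> /andP[z0 zr]; have r0 := lt_le_trans z0 zr.
rewrite /kern lef_pV2 ?posrE ?powR_gt0//.
by rewrite ge0_ler_powR ?nnegrE ?(ltW q_gt0) ?enorm_ge0 ?(ltW r0).
Qed.

Lemma measurable_kern : measurable_fun setT kern.
Proof.
rewrite (_ : kern = (fun x => x `^ (- (n%:R + 2 * s))) \o (@enorm R n)); last first.
  by apply/funext => z; rewrite /= powRN.
exact: (measurableT_comp (@measurable_powR R (- (n%:R + 2 * s))) (@measurable_enorm R n)).
Qed.

(** The factor [l ^+ n] is the Jacobian of the dilation by [l]. *)
Lemma kern_homogeneous (l : R) z : 0 < l ->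
  l ^+ n * kern (l *: z) = l `^ (- (2 * s)) * kern z.
Proof.
move=> l0; rewrite kernZ gtr0_norm// mulrA; congr (_ * _).
rewrite -powR_mulrn ?(ltW l0)// -powRD; last by rewrite (gt_eqF l0) implybT.
by congr (_ `^ _); ring.
Qed.

(** What remains of the kernel after a second difference of a [C^{1,1}] function; it is integrable
    near 0 because [s < 1]. *)
Definition moment z : R := enorm z ^+ 2 * kern z.

Lemma moment_ge0 z : 0 <= moment z.
Proof. by rewrite mulr_ge0 ?kern_ge0 ?sqr_ge0. Qed.

Lemma measurable_moment : measurable_fun setT moment.
Proof.
apply: measurable_funM; last exact: measurable_kern.
by apply: measurable_funX; exact: measurable_enorm.
Qed.

Lemma moment_homogeneous (l : R) z : 0 < l ->
  l ^+ n * moment (l *: z) = l `^ (2 - 2 * s) * moment z.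
Proof.
move=> l0; rewrite /moment enormZ (gtr0_norm l0) exprMn.
transitivity (l ^+ 2 * enorm z ^+ 2 * (l ^+ n * kern (l *: z))); first by ring.
rewrite kern_homogeneous//.
have -> : l `^ (2 - 2 * s) = l ^+ 2 * l `^ (- (2 * s)).
    by rewrite -powR_mulrn ?(ltW l0)// -powRD// (gt_eqF l0) implybT.
by ring.
Qed.

End kernel.

Section kernel_integrals.
Context (R : realType) (n : nat) (s : R) (s01 : 0 < s < 1).
Local Notation mu := (lebesgue_rV R n).
Local Notation kern := (@kern R n s).
Local Notation moment := (@moment R n s).
Implicit Types (z : 'rV[R]_n).
Local Open Scope ereal_scope.

Let s0 : (0 < s)%R. Proof. by case/andP: s01. Qed.
Let s1 : (s < 1)%R. Proof. by case/andP: s01. Qed.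

Lemma le_integral_cube (D : set 'rV[R]_n) (g : 'rV[R]_n -> R) (k M : R) :
  (0 <= k)%R -> (0 <= M)%R -> measurable D -> measurable_fun D g ->
  D `<=` @cube R n k -> (forall z, D z -> 0 <= g z <= M)%R ->
  \int[mu]_(z in D) (g z)%:E <= (M * (k *+ 2) ^+ n)%:E.
Proof.
move=> k0 M0 mD mg Dk gM.
apply: (@le_trans _ _ (\int[mu]_(z in D) M%:E)).
  apply: ge0_le_integral => //.
  - by move=> z Dz; rewrite lee_fin; case/andP: (gM z Dz).
  - exact/measurable_EFinP.
  - by move=> z Dz; rewrite lee_fin; case/andP: (gM z Dz).
rewrite integral_cst// EFinM; apply: lee_wpmul2l; first by rewrite lee_fin.
rewrite -lebesgue_rV_cube//; apply: le_measure; rewrite ?inE//.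
exact: measurable_cube.
Qed.

Lemma enorm_le_cube z k : (enorm z <= k)%R -> @cube R n k z.
Proof.
by move=> h i; rewrite -ler_norml (le_trans _ h)// coord_le_enorm.
Qed.

Lemma powR_archimedean (r : R) : exists m : nat, (r <= 2 ^+ m)%R.
Proof.
exists (Num.truncn `|r|).+1; apply: (le_trans (ler_norm r)).
apply: (le_trans (ltW (truncnS_gt _))).
by rewrite -natrX ler_nat ltnW// ltn_expl.
Qed.

(** Dyadic shells, with ratio [2^(-2s) < 1] since [s > 0]. *)
Lemma tail1_lty : \int[mu]_(z in [set z | 1 < enorm z]%R) (kern z)%:E < +oo.
Proof.
pose S m := [set z : 'rV[R]_n | (1 < enorm z) && (enorm z <= 2 ^+ m)]%R.
have mS m : measurable (S m).
  rewrite (_ : S m = [set z | 1 < enorm z]%R `&` [set z | enorm z <= 2 ^+ m]%R).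
    by apply: measurableI; [exact: measurable_enorm_gt|exact: measurable_enorm_le].
  by apply/seteqP; split => z /=; rewrite /S /=; [move/andP|case=> -> ->].
have -> : [set z | 1 < enorm z]%R = \bigcup_m S m.
  apply/seteqP; split => z /=; last by move=> [m _ /andP[]].
  move=> z1; have [m hm] := powR_archimedean (enorm z).
  by exists m => //; rewrite /S /= z1.
apply: le_lt_trans (ltry _).
apply: (@homogeneous_integral_le R n (EFin \o kern) S 2%R (2 `^ (- (2 * s)))%R (4 ^+ n)%R);
  [by []| |by rewrite exprn_ge0| | | |exact: mS| | | |].
- rewrite powR_ge0 /= powRN invf_lt1 ?powR_gt0//.
  rewrite [ltLHS](_ : _ = 1 `^ (2 * s))%R; last by rewrite powR1.
  by rewrite gt0_ltr_powR ?nnegrE ?mulr_gt0 ?ltr1n.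
- by apply/measurable_EFinP; exact: measurable_kern.
- by move=> x /=; rewrite lee_fin kern_ge0.
- by move=> x /=; rewrite -!EFinM kern_homogeneous.
- move=> m1 m2 m12; apply/subsetPset => z /andP[z1 z2]; apply/andP; split => //.
  by rewrite (le_trans z2)// ler_weXn2l// ler1n.
- by apply/seteqP; split => z //= /andP[z1]; rewrite expr0 leNgt z1.
- move=> m z /andP[z1 z2]; have [h|h] := leP (enorm z) 2%R.
    by left; apply/andP; split; rewrite ?expr1.
  right; apply/andP; rewrite enormZ ger0_norm ?invr_ge0// mulrC ltr_pdivlMr// mul1r.
  by rewrite ler_pdivrMr// -exprSr.
(* The first shell lies in a cube of side 4, where the kernel is at most 1. *)
- rewrite -[(4 ^+ n)%R]mul1r (_ : 4%R = 2 *+ 2)%R; last by lra.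
  apply: le_integral_cube => //.
  + by apply: measurable_funTS; exact: measurable_kern.
  + by move=> z /andP[_]; rewrite expr1 => /enorm_le_cube.
  + by move=> z /andP[z1 _]; rewrite kern_ge0/= kern_le1// ltW.
Qed.

Lemma moment1_lty : \int[mu]_(z in [set z | enorm z <= 1]%R) (moment z)%:E < +oo.
Proof.
pose S m := [set z : 'rV[R]_n | (2^-1 ^+ m < enorm z) && (enorm z <= 1)]%R.
have mS m : measurable (S m).
  rewrite (_ : S m = [set z | 2^-1 ^+ m < enorm z]%R `&` [set z | enorm z <= 1]%R).
    by apply: measurableI; [exact: measurable_enorm_gt|exact: measurable_enorm_le].
  by apply/seteqP; split => z /=; rewrite /S /=; [move/andP|case=> -> ->].
have -> : \int[mu]_(z in [set z | enorm z <= 1]%R) (moment z)%:E =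
    \int[mu]_(z in \bigcup_m S m) (moment z)%:E.
  rewrite integral_mkcond [RHS]integral_mkcond; apply: eq_integral => z _.
  rewrite /patch; case: ifPn.
    rewrite inE => z1; case: ifPn => //; rewrite notin_setE => h.
    (* The shells miss only the origin, where [moment] vanishes. *)
    suff -> : z = 0%R by rewrite /moment enorm0 expr0n mul0r.
    apply: enorm_eq0; apply/eqP/negPn/negP => z0; apply: h.
    have {}z0 : (0 < enorm z)%R by rewrite lt0r z0 enorm_ge0.
    have [m hm] := powR_archimedean ((enorm z)^-1 + 1).
    exists m => //; apply/andP; split => //.
    rewrite exprVn invf_plt ?posrE ?exprn_gt0//; apply: lt_le_trans hm.
    by rewrite ltrDl.
  by rewrite notin_setE => z1; case: ifPn => //; rewrite inE => -[m _ /andP[]].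
apply: le_lt_trans (ltry _).
apply: (@homogeneous_integral_le R n (EFin \o moment) S 2^-1%R (2^-1 `^ (2 - 2 * s))%R
  ((2^-1 `^ (n%:R + 2 * s))^-1 * (1 *+ 2) ^+ n)%R);
  [by rewrite invr_gt0| |by rewrite mulr_ge0 ?invr_ge0 ?powR_ge0 ?exprn_ge0| | | |exact: mS| | | |].
- rewrite powR_ge0 /=; rewrite [ltRHS](_ : _ = 1 `^ (2 - 2 * s))%R; last by rewrite powR1.
  rewrite gt0_ltr_powR ?nnegrE//.
  + by rewrite subr_gt0 gtr_pMr.
  + by rewrite invf_lt1// ltr1n.
- by apply/measurable_EFinP; exact: measurable_moment.
- by move=> x /=; rewrite lee_fin moment_ge0.
- by move=> x /=; rewrite -!EFinM moment_homogeneous// invr_gt0.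
- move=> m1 m2 m12; apply/subsetPset => z /andP[z1 z2]; apply/andP; split => //.
  by rewrite (le_lt_trans _ z1)// ler_wiXn2l// ?invf_le1// ler1n.
- by apply/seteqP; split => z //= /andP[z1]; rewrite leNgt z1.
- move=> m z /andP[z1 z2]; have [h|h] := ltP 2^-1%R (enorm z).
    by left; apply/andP; split; rewrite ?expr1.
  right; apply/andP; rewrite invrK enormZ ger0_norm//.
  by rewrite -ltr_pdivrMl// -exprS z1 -ler_pdivlMl// mulr1.
- apply: le_integral_cube => //.
  + by apply: measurable_funTS; exact: measurable_moment.
  + by move=> z /andP[_] /enorm_le_cube.
  + move=> z /andP[]; rewrite expr1 => z1 z2; rewrite moment_ge0/= /moment.
    have zp : (0 < enorm z)%R by exact: lt_trans z1.
    have h : (kern z <= (2^-1 `^ (n%:R + 2 * s))^-1)%R.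
      rewrite /kern lef_pV2 ?posrE ?powR_gt0 ?invr_gt0//.
      rewrite ge0_ler_powR ?nnegrE ?enorm_ge0 ?invr_ge0 ?ltW//.
      by rewrite ltr_wpDl// mulr_gt0.
    apply: le_trans h; rewrite ler_piMl ?kern_ge0// expr_le1// enorm_ge0//.
Qed.

Definition tailc : R := fine (\int[mu]_(z in [set z | 1 < enorm z]%R) (kern z)%:E).
Definition momentc : R := fine (\int[mu]_(z in [set z | enorm z <= 1]%R) (moment z)%:E).

Lemma tailc_ge0 : (0 <= tailc)%R.
Proof. by apply: fine_ge0; apply: integral_ge0 => z _; rewrite lee_fin kern_ge0. Qed.

Lemma momentc_ge0 : (0 <= momentc)%R.
Proof. by apply: fine_ge0; apply: integral_ge0 => z _; rewrite lee_fin moment_ge0. Qed.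

Lemma homogeneous_integral_scale (g : 'rV[R]_n -> R) (D De : set 'rV[R]_n) (e q : R) :
  (0 < e)%R -> measurable De -> measurable_fun setT g -> (forall z, 0 <= g z)%R ->
  (forall z, e ^+ n * g (e *: z) = q * g z)%R -> (0 <= q)%R ->
  (fun z => e *: z + 0)%R @^-1` De = D ->
  \int[mu]_(z in De) (g z)%:E = q%:E * \int[mu]_(z in D) (g z)%:E.
Proof.
move=> e0 mDe mg g0 ge q0 DE.
have mD : measurable D by rewrite -DE; exact: measurable_preimage_affine_rV.
have mEg : measurable_fun setT (EFin \o g) by exact/measurable_EFinP.
rewrite (@ge0_integral_rV_affine_in R n e 0%R De (EFin \o g)) ?gt_eqF//; last 2 first.
- exact: measurable_funTS.
- by move=> x _; rewrite lee_fin.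
rewrite DE gtr0_norm// -!ge0_integralZl//; last 5 first.
- by apply: measurable_funTS.
- by move=> x _; rewrite lee_fin.
- by rewrite -DE; apply: (@measurable_fun_rV_affine _ _ _ _ _ (EFin \o g)) => //; exact: measurable_funTS.
- by move=> x _; rewrite lee_fin.
- by rewrite lee_fin exprn_ge0// ltW.
by apply: eq_integral => z _; rewrite addr0 /= -!EFinM ge.
Qed.

Lemma tail_integral (e : R) : (0 < e)%R ->
  \int[mu]_(z in [set z | e < enorm z]%R) (kern z)%:E = (e `^ (- (2 * s)) * tailc)%:E.
Proof.
move=> e0; rewrite EFinM fineK; last first.
  by rewrite ge0_fin_numE ?tail1_lty//; apply: integral_ge0 => z _; rewrite lee_fin kern_ge0.
apply: (homogeneous_integral_scale (e := e)).
- exact: e0.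
- exact: measurable_enorm_gt.
- exact: measurable_kern.
- exact: kern_ge0.
- by move=> z; exact: kern_homogeneous.
- exact: powR_ge0.
- apply/seteqP; split => z /=; rewrite addr0 enormZ gtr0_norm//.
    by rewrite -[X in (X < _)%R -> _]mulr1 ltr_pM2l.
  by move=> h; rewrite -[X in (X < _)%R]mulr1 ltr_pM2l.
Qed.

Lemma moment_integral (e : R) : (0 < e)%R ->
  \int[mu]_(z in [set z | enorm z <= e]%R) (moment z)%:E = (e `^ (2 - 2 * s) * momentc)%:E.
Proof.
move=> e0; rewrite EFinM fineK; last first.
  by rewrite ge0_fin_numE ?moment1_lty//; apply: integral_ge0 => z _; rewrite lee_fin moment_ge0.
apply: (homogeneous_integral_scale (e := e)).
- exact: e0.
- exact: measurable_enorm_le.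
- exact: measurable_moment.
- exact: moment_ge0.
- by move=> z; exact: moment_homogeneous.
- exact: powR_ge0.
- apply/seteqP; split => z /=; rewrite addr0 enormZ gtr0_norm//.
    by rewrite -[X in (_ <= X)%R -> _]mulr1 ler_pM2l.
  by move=> h; rewrite -[X in (_ <= X)%R]mulr1 ler_pM2l.
Qed.

End kernel_integrals.

Lemma sin_le_norm (R : realType) (x : R) : `|sin x| <= `|x|.
Proof.
wlog x0 : x / 0 <= x => [h|].
  have [/h//|/ltW x0] := leP 0 x.
  by rewrite -normrN -sinN -(normrN x) h// oppr_ge0.
have [|y _] := @MVT_segment R sin cos 0 x x0 (fun y _ => is_derive_sin y).
  by apply: continuous_subspaceT; exact: continuous_sin.
by rewrite sin0 !subr0 => ->; rewrite normrM ler_piMl// cos_max.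
Qed.

Lemma one_minus_cos_le (R : realType) (x : R) : 1 - cos x <= x ^+ 2.
Proof.
wlog x0 : x / 0 <= x => [h|].
  have [/h//|/ltW x0] := leP 0 x.
  by rewrite -cosN -sqrrN h// oppr_ge0.
have [|y /itvP ySx] := @MVT_segment R cos (fun y => - sin y) 0 x x0 (fun y _ => is_derive_cos y).
  by apply: continuous_subspaceT; exact: continuous_cos.
rewrite cos0 subr0 => /eqP; rewrite -opprB eqr_oppLR => /eqP ->; rewrite mulNr opprK.
rewrite expr2 ler_wpM2r//; apply: (le_trans (ler_norm _)).
by apply: (le_trans (sin_le_norm y)); rewrite ger0_norm ySx.
Qed.

Section kernel_positivity.
Context (R : realType) (n : nat) (s : R) (s01 : 0 < s < 1).
Local Notation mu := (lebesgue_rV R n).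
Local Notation kern := (@kern R n s).
Local Notation moment := (@moment R n s).
Implicit Types (z : 'rV[R]_n).
Local Open Scope ereal_scope.

(** The cube of side [c] centred at [(c, ..., c)]. It stays away from the origin and has all
    coordinates positive, so positive integrands have an explicit lower bound on it. *)
Definition box (c : R) : set 'rV[R]_n := [set z | forall i, c / 2 <= z ord0 i <= c * (3 / 2)]%R.

Lemma boxE (c : R) : (0 < c)%R -> (fun z => c *: z + const_mx c)%R @^-1` box c = cube 2^-1.
Proof.
move=> c0; apply/seteqP; split => z /= h i; have := h i; rewrite !mxE.
  by move=> /andP[h1 h2]; apply/andP; split; rewrite -(ler_pM2l c0); lra.
move=> /andP[h1 h2]; move: h1 h2; rewrite -(ler_pM2l c0) -[in X in _ -> X](ler_pM2l c0) => h1 h2.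
by apply/andP; split; lra.
Qed.

Lemma measurable_box (c : R) : (0 < c)%R -> measurable (box c).
Proof.
move=> c0; have -> : box c = (fun z => c^-1 *: z + const_mx (- 1))%R @^-1` cube 2^-1.
  apply/seteqP; split => z /= h i; have := h i; rewrite !mxE => /andP[h1 h2].
    by apply/andP; split; rewrite -(ler_pM2l c0) mulrDr mulVKf ?gt_eqF//; lra.
  move: h1 h2; rewrite -(ler_pM2l c0) mulrDr mulVKf ?gt_eqF// => h1.
  rewrite -(ler_pM2l c0) mulrDr mulVKf ?gt_eqF// => h2.
  by apply/andP; split; lra.
by apply: measurable_preimage_affine_rV; exact: measurable_cube.
Qed.

Lemma lebesgue_rV_box (c : R) : (0 < c)%R -> mu (box c) = (c ^+ n)%:E.
Proof.
move=> c0; have mB := measurable_box c0.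
transitivity (\int[mu]_(z in box c) (cst 1) z).
  by rewrite integral_cst// mul1e.
rewrite (@ge0_integral_rV_affine_in R n c (const_mx c))//; last by rewrite gt_eqF.
rewrite boxE//; transitivity ((`|c| ^+ n)%R%:E * \int[mu]_(z in cube 2^-1) (cst 1) z) => //.
rewrite integral_cst; last exact: measurable_cube.
have -> : mu (cube 2^-1) = 1.
  rewrite lebesgue_rV_cube//; have -> : (2^-1 *+ 2 = 1 :> R)%R by rewrite mulr2n; lra.
  by rewrite expr1n.
by rewrite !mule1 gtr0_norm.
Qed.

Lemma integral_box_ge (D : set 'rV[R]_n) (g : 'rV[R]_n -> R) (c M : R) :
  (0 < c)%R -> (0 <= M)%R -> measurable D -> measurable_fun D g ->
  box c `<=` D -> (forall z, D z -> 0 <= g z)%R -> (forall z, box c z -> M <= g z)%R ->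
  (M * c ^+ n)%:E <= \int[mu]_(z in D) (g z)%:E.
Proof.
move=> c0 M0 mD mg cD g0 gM; have mB := measurable_box c0.
apply: (@le_trans _ _ (\int[mu]_(z in box c) (g z)%:E)); last first.
  apply: ge0_subset_integral => //; exact/measurable_EFinP.
rewrite EFinM -lebesgue_rV_box// -integral_cst//.
apply: ge0_le_integral => //.
- by apply/measurable_EFinP; apply: measurable_funS mg.
Qed.

Lemma box_coord (i : 'I_n) (c : R) z : (0 < c)%R -> box c z -> (c / 2 <= enorm z)%R.
Proof.
move=> c0 /(_ i)/andP[h _]; apply: le_trans h _.
by apply: le_trans (coord_le_enorm z i); exact: ler_norm.
Qed.

Lemma box_enorm (c : R) z : (0 < c)%R -> box c z -> (enorm z <= n%:R * (c * (3 / 2)))%R.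
Proof.
move=> c0 h; apply: le_trans (enorm_le_norm z) _; rewrite ler_wpM2l//.
rewrite [(`|z|)%R]mx_normrE; apply: bigmax_le => [|[j i] _ /=]; first by lra.
rewrite (ord1 j); have /andP[h1 h2] := h i; rewrite ger0_norm//.
by apply: le_trans h1; lra.
Qed.

Lemma box_kern (i : 'I_n) (c : R) z : (0 < c)%R -> box c z ->
  (((n%:R * (c * (3 / 2))) `^ (n%:R + 2 * s))^-1 <= kern z)%R.
Proof.
move=> c0 h; apply: le_kern => //; rewrite box_enorm// andbT.
by apply: lt_le_trans (box_coord i c0 h); lra.
Qed.

(** The mass of the kernel beyond a hyperplane. Its positivity is what makes a jump of the lowest
    value visible to the operator. *)
Definition rightc (i : 'I_n) : R := fine (\int[mu]_(z in [set z : 'rV[R]_n | 1 < z ord0 i]%R) (kern z)%:E).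

Lemma right_sub_tail (i : 'I_n) (e : R) :
  [set z : 'rV[R]_n | e < z ord0 i]%R `<=` [set z | e < enorm z]%R.
Proof.
move=> z /= h; apply: lt_le_trans h _.
by apply: le_trans (coord_le_enorm z i); exact: ler_norm.
Qed.

Lemma right_integral (i : 'I_n) (e : R) : (0 < e)%R ->
  \int[mu]_(z in [set z : 'rV[R]_n | e < z ord0 i]%R) (kern z)%:E = (e `^ (- (2 * s)) * rightc i)%:E.
Proof.
move=> e0; rewrite EFinM fineK; last first.
  rewrite ge0_fin_numE; last by apply: integral_ge0 => z _; rewrite lee_fin kern_ge0.
  apply: le_lt_trans (tail1_lty n s01); apply: ge0_subset_integral => //.
  - exact: measurable_coord_gt.
  - exact: measurable_enorm_gt.
  - by apply/measurable_EFinP; apply: measurable_funTS; exact: measurable_kern.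
  - by move=> z _; rewrite lee_fin kern_ge0.
  - exact: right_sub_tail.
apply: (homogeneous_integral_scale (e := e)).
- exact: e0.
- exact: measurable_coord_gt.
- exact: measurable_kern.
- exact: kern_ge0.
- by move=> z; exact: kern_homogeneous.
- exact: powR_ge0.
- apply/seteqP; split => z /=; rewrite addr0 mxE.
    by rewrite -[X in (X < _)%R -> _]mulr1 ltr_pM2l.
  by move=> h; rewrite -[X in (X < _)%R]mulr1 ltr_pM2l.
Qed.

Lemma rightc_gt0 (i : 'I_n) : (0 < rightc i)%R.
Proof.
have c4 : (0 < 4 :> R)%R by [].
set M := (((n%:R * (4 * (3 / 2))) `^ (n%:R + 2 * s))^-1)%R : R.
have n0 : (0 < n)%N by apply: leq_ltn_trans (ltn_ord i).
have M0 : (0 < M)%R by rewrite invr_gt0 powR_gt0// mulr_gt0 ?ltr0n.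
have : (M * 4 ^+ n)%:E <= \int[mu]_(z in [set z : 'rV[R]_n | 1 < z ord0 i]%R) (kern z)%:E.
  apply: integral_box_ge => //.
  - exact: ltW.
  - exact: measurable_coord_gt.
  - by apply: measurable_funTS; exact: measurable_kern.
  - move=> z /(_ i)/andP[h _]; apply: lt_le_trans h; lra.
  - by move=> z _; exact: kern_ge0.
  - by move=> z h; exact: (box_kern i).
rewrite right_integral// powR1 mul1r lee_fin; apply: lt_le_trans.
by rewrite mulr_gt0// exprn_gt0.
Qed.

Lemma cos_integral_gt0 (i : 'I_n) :
  (0 < \int[mu]_z ((1 - cos (z ord0 i)) / enorm z `^ (n%:R + 2 * s)))%R.
Proof.
pose g z := ((1 - cos (z ord0 i)) * kern z)%R.
have mg : measurable_fun setT g.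
  apply: measurable_funM; last exact: measurable_kern.
  apply: measurable_funB => //.
  apply: (measurableT_comp (f := @cos R)); last exact: measurable_coordR.
  by apply: continuous_measurable_fun; exact: continuous_cos.
have g0 z : (0 <= g z)%R by rewrite mulr_ge0 ?kern_ge0// subr_ge0 cos_le1.
(* Finiteness matters as much as positivity: [fine +oo = 0], and then the constant would be
   [0^-1 = 0]. *)
rewrite /Rintegral; apply: fine_gt0; apply/andP; split.
  have n0 : (0 < n)%N by apply: leq_ltn_trans (ltn_ord i).
  pose M := (((n%:R * (1 * (3 / 2))) `^ (n%:R + 2 * s))^-1)%R : R.
  have M0 : (0 < M)%R by rewrite invr_gt0 powR_gt0// mulr_gt0 ?ltr0n.
  have C0 : (0 < 1 - cos (2^-1 : R))%R.
    have p2 := @pi_ge2 R.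
    by rewrite subr_gt0 -[ltRHS](@cos0 R) ltr_cos// !in_itv/=; lra.
  apply: (@lt_le_trans _ _ (((1 - cos (2^-1 : R)) * M) * 1 ^+ n)%:E).
    by rewrite lte_fin expr1n mulr1 mulr_gt0.
  apply: (@integral_box_ge setT g 1) => //.
  - by rewrite mulr_ge0// ltW.
  - move=> z h; apply: ler_pM; [exact: ltW|exact: ltW| |].
      have p2 := @pi_ge2 R.
      have /andP[h1 h2] := h i.
      rewrite lerD2l lerN2 leNgt ltr_cos ?in_itv/=; lra.
    exact: (box_kern i).
have mgE : measurable_fun setT (EFin \o g) by exact/measurable_EFinP.
have -> : setT = [set z : 'rV[R]_n | enorm z <= 1]%R `|` [set z | 1 < enorm z]%R.
  by apply/seteqP; split => z // _ /=; case: leP; [left|right].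
have mle := @measurable_enorm_le R n 1.
have mgt := @measurable_enorm_gt R n 1.
apply: le_lt_trans (ge0_le_integral_setU _ mle mgt mgE _) _.
  by move=> z; rewrite lee_fin.
apply: lte_add_pinfty.
  apply: le_lt_trans (moment1_lty n s01); apply: ge0_le_integral => //.
  - by move=> z _; rewrite lee_fin.
  - exact: measurable_funTS.
  - by apply/measurable_EFinP; apply: measurable_funTS; exact: measurable_moment.
  - move=> z _; rewrite lee_fin /g ler_wpM2r ?kern_ge0//.
    apply: le_trans (one_minus_cos_le _) _; rewrite -real_normK ?num_real//.
    by rewrite ler_pXn2r ?nnegrE ?enorm_ge0// coord_le_enorm.
apply: (@le_lt_trans _ _ (\int[mu]_(z in [set z | 1 < enorm z]%R) (2%:E * (kern z)%:E))).
  apply: ge0_le_integral => //.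
  - by move=> z _; rewrite lee_fin.
  - exact: measurable_funTS.
  - by apply/measurable_EFinP; apply: measurable_funM => //; apply: measurable_funTS; exact: measurable_kern.
  - move=> z _; rewrite -EFinM lee_fin /g ler_wpM2r ?kern_ge0//.
    by have := cos_geN1 (z ord0 i); lra.
rewrite ge0_integralZl//.
- by rewrite tail_integral// -EFinM ltry.
- by apply/measurable_EFinP; apply: measurable_funTS; exact: measurable_kern.
- by move=> z _; rewrite lee_fin kern_ge0.
Qed.

End kernel_positivity.

Lemma frac_lap_const_gt0 (R : realType) (n : nat) (hn : (2 <= n)%N) (s : R) :
  0 < s < 1 -> 0 < frac_lap_const hn s.
Proof. by move=> s01; rewrite invr_gt0; exact: cos_integral_gt0. Qed.

Section tail_space.
Context (R : realType) (n : nat) (s : R) (s01 : 0 < s < 1).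
Local Notation mu := (lebesgue_rV R n).
Local Notation kern := (@kern R n s).
Local Notation moment := (@moment R n s).
Implicit Types (v : 'rV[R]_n -> R) (x z : 'rV[R]_n).

Lemma compact_cube (k : R) : compact (@cube R n k).
Proof.
rewrite (_ : cube k = [set v : 'rV[R]_n | forall i, `[- k, k]%classic (v ord0 i)]).
  by apply: (@rV_compact _ n (fun=> `[- k, k]%classic)) => i; exact: segment_compact.
by apply/seteqP; split => z /= h i; have := h i; rewrite /= in_itv.
Qed.

Lemma L2s_measurable v : L2s s v -> measurable_fun setT v.
Proof.
move=> [hl _].
have -> : setT = \bigcup_(k : nat) (@cube R n k%:R).
  apply/esym/seteqP; split => // x _ /=.
  exists (Num.truncn (enorm x)).+1 => //.
  by apply: enorm_le_cube; apply: ltW; exact: truncnS_gt.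
apply/measurable_fun_bigcup; first by move=> k; exact: measurable_cube.
by move=> k; have /integrableP[/measurable_EFinP] := hl _ (@compact_cube k%:R).
Qed.

Lemma measurable_shift x v : measurable_fun setT v -> measurable_fun setT (fun z => v (x + z)).
Proof.
move=> mv; apply: (measurableT_comp mv).
have := @measurable_affine_rV R n 1 x; congr measurable_fun.
by apply/funext => z; rewrite scale1r addrC.
Qed.

Lemma measurable_opp x v : measurable_fun setT v -> measurable_fun setT (fun z => v (x - z)).
Proof.
move=> mv; apply: (measurableT_comp mv).
have := @measurable_affine_rV R n (-1) x; congr measurable_fun.
by apply/funext => z; rewrite scaleN1r addrC.
Qed.

Lemma integrable_kern (e c : R) : 0 < e ->
  mu.-integrable [set z | e < enorm z] (EFin \o (fun z => c * kern z)).
Proof.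
move=> e0; have mk : measurable_fun [set z | e < enorm z] kern.
  by apply: measurable_funTS; exact: measurable_kern.
have -> : EFin \o (fun z => c * kern z) = (fun z => c%:E * (EFin \o kern) z)%E by [].
apply: integrableZl; first exact: measurable_enorm_gt.
apply/integrableP; split; first exact/measurable_EFinP.
rewrite (eq_integral (EFin \o kern)); last first.
  by move=> z _ /=; rewrite ger0_norm ?kern_ge0.
by rewrite /= tail_integral// ltry.
Qed.

(** The kernel is centred at [x], the weight of [L_{2s}] at 0. Away from the singularity they are
    comparable, as [|x + z|] is at most a multiple of [|z|] when [|z| > e]. *)
Lemma kern_le_weight x (e : R) : 0 < e -> exists2 C : R, 0 < C &
  forall z, e < enorm z ->
    kern z <= C * (1 + enorm (x + z) `^ (n%:R + 2 * s))^-1.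
Proof.
move=> e0; set q := n%:R + 2 * s.
have q0 : 0 < q by case/andP: s01 => ? _; rewrite ltr_wpDl// mulr_gt0.
pose L := n%:R * (1 + `|x| / e).
exists (e `^ (- q) + (L + 1) `^ q).
  by rewrite ltr_wpDl ?powR_ge0// powR_gt0// ltr_wpDl// mulr_ge0// addr_ge0// divr_ge0// ltW.
move=> z ez; have z0 : 0 < enorm z := lt_trans e0 ez.
have D0 : 0 < 1 + enorm (x + z) `^ q by rewrite ltr_wpDr// powR_ge0.
rewrite ler_pdivlMr// /kern -/q -ler_pdivlMl; last by rewrite invr_gt0 powR_gt0.
rewrite invrK mulrC mulrDl; apply: lerD.
  rewrite powRN -ler_pdivrMl ?invr_gt0 ?powR_gt0// invrK mulr1.
  by rewrite ge0_ler_powR ?nnegrE ?(ltW q0) ?(ltW e0) ?enorm_ge0// ltW.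
have Lz : enorm (x + z) <= (L + 1) * enorm z.
  apply: le_trans (enorm_le_norm _) _.
  apply: (@le_trans _ _ (L * enorm z)); last by rewrite ler_wpM2r ?enorm_ge0// lerDl.
  rewrite /L -mulrA ler_wpM2l// mulrDl mul1r.
  have h1 := ler_normD x z; have h2 := norm_le_enorm z.
  have h3 : `|x| <= `|x| / e * enorm z.
    by rewrite mulrAC ler_pdivlMr// ler_wpM2l// ltW.
  by rewrite (le_trans h1)// addrC lerD.
have L1 : 0 <= L + 1 by rewrite addr_ge0// mulr_ge0// addr_ge0// divr_ge0// ltW.
rewrite -powRM ?enorm_ge0//.
by rewrite ge0_ler_powR ?nnegrE ?(ltW q0) ?enorm_ge0 ?mulr_ge0 ?enorm_ge0.
Qed.

Lemma L2s_integrable_tail v x (e : R) : L2s s v -> 0 < e ->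
  mu.-integrable [set z | e < enorm z] (EFin \o (fun z => v (x + z) * kern z)).
Proof.
move=> hv e0; have mv := L2s_measurable hv.
have mD := @measurable_enorm_gt R n e.
pose w (y : 'rV[R]_n) := `|v y| / (1 + enorm y `^ (n%:R + 2 * s)).
have q0 : 0 <= n%:R + 2 * s by case/andP: s01 => ? _; rewrite addr_ge0// mulr_ge0// ltW.
have D0 y : 0 < 1 + enorm y `^ (n%:R + 2 * s) :> R by rewrite ltr_wpDr// powR_ge0.
have mw : measurable_fun setT w.
  rewrite (_ : w = fun y => `|v y| * (1 + enorm y `^ (n%:R + 2 * s)) `^ (-1)); last first.
    by apply/funext => y; rewrite powR_inv1// ltW.
  apply: measurable_funM; first exact: measurableT_comp.
  apply: (measurableT_comp (@measurable_powR R (-1))).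
  apply: measurable_funD => //.
  exact: (measurableT_comp (@measurable_powR R _) (@measurable_enorm R n)).
have w0 y : 0 <= w y by rewrite divr_ge0// ltW.
have [C C0 hC] := kern_le_weight x e0.
apply/integrableP; split.
  apply/measurable_EFinP; apply: measurable_funTS; apply: measurable_funM.
    exact: measurable_shift.
  exact: measurable_kern.
have mwx : measurable_fun setT (fun z => (w (x + z))%:E).
  by apply/measurable_EFinP; exact: measurable_shift.
have mCw : measurable_fun setT (fun z => C%:E * (w (x + z))%:E)%E.
  exact: measurable_funeM.
apply: (@le_lt_trans _ _ (\int[mu]_(z in [set z | (e < enorm z)%R]) (C%:E * (w (x + z))%:E))%E).
  apply: ge0_le_integral => //.
  - apply/measurable_EFinP; apply: measurableT_comp => //.
    apply: measurable_funTS; apply: measurable_funM; first exact: measurable_shift.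
    exact: measurable_kern.
  - exact: measurable_funTS.
  - move=> z /= ez; rewrite -EFinM lee_fin normrM (ger0_norm (kern_ge0 _ _)).
    rewrite /w mulrCA ler_wpM2l//; exact: hC.
have [_ hw] := hv.
apply: (@le_lt_trans _ _ (\int[mu]_z (C%:E * (w (x + z))%:E))%E).
  apply: ge0_subset_integral => //.
  - by move=> z _; rewrite -EFinM lee_fin mulr_ge0// ltW.
rewrite ge0_integralZl//; last 2 first.
- by move=> z _; rewrite lee_fin.
- by rewrite lee_fin ltW.
apply: lte_mul_pinfty; [by rewrite lee_fin ltW|by []|].
have mwE : measurable_fun setT (EFin \o w) by exact/measurable_EFinP.
have := @integral_rV_isometry R n 1 x setT (EFin \o w) (normr1 R) measurableT mwE.
rewrite preimage_setT => E1.
have E2 : (\int[mu]_z (EFin \o w) (1 *: z + x)%R = \int[mu]_z (w (x + z))%:E)%E.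
  by apply: eq_integral => z _; rewrite /= scale1r (addrC z).
by rewrite -E2 -E1; exact: hw.
Qed.

End tail_space.

(** * The truncated and the principal value Laplacian *)

Lemma integrableZl_EFin d (T : measurableType d) (R : realType)
    (mu : {measure set T -> \bar R}) (D : set T) (c : R) (f : T -> R) :
  measurable D -> mu.-integrable D (EFin \o f) ->
  mu.-integrable D (EFin \o (fun x => c * f x)).
Proof.
move=> mD fi; have := integrableZl mD c fi; exact: eq_integrable.
Qed.

Section truncation.
Context (R : realType) (n : nat) (s : R) (s01 : 0 < s < 1).
Local Notation mu := (lebesgue_rV R n).
Local Notation kern := (@kern R n s).
Local Notation moment := (@moment R n s).
Context (v : 'rV[R]_n -> R) (hv : L2s s v).
Implicit Types (x z : 'rV[R]_n).

Definition trunc_lap x (e : R) : R :=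
  \int[mu]_(z in [set z | e < enorm z]) ((v x - v (x + z)) * kern z).

Lemma trunc_lapE x e :
  \int[mu]_(y in [set y | e < enorm (x - y)])
     ((v x - v y) / enorm (x - y) `^ (n%:R + 2 * s)) = trunc_lap x e.
Proof.
have mv := L2s_measurable hv.
have mD : measurable [set y | e < enorm (x - y)].
  have := @measurable_preimage_affine_rV R n (-1) x _ (@measurable_enorm_gt R n e).
  by congr measurable; apply/seteqP; split => y /=; rewrite scaleN1r addrC.
pose G (y : 'rV[R]_n) := (v x - v y) * kern (x - y).
have mG : measurable_fun setT G.
  apply: measurable_funM; first exact: measurable_funB.
  exact: (@measurable_opp R n x _ (@measurable_kern R n s)).
have mGD : measurable_fun [set y | e < enorm (x - y)] (EFin \o G).
  by apply/measurable_EFinP; exact: measurable_funTS.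
have E1 : (\int[mu]_(y in [set y | (e < enorm (x - y))%R])
      ((v x - v y) / enorm (x - y) `^ (n%:R + 2 * s))%:E =
    \int[mu]_(y in [set y | (e < enorm (x - y))%R]) (EFin \o G) y)%E.
  by apply: eq_integral => y _; rewrite /G /kern.
have DE : (fun z => 1 *: z + x) @^-1` [set y | e < enorm (x - y)] = [set z | e < enorm z].
  by apply/seteqP; split => z /=; rewrite scale1r opprD addrCA subrr addr0 enormN.
have E2 : (\int[mu]_(z in [set z | (e < enorm z)%R]) (EFin \o G) (1 *: z + x)%R =
    \int[mu]_(z in [set z | (e < enorm z)%R]) ((v x - v (x + z)) * kern z)%:E)%E.
  apply: eq_integral => z _; rewrite /G /= scale1r (addrC z x) opprD addrA subrr add0r.
  by rewrite kernN.
by rewrite /trunc_lap /Rintegral E1 (integral_rV_isometry x (normr1 R) mD mGD) DE E2.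
Qed.

Lemma integrable_diff x e : 0 < e ->
  mu.-integrable [set z | e < enorm z] (EFin \o (fun z => (v x - v (x + z)) * kern z)).
Proof.
move=> e0; rewrite (_ : _ \o _ = ((EFin \o (fun z => (v x * kern z)%R)) \-
    (EFin \o (fun z => (v (x + z) * kern z)%R)))%E); last first.
  by apply/funext => z /=; rewrite -EFinB mulrBl.
apply: integrableB; first exact: measurable_enorm_gt.
- exact: integrable_kern.
- exact: L2s_integrable_tail.
Qed.

Definition annulus (a b : R) := [set z : 'rV[R]_n | a < enorm z <= b].

Lemma measurable_annulus a b : measurable (annulus a b).
Proof.
rewrite (_ : annulus a b = [set z | a < enorm z] `&` [set z | enorm z <= b]).
  by apply: measurableI; [exact: measurable_enorm_gt|exact: measurable_enorm_le].
by apply/seteqP; split => z; rewrite /annulus /=; [move/andP|case=> -> ->].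
Qed.

Lemma integrable_moment (b : R) : 0 < b ->
  mu.-integrable [set z | enorm z <= b] (EFin \o moment).
Proof.
move=> b0; apply/integrableP; split.
  by apply/measurable_EFinP; apply: measurable_funTS; exact: measurable_moment.
rewrite (eq_integral (EFin \o moment)); last first.
  by move=> z _ /=; rewrite ger0_norm ?moment_ge0.
by rewrite /= moment_integral// ltry.
Qed.

Definition sdiff x z := v (x + z) + v (x - z) - 2 * v x.

(* Symmetrising [z -> - z] replaces first by second differences. *)
Lemma symmetrise x a (A : set 'rV[R]_n) : 0 < a -> measurable A ->
  A `<=` [set z | a < enorm z] -> (fun z => -1 *: z + 0) @^-1` A = A ->
  mu.-integrable A (EFin \o (fun z => - sdiff x z * kern z)) /\
  \int[mu]_(z in A) ((v x - v (x + z)) * kern z) =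
    2^-1 * \int[mu]_(z in A) (- sdiff x z * kern z).
Proof.
move=> a0 mA sA NA.
have iA : mu.-integrable A (EFin \o (fun z => (v x - v (x + z)) * kern z)).
  by apply: (integrableS _ _ _ (integrable_diff x a0)) => //; exact: measurable_enorm_gt.
pose F z := (v x - v (x + z)) * kern z; pose F' z := (v x - v (x - z)) * kern z.
have FF' : (fun z => (EFin \o F) (-1 *: z + 0)) = EFin \o F'.
  by apply/funext => z; rewrite /F /F' /= scaleN1r addr0 kernN.
have iAN : mu.-integrable A (EFin \o F').
  have := integrable_rV_isometry 0 (normrN1 R) mA iA.
  by rewrite NA FF'.
have E : \int[mu]_(z in A) F z = \int[mu]_(z in A) F' z.
  rewrite /Rintegral.
  by rewrite (integral_rV_isometry 0 (normrN1 R) mA (measurable_int _ iA)) NA FF'.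
have Eq z : - sdiff x z * kern z =
    (v x - v (x + z)) * kern z + (v x - v (x - z)) * kern z.
  by rewrite /sdiff; ring.
split.
  rewrite (_ : _ \o _ = ((EFin \o (fun z => ((v x - v (x + z)) * kern z)%R)) \+
    (EFin \o (fun z => ((v x - v (x - z)) * kern z)%R)))%E); last first.
    by apply/funext => z /=; rewrite Eq EFinD.
  exact: integrableD.
rewrite (eq_Rintegral _ (fun z _ => Eq z)) RintegralD// -E.
by move: (\int[mu]_(z in A) F z) => I; lra.
Qed.

Lemma trunc_lap_sym x a : 0 < a ->
  mu.-integrable [set z | a < enorm z] (EFin \o (fun z => - sdiff x z * kern z)) /\
  trunc_lap x a = 2^-1 * \int[mu]_(z in [set z | a < enorm z]) (- sdiff x z * kern z).
Proof.
move=> a0; apply: (symmetrise x a0) => //; first exact: measurable_enorm_gt.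
by apply/seteqP; split => z; rewrite /= scaleN1r addr0 enormN.
Qed.

Lemma trunc_lap_annulus x a b : 0 < a -> a <= b ->
  mu.-integrable (annulus a b) (EFin \o (fun z => - sdiff x z * kern z)) /\
  trunc_lap x a - trunc_lap x b = 2^-1 * \int[mu]_(z in annulus a b) (- sdiff x z * kern z).
Proof.
move=> a0 ab.
have mA := measurable_annulus a b.
have NA : (fun z => -1 *: z + 0) @^-1` annulus a b = annulus a b.
  by apply/seteqP; split => z; rewrite /annulus /= scaleN1r addr0 enormN.
have sA : annulus a b `<=` [set z | a < enorm z] by move=> z /andP[].
have [iA <-] := symmetrise x a0 mA sA NA; split => //.
have -> : trunc_lap x a = \int[mu]_(z in annulus a b) ((v x - v (x + z)) * kern z) +
    trunc_lap x b.
  rewrite /trunc_lap; have -> : [set z : 'rV[R]_n | a < enorm z] =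
      annulus a b `|` [set z | b < enorm z].
    apply/seteqP; split => z /=.
      by rewrite /annulus /= => ->; case: leP; [left|right].
    by move=> [/andP[]//|]; exact: le_lt_trans.
  rewrite Rintegral_setU//.
  - exact: measurable_enorm_gt.
  - apply: (integrableS _ _ _ (integrable_diff x a0)) => //.
    + exact: measurable_enorm_gt.
    + by apply: measurableU => //; exact: measurable_enorm_gt.
    + by move=> z /= [/andP[]//|]; exact: le_lt_trans.
  - by apply/disj_setPS => z /= [/andP[_]]; rewrite leNgt => /negbTE ->.
by rewrite addrK.
Qed.

Let annulus_moment a b : 0 < a -> a <= b -> 
  mu.-integrable (annulus a b) (EFin \o moment) /\
  \int[mu]_(z in annulus a b) moment z <= b `^ (2 - 2 * s) * momentc n s.
Proof.
move=> a0 ab; have b0 := lt_le_trans a0 ab.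
have i1 := integrable_moment b0.
have sub : annulus a b `<=` [set z | enorm z <= b] by move=> z /andP[].
have mA := measurable_annulus a b.
have mb := @measurable_enorm_le R n b.
have i2 := integrableS mb mA sub i1.
split => //; rewrite -[leRHS]/(fine (_ %:E)) -moment_integral// /Rintegral fine_le//.
- exact: integrable_fin_num.
- exact: integrable_fin_num.
- apply: ge0_subset_integral => //.
  + by apply/measurable_EFinP; apply: measurable_funTS; exact: measurable_moment.
  + by move=> z _; rewrite lee_fin moment_ge0.
Qed.

Lemma trunc_lap_le x B a b : 0 < a -> a <= b -> 0 <= B ->
  (forall z, enorm z <= b -> - (2 * B) * enorm z ^+ 2 <= sdiff x z) ->
  trunc_lap x a - trunc_lap x b <= B * (b `^ (2 - 2 * s) * momentc n s).
Proof.
move=> a0 ab B0 hB; have [i1 ->] := trunc_lap_annulus x a0 ab.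
have [i2 h2] := annulus_moment a0 ab.
have mA := measurable_annulus a b.
apply: (@le_trans _ _ (2^-1 * ((2 * B) * \int[mu]_(z in annulus a b) moment z))).
  rewrite ler_wpM2l// -RintegralZl//; apply: le_Rintegral => //.
  - exact: integrableZl_EFin.
  - move=> z /andP[_ zb]; rewrite /moment mulrA ler_wpM2r ?kern_ge0//.
    by rewrite lerNl -mulNr; exact: hB.
by rewrite !mulrA mulVf// mul1r -mulrA ler_wpM2l// -mulrA.
Qed.

Lemma trunc_lap_ge x B a b : 0 < a -> a <= b -> 0 <= B ->
  (forall z, enorm z <= b -> sdiff x z <= (2 * B) * enorm z ^+ 2) ->
  - (B * (b `^ (2 - 2 * s) * momentc n s)) <= trunc_lap x a - trunc_lap x b.
Proof.
move=> a0 ab B0 hB; have [i1 ->] := trunc_lap_annulus x a0 ab.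
have [i2 h2] := annulus_moment a0 ab.
have mA := measurable_annulus a b.
apply: (@le_trans _ _ (2^-1 * (- (2 * B) * \int[mu]_(z in annulus a b) moment z))).
  rewrite mulNr mulrN lerN2 !mulrA mulVf// mul1r -mulrA ler_wpM2l//.
rewrite ler_wpM2l// -RintegralZl//; apply: le_Rintegral => //.
- exact: integrableZl_EFin.
- move=> z /andP[_ zb]; rewrite /moment mulrA ler_wpM2r ?kern_ge0//.
  by rewrite mulNr lerN2; exact: hB.
Qed.

Definition pv_lap x : R := lim (trunc_lap x e @[e --> 0^'+]).

Lemma moment_small (B d : R) : 0 < d -> 
  \forall b \near 0^'+, B * (b `^ (2 - 2 * s) * momentc n s) < d.
Proof.
move=> d0; have h : B * (b `^ (2 - 2 * s) * momentc n s) @[b --> 0^'+] --> B * (0 * momentc n s).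
  apply: cvgMr; apply: cvgMl; apply: powR_cvg0.
  by case/andP: s01 => ? ?; rewrite subr_gt0 gtr_pMr.
by apply: cvgr_lt h _ _; rewrite mul0r mulr0.
Qed.

(** Cauchy's criterion: all radii below [b] differ by at most a multiple of [b^(2 - 2s)], which
    tends to 0. *)
Lemma cvg_trunc_lap x N r : 0 < r -> 0 <= N ->
  (forall z, enorm z <= r -> `|sdiff x z| <= N * enorm z ^+ 2) ->
  cvg (trunc_lap x e @[e --> 0^'+]).
Proof.
move=> r0 N0 hN; apply/cauchy_cvgP/cauchy_exP => d d0.
have [b [bd b0 br]] : exists b, [/\ (N / 2) * (b `^ (2 - 2 * s) * momentc n s) < d, 0 < b & b <= r].
  near (0 : R)^'+ => b; exists b; split; near: b.
  - exact: moment_small.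
  - exact: nbhs_right_gt.
  - exact: nbhs_right_le.
exists (trunc_lap x b).
suff : \forall a \near 0^'+, ball (trunc_lap x b) d (trunc_lap x a) by [].
near=> a.
have a0 : 0 < a by near: a; exact: nbhs_right_gt.
have ab : a <= b by near: a; exact: nbhs_right_le.
rewrite /ball /= distrC; apply: le_lt_trans bd; rewrite ler_norml.
have N20 : 0 <= N / 2 by rewrite divr_ge0.
have N2 : 2 * (N / 2) = N by lra.
apply/andP; split.
  apply: trunc_lap_ge => // z zb; rewrite N2.
  by apply: (le_trans (ler_norm _)); apply: hN; exact: le_trans br.
apply: trunc_lap_le => // z zb; rewrite N2 mulNr lerNl.
rewrite (le_trans _ (hN _ (le_trans zb br)))// -normrN; exact: ler_norm.
Unshelve. all: by end_near. Qed.

(** The two-sided constant [N] gives convergence, the one-sided constant [B] the bound. Hence the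
    bound is uniform even where no uniform [N] is known. *)
Lemma pv_lap_le_trunc x N B r : 0 < r -> 0 <= N -> 0 <= B ->
  (forall z, enorm z <= r -> `|sdiff x z| <= N * enorm z ^+ 2) ->
  (forall z, enorm z <= r -> - (2 * B) * enorm z ^+ 2 <= sdiff x z) ->
  pv_lap x <= trunc_lap x r + B * (r `^ (2 - 2 * s) * momentc n s).
Proof.
move=> r0 N0 B0 hN hB; apply: limr_le; first exact: (cvg_trunc_lap r0 N0 hN).
near=> a; rewrite -lerBlDl; have a0 : 0 < a by near: a; exact: nbhs_right_gt.
by apply: trunc_lap_le => //; near: a; exact: nbhs_right_le.
Unshelve. all: by end_near. Qed.

Lemma pv_lap_le x N B r (g : 'rV[R]_n -> R) : 0 < r -> 0 <= N -> 0 <= B ->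
  (forall z, enorm z <= r -> `|sdiff x z| <= N * enorm z ^+ 2) ->
  (forall z, enorm z <= r -> - (2 * B) * enorm z ^+ 2 <= sdiff x z) ->
  mu.-integrable [set z | r < enorm z] (EFin \o (fun z => g z * kern z)) ->
  (forall z, r < enorm z -> g z <= v (x + z) - v x) ->
  pv_lap x <= B * (r `^ (2 - 2 * s) * momentc n s) -
    \int[mu]_(z in [set z | r < enorm z]) (g z * kern z).
Proof.
move=> r0 N0 B0 hN hB ig hg; apply: le_trans (pv_lap_le_trunc r0 N0 B0 hN hB) _.
have mD := @measurable_enorm_gt R n r.
rewrite addrC lerD2l -mulN1r -RintegralZl//; apply: le_Rintegral => //.
- exact: integrable_diff.
- exact: integrableZl_EFin.
- move=> z rz; rewrite mulN1r -mulNr ler_wpM2r ?kern_ge0// lerNr opprB.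
  exact: hg.
Qed.

Lemma Rtail_integral (c r : R) : 0 < r ->
  \int[mu]_(z in [set z | r < enorm z]) (c * kern z) = c * (r `^ (- (2 * s)) * tailc n s).
Proof.
move=> r0; rewrite RintegralZl; [|exact: measurable_enorm_gt|]; last first.
  have := integrable_kern n s01 1 r0; apply: eq_integrable; first exact: measurable_enorm_gt.
  by move=> z _ /=; rewrite mul1r.
by rewrite /Rintegral tail_integral.
Qed.

End truncation.

Lemma frac_lapE (R : realType) (n : nat) (hn : (2 <= n)%N) (s : R)
    (v : 'rV[R]_n -> R) x : 0 < s < 1 -> L2s s v ->
  frac_lap hn s v x = frac_lap_const hn s * pv_lap s v x.
Proof.
move=> s01 hv; exact: (f_equal (fun F : R -> R => frac_lap_const hn s * lim (F e @[e --> 0^'+]))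
  (funext (fun e => trunc_lapE hv x e))).
Qed.

(** * Local bounds from [C^{1,1}] regularity *)

Section C11_bounds.
Context (R : realType) (n : nat).
Implicit Types (v : 'rV[R]_n -> R) (x y z : 'rV[R]_n).

Lemma is_derive_line v x z (t : R) : differentiable v (x + t *: z) ->
  is_derive t 1 (fun t => v (x + t *: z)) ('D_z v (x + t *: z)).
Proof.
move=> dv.
have E : (fun h : R => h^-1 *: (((fun t => v (x + t *: z)) \o shift t) (h *: 1) - v (x + t *: z))) =
         (fun h : R => h^-1 *: ((v \o shift (x + t *: z)) (h *: z) - v (x + t *: z))).
  apply/funext => h /=; congr (_ *: (v _ - _)).
  by rewrite [h *: 1]mulr1 scalerDl addrCA.
have dz : derivable v (x + t *: z) z by exact: diff_derivable.
split; last by rewrite /derive E.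
by rewrite /derivable E.
Qed.

Lemma derive_grad v x z : differentiable v x ->
  'D_z v x = \sum_(j < n) z ord0 j * grad v x ord0 j.
Proof.
move=> dv; rewrite deriveE// [in LHS](row_sum_delta z) linear_sum.
by apply: eq_bigr => j _; rewrite linearZ /= mxE deriveE.
Qed.

Lemma C11loc_bounds v (k : R) : C11loc v -> 0 <= k -> exists2 N : R, 0 <= N &
  forall x, `|x| <= k ->
  [/\ `|v x| <= N,
      forall z, enorm z <= 1 -> `|sdiff v x z| <= N * enorm z ^+ 2 &
      forall y, `|y| <= k -> `|v x - v y| <= N * `|x - y| ].
Proof.
move=> [dv lip] k0.
have cK : compact (@cube R n (k + 2)) by exact: compact_cube.
(* The enlarged cube contains [x + z] for [|x| <= k] and [|z| <= 1]. *)
have cubeE x : `|x| <= k + 2 -> cube (k + 2) x.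
  by move=> h i; rewrite -ler_norml (le_trans (coord_le_norm x i)).
have [L L0 hL] : exists2 L : R, 0 <= L & forall x y, `|x| <= k + 2 -> `|y| <= k + 2 ->
    `|grad v x - grad v y| <= L * `|x - y|.
  have := lip _ cK.
  rewrite /lipschitz_on => hM.
  near (pinfty_nbhs R) => L.
  exists L; first by near: L; apply: nbhs_pinfty_ge; rewrite num_real.
  move=> x y /cubeE hx /cubeE hy.
  have : L.-lipschitz_on (grad v) (globally (cube (k + 2) `*` cube (k + 2))) by near: L.
  by move=> /(_ (x, y)); apply.
have D_le x y z : `|x| <= k + 2 -> `|y| <= k + 2 ->
    `|'D_z v x - 'D_z v y| <= n%:R * `|z| * (L * `|x - y|).
  move=> hx hy; rewrite !derive_grad// -sumrB.
  apply: (le_trans (ler_norm_sum _ _ _)).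
  apply: (@le_trans _ _ (\sum_(j < n) `|z| * (L * `|x - y|))); last first.
    by rewrite sumr_const card_ord -[_ *+ n]mulr_natl mulrA.
  apply: ler_sum => j _; rewrite -mulrBr normrM ler_pM ?coord_le_norm//.
  apply: le_trans (hL _ _ hx hy).
  by have := coord_le_norm (grad v x - grad v y) j; rewrite !mxE.
pose G := `|grad v 0| + L * (k + 2).
have k2 : 0 <= k + 2 by rewrite addr_ge0.
have G0 : 0 <= G by rewrite addr_ge0// mulr_ge0.
have D_bd x z : `|x| <= k + 2 -> `|'D_z v x| <= n%:R * `|z| * G.
  move=> hx; rewrite derive_grad//; apply: (le_trans (ler_norm_sum _ _ _)).
  apply: (@le_trans _ _ (\sum_(j < n) `|z| * G)); last first.
    by rewrite sumr_const card_ord -[_ *+ n]mulr_natl mulrA.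
  apply: ler_sum => j _; rewrite normrM ler_pM ?coord_le_norm//.
  apply: le_trans (coord_le_norm _ _) _.
  rewrite -[grad v x](subrK (grad v 0)) addrC; apply: le_trans (ler_normD _ _) _.
  rewrite lerD2l; apply: le_trans (hL _ _ hx _) _; rewrite ?normr0// subr0.
  by rewrite ler_wpM2l.
have line_cont (f df : R -> R) : (forall t : R, is_derive t (1 : R) f (df t)) ->
    {within `[0, 1], continuous f}.
  move=> h; apply: continuous_subspaceT => t.
  by apply/differentiable_continuous/derivable1_diffP; have [] := h t.
have lips x y : `|x| <= k -> `|y| <= k -> `|v x - v y| <= n%:R * G * `|x - y|.
  move=> hx hy.
  pose f t := v (y + t *: (x - y)).
  have df (t : R) : is_derive t (1 : R) f ('D_(x - y) v (y + t *: (x - y))).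
    exact: is_derive_line.
  have [c /itvP c01] := @MVT_segment R f _ 0 1 ler01 (fun t _ => df t) (line_cont _ _ df).
  rewrite /f scale1r scale0r addr0 subrKC subr0 mulr1 => ->.
  rewrite [leRHS]mulrAC; apply: D_bd.
  rewrite (_ : y + c *: (x - y) = (1 - c) *: y + c *: x); last first.
    by rewrite scalerBr scalerBl scale1r [RHS]addrAC -!addrA.
  apply: (le_trans (ler_normD _ _)); rewrite !normrZ.
  rewrite (@ger0_norm _ c) ?c01// (@ger0_norm _ (1 - c)) ?subr_ge0 ?c01//.
  have h1 : (1 - c) * `|y| <= (1 - c) * k by rewrite ler_wpM2l// subr_ge0 c01.
  have h2 : c * `|x| <= c * k by rewrite ler_wpM2l// c01.
  by lra.
have sd x z : `|x| <= k -> enorm z <= 1 -> `|sdiff v x z| <= (2 * n%:R * L) * enorm z ^+ 2.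
  move=> hx z1; have hz := norm_le_enorm z.
  (* One mean value theorem for the sum of both rays turns the second difference into a difference
     of gradients at distance at most [2 |z|]. *)
  pose f t := v (x + t *: z) + v (x + t *: (- z)).
  have df (t : R) : is_derive t (1 : R) f ('D_z v (x + t *: z) + 'D_(- z) v (x + t *: (- z))).
    by apply: is_deriveD; exact: is_derive_line.
  have [c /itvP c01] := @MVT_segment R f _ 0 1 ler01 (fun t _ => df t) (line_cont _ _ df).
  rewrite /f !scale1r !scale0r !addr0 subr0 mulr1 -mulr2n => E.
  rewrite /sdiff mulr_natl E.
  have -> : 'D_(- z) v (x + c *: - z) = - 'D_z v (x + c *: - z).
    rewrite !derive_grad// -sumrN; apply: eq_bigr => j _.
    by rewrite mxE mulNr.
  have cz : `|c *: z| <= 1.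
    rewrite normrZ ger0_norm ?c01//; apply: le_trans (_ : 1 * `|z| <= 1).
      by rewrite ler_wpM2r// c01.
    by rewrite mul1r (le_trans hz).
  apply: (@le_trans _ _ (n%:R * `|z| * (L * `|(x + c *: z) - (x + c *: - z)|))).
    apply: D_le; apply: (le_trans (ler_normD _ _)).
      by rewrite lerD// (le_trans cz)// ler1n.
    by rewrite scalerN normrN lerD// (le_trans cz)// ler1n.
  have -> : (x + c *: z) - (x + c *: - z) = (2 * c) *: z.
    rewrite opprD addrACA subrr add0r scalerN opprK -scalerDl; congr (_ *: _); ring.
  rewrite normrZ ger0_norm ?mulr_ge0 ?c01//.
  have nL : 0 <= n%:R * L by rewrite mulr_ge0.
  have zz : `|z| * `|z| <= enorm z ^+ 2 by rewrite expr2 ler_pM.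
  have cc : c * (`|z| * `|z|) <= enorm z ^+ 2.
    by apply: le_trans zz; rewrite ler_piMl ?mulr_ge0// c01.
  have := ler_wpM2l nL cc.
  by rewrite (_ : n%:R * `|z| * (L * (2 * c * `|z|)) = 2 * (n%:R * L * (c * (`|z| * `|z|)))); [lra|ring].
have nG : 0 <= n%:R * G by rewrite mulr_ge0.
have nL : 0 <= 2 * n%:R * L by rewrite !mulr_ge0.
exists (`|v 0| + n%:R * G * k + n%:R * G + 2 * n%:R * L); first by rewrite !addr_ge0// mulr_ge0.
move=> x hx; split.
- rewrite -[v x](subrK (v 0)); apply: (le_trans (ler_normD _ _)).
  have := lips x 0 hx; rewrite normr0 => /(_ k0); rewrite subr0 => h.
  have : n%:R * G * `|x| <= n%:R * G * k by rewrite ler_wpM2l.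
  by lra.
- move=> z z1; apply: le_trans (sd x z hx z1) _; rewrite ler_wpM2r ?sqr_ge0//.
  by rewrite lerDr !addr_ge0// mulr_ge0.
- move=> y hy; apply: le_trans (lips x y hx hy) _; rewrite ler_wpM2r//.
  have : 0 <= n%:R * G * k by rewrite mulr_ge0.
  have := normr_ge0 (v 0); lra.
Unshelve. all: by end_near. Qed.

End C11_bounds.

(** * Baire's theorem and behaviour at the boundary *)

Lemma ler_powR_neg (R : realType) (a b p : R) : 0 < a -> a <= b -> p <= 0 ->
  b `^ p <= a `^ p.
Proof.
move=> a0 ab p0; have b0 := lt_le_trans a0 ab.
rewrite -(opprK p) (powRN a (- p)) (powRN b (- p)) lef_pV2 ?posrE ?powR_gt0//.
by rewrite ge0_ler_powR ?nnegrE ?oppr_ge0// ltW.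
Qed.

Section baire_on_the_line.
Context (R : realType).

Lemma closed_notin_ball (T : set R) (t : R) : closed T -> ~ T t ->
  exists2 e : R, 0 < e & forall t', `|t' - t| < e -> ~ T t'.
Proof.
move=> cT nTt; have /nbhs_ballP[e /= e0 he] : nbhs t (~` T).
  by apply: open_nbhs_nbhs; split => //; exact: closed_openC.
by exists e => // t' h; apply: (he t'); rewrite /ball /= distrC.
Qed.

(** Otherwise there are nested closed intervals, each centred at a point of [F], the [N]-th step
    avoiding [T N]. Their common point would lie in no [T N], although these cover the line. *)
Lemma baire_line (F : set R) (T : (set R)^nat) : F !=set0 ->
  (forall N, closed (T N)) -> (forall t, exists N, T N t) ->
  exists N a b t0, [/\ a < t0 < b, F t0 & forall t, a < t < b -> F t -> T N t].
Proof.
move=> [f0 Ff0] cT covT; apply: contrapT => no.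
have step (N : nat) (q : R * R * R) : q.1.1 < q.2 < q.1.2 -> F q.2 ->
    exists q' : R * R * R, [/\ q'.1.1 < q'.2 < q'.1.2, F q'.2,
      q.1.1 < q'.1.1, q'.1.2 < q.1.2 & forall t, q'.1.1 <= t <= q'.1.2 -> ~ T N t].
  move: q => [[a b] t0] /= abt Ft0.
  have [t [abt' Ft nT]] : exists t, [/\ a < t < b, F t & ~ T N t].
    apply: contrapT => no'; apply: no; exists N, a, b, t0; split => // t h1 h2.
    by apply: contrapT => nT; apply: no'; exists t.
  have [e e0 he] := closed_notin_ball (cT N) nT.
  have /andP[ta tb] := abt'.
  (* Small enough to avoid [T N] and to leave a gap to both old end points. *)
  pose d := Num.min (e / 2) (Num.min ((t - a) / 2) ((b - t) / 2)).
  have d0 : 0 < d by rewrite !lt_min !divr_gt0 ?subr_gt0.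
  have [de [da db]] : d <= e / 2 /\ d <= (t - a) / 2 /\ d <= (b - t) / 2.
    by rewrite /d !ge_min !lexx ?orbT.
  exists ((t - d), (t + d), t); split => //=; try lra.
  move=> t' /andP[h1 h2]; apply: he; rewrite ltr_norml; apply/andP; split; lra.
pose good (q : R * R * R) := q.1.1 < q.2 < q.1.2 /\ F q.2.
have hchoice (Nq : nat * {q : R * R * R | good q}) : exists q' : {q | good q},
  [/\ (sval Nq.2).1.1 < (sval q').1.1, (sval q').1.2 < (sval Nq.2).1.2 &
   forall t, (sval q').1.1 <= t <= (sval q').1.2 -> ~ T Nq.1 t].
  move: Nq => [N [q gq]] /=; have [q' [h1 h2 h3 h4 h5]] := step N q gq.1 gq.2.
  by exists (exist _ q' (conj h1 h2)).
have /choice[nxt hn] := hchoice.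
have g0 : good (f0 - 1, f0 + 1, f0) by split => //=; lra.
pose Q := fix Q (N : nat) : {q | good q} :=
  if N is N'.+1 then nxt (N', Q N') else exist _ _ g0.
pose A N := (sval (Q N)).1.1; pose B N := (sval (Q N)).1.2.
have AB N : A N < B N by rewrite /A /B; case: (sval _) (svalP (Q N)) => [[x y] z] [/andP[/= h1 h2] _]; exact: lt_trans h2.
have A1 N : A N < A N.+1 by have [h _ _] := hn (N, Q N).
have B1 N : B N.+1 < B N by have [_ h _] := hn (N, Q N).
have nT N t : A N.+1 <= t <= B N.+1 -> ~ T N t by have [_ _ h] := hn (N, Q N); exact: h.
have Ale m k : A m <= A (m + k)%N.
  by elim: k => [|k IH]; rewrite ?addn0// addnS (le_trans IH)// ltW.
have Ble m k : B (m + k)%N <= B m.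
  by elim: k => [|k IH]; rewrite ?addn0// addnS (le_trans _ IH)// ltW.
have ABle m k : A m <= B k.
  by rewrite (le_trans (Ale m k))// (le_trans (ltW (AB _)))// addnC Ble.
have hs : has_sup (range A).
  by split; [exists (A 0%N), 0%N|exists (B 0%N) => _ [m _ <-]; exact: ABle].
have [N TN] := covT (sup (range A)).
apply: (nT N _ _ TN); apply/andP; split.
  by apply: ub_le_sup; [exact: hs.2|exists N.+1].
by apply: ge_sup; [exact: hs.1|move=> _ [m _ <-]; exact: ABle].
Qed.

End baire_on_the_line.

(** * One-sided bounds on the time derivative and blow-up at a boundary point *)

Section solution.
Context (R : realType) (n : nat) (hn : (2 <= n)%N) (s p : R) (f : R -> R).
Context (Omega : set 'rV[R]_n) (u : 'rV[R]_n -> R -> R).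
Context (s01 : 0 < s < 1) (cf : continuous f) (p0 : p < 0).
Context (sol : classical_solution hn s p f Omega u).
Local Notation mu := (lebesgue_rV R n).
Local Notation kern := (@kern R n s).
Local Notation k0 := (frac_lap_const hn s).

Lemma solution_ge0 x t : 0 <= u x t.
Proof.
have [h|h] := pselect (Omega x); first exact/ltW/(solution_gt0 sol).
by rewrite (solution_eq0 sol).
Qed.

Lemma solution_cts x : continuous (u x).
Proof.
have [h|h] := pselect (Omega x).
  move=> t; apply/differentiable_continuous/derivable1_diffP.
  exact: (solution_derivable sol).
rewrite (_ : u x = cst 0); first exact: cst_continuous.
by apply/funext => t; exact: (solution_eq0 sol).
Qed.

Lemma solution_sdiff_bound x t : exists2 N : R, 0 <= N &
  forall z, enorm z <= 1 -> `|sdiff (u ^~ t) x z| <= N * enorm z ^+ 2.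
Proof.
have [N N0 /(_ x (lexx _))[_ h _]] := C11loc_bounds (solution_C11loc sol t) (normr_ge0 x).
by exists N.
Qed.

(** The equation with the nonlocal term bounded below: second differences near [x], any integrable
    minorant [g] of the increments further away. No upper bound on [u] away from [x] enters. *)
Lemma time_derivative_ge x t (B r : R) (g : 'rV[R]_n -> R) :
  Omega x -> 0 < r <= 1 -> 0 <= B ->
  (forall z, enorm z <= r -> - (2 * B) * enorm z ^+ 2 <= sdiff (u ^~ t) x z) ->
  mu.-integrable [set z | r < enorm z] (EFin \o (fun z => g z * kern z)) ->
  (forall z, r < enorm z -> g z <= u (x + z) t - u x t) ->
  k0 * (\int[mu]_(z in [set z | r < enorm z]) (g z * kern z) -
        B * (r `^ (2 - 2 * s) * momentc n s)) +
  coord1 hn x * u x t `^ p + f (u x t) <= derive1 (u x) t.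
Proof.
move=> Ox /andP[r0 r1] B0 hB ig hg.
have := solution_eq sol t Ox; rewrite frac_lapE//; last exact: (solution_L2s sol).
have [N N0 hN] := solution_sdiff_bound x t.
have := pv_lap_le s01 (solution_L2s sol t) r0 N0 B0
  (fun z zr => hN z (le_trans zr r1)) hB ig hg.
have k00 := frac_lap_const_gt0 hn s01.
rewrite -(ler_pM2l k00).
move: (\int[mu]_(z in _) _) (pv_lap _ _ _) => I P h1 h2.
have : k0 * (I - B * (r `^ (2 - 2 * s) * momentc n s)) + k0 * P <= 0.
  by rewrite -mulrDr pmulr_rle0//; move: h1; rewrite ler_pM2l//; lra.
lra.
Qed.

Lemma time_derivative_ge_cst x t (B r M : R) :
  Omega x -> 0 < r <= 1 -> 0 <= B ->
  (forall z, enorm z <= r -> - (2 * B) * enorm z ^+ 2 <= sdiff (u ^~ t) x z) ->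
  u x t <= M ->
  coord1 hn x * u x t `^ p + f (u x t) -
  k0 * (B * (r `^ (2 - 2 * s) * momentc n s) + M * (r `^ (- (2 * s)) * tailc n s))
    <= derive1 (u x) t.
Proof.
move=> Ox r01 B0 hB uM; have /andP[r0 r1] := r01.
have := @time_derivative_ge x t B r (fun=> - M) Ox r01 B0 hB (integrable_kern n s01 (- M) r0).
have hg z : r < enorm z -> - M <= u (x + z) t - u x t.
  by move=> _; have := solution_ge0 (x + z) t; lra.
by move=> /(_ hg); rewrite Rtail_integral//; lra.
Qed.

(** The quantitative content of [C^{1,1}] at one time, written with values of [u] only, so that it
    is preserved by pointwise limits in time. *)
Definition regular (k N t : R) := forall x, `|x| <= k ->
  [/\ `|u x t| <= N,
      forall z, enorm z <= 1 -> `|sdiff (u ^~ t) x z| <= N * enorm z ^+ 2 &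
      forall y, `|y| <= k -> `|u x t - u y t| <= N * `|x - y| ].

(** For fixed [x], [y], [z] each bound is a closed condition on [t], because [u x] is continuous. *)
Lemma closed_regular k N : closed (regular k N).
Proof.
have clo (g : R -> R) c : continuous g -> closed [set t | `|g t| <= c].
  move=> cg; apply: (@closed_comp _ _ (fun t => `|g t|) [set x | x <= c]).
    by move=> t _; apply: cvg_norm; exact: cg.
  exact: closed_le.
have sub (P : set R) : closed P -> regular k N `<=` P -> closure (regular k N) `<=` P.
  by move=> cP h t /(closure_subset h); move: (cP) => /closure_id <-.
move=> t clt x hx; split.
- by apply: (sub _ (clo _ N (@solution_cts x))) clt => t' /(_ x hx)[].
- move=> z hz; have cs : continuous (fun t => sdiff (u ^~ t) x z).
    move=> t'; apply: cvgB; first by apply: cvgD; exact: solution_cts.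
    by apply: cvgMr; exact: solution_cts.
  by apply: (sub _ (clo _ (N * enorm z ^+ 2) cs)) clt => t' /(_ x hx)[_ + _]; apply.
- move=> y hy; have cs : continuous (fun t => u x t - u y t).
    by move=> t'; apply: cvgB; exact: solution_cts.
  by apply: (sub _ (clo _ (N * `|x - y|) cs)) clt => t' /(_ x hx)[_ _]; apply.
Qed.

Lemma regular_exists k t : 0 <= k -> exists N : nat, regular k N%:R t.
Proof.
move=> k_ge0; have [N N0 h] := C11loc_bounds (solution_C11loc sol t) k_ge0.
exists (Num.truncn N).+1 => x hx; have [h1 h2 h3] := h x hx.
have NN : N <= (Num.truncn N).+1%:R by apply/ltW; exact: truncnS_gt.
split; first exact: le_trans NN.
- by move=> z hz; apply: le_trans (h2 z hz) _; rewrite ler_wpM2r ?sqr_ge0.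
- by move=> y hy; apply: le_trans (h3 y hy) _; rewrite ler_wpM2r.
Qed.

Lemma f_bounded (M : R) : exists2 C : R, 0 <= C & forall a, - M <= a <= M -> `|f a| <= C.
Proof.
have [M0|M0] := leP 0 M; last first.
  by exists 0 => // a /andP[h1 h2]; exfalso; lra.
have cfM : {within `[- M, M], continuous (fun a => `|f a|)}.
  by apply: continuous_subspaceT => a; apply: cvg_norm; exact: cf.
have [|c cM hc] := EVT_max _ cfM; first lra.
by exists `|f c| => // a ha; apply: hc.
Qed.

(** [xb] is a boundary point and [e] the inward unit normal there. The last hypothesis is the
    blow-up of [x_1 u^p] for [u <= N r^2]; it is the only place where domain and exponent enter. *)
Lemma no_solution_boundary (xb e : 'rV[R]_n) : enorm e = 1 ->
  ~ Omega xb -> (forall r : R, 0 < r < 1 -> ~ Omega (xb - r *: e)) ->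
  (forall r : R, 0 < r < 1 -> Omega (xb + r *: e) /\ 0 < coord1 hn (xb + r *: e)) ->
  (forall N C : R, 0 < N -> exists2 r : R, 0 < r < 1 &
     C <= coord1 hn (xb + r *: e) * (N * r ^+ 2) `^ p) ->
  False.
Proof.
move=> e1 nOb nOm Op blow.
pose k := `|xb| + 1.
have kge : 0 <= k by rewrite addr_ge0.
have ne : [set: R] !=set0 by exists 0.
have [N [a [b [t0 [/andP[at0 t0b] _ hN]]]]] :=
  baire_line ne (fun N => @closed_regular k N%:R)
    (fun t => regular_exists t kge).
pose M : R := N%:R + 1.
have M0 : 0 < M by rewrite ltr_wpDl.
have NM : N%:R <= M by rewrite lerDl.
have [G G0 hG] := f_bounded M.
pose t1 := (a + t0) / 2; pose t2 := (t0 + b) / 2.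
have t12 : 0 < t2 - t1 by rewrite /t1 /t2; lra.
have int t : t1 <= t <= t2 -> a < t < b by rewrite /t1 /t2 => /andP[h1 h2]; lra.
pose Q := k0 * (M * (1 `^ (2 - 2 * s) * momentc n s) + M * (1 `^ (- (2 * s)) * tailc n s)).
(* [G] pays for [f] and [Q] for the nonlocal term. What is left makes [u] grow by [2 M] on
   [[t1, t2]], while it remains in [[0, M]]. *)
have [r r01 hr] := blow M (2 * M / (t2 - t1) + G + Q) M0.
have /andP[r0 r1] := r01.
set x := xb + r *: e.
have [Ox c1] := Op r r01.
have er : enorm (r *: e) = r by rewrite enormZ e1 mulr1 gtr0_norm.
have ux t : t1 <= t <= t2 -> u x t <= M * r ^+ 2.
  move=> /int ht; have xbk : `|xb| <= k by rewrite lerDl.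
  have [_ h _] := hN t ht I xb xbk.
  have := h (r *: e); rewrite er => /(_ (ltW r1)).
  (* Of the three values in the second difference at [xb] only [u x t] survives, which gives the
     quadratic bound. *)
  rewrite /sdiff (solution_eq0 sol _ nOb) (solution_eq0 sol _ (nOm r r01)).
  rewrite mulr0 subr0 addr0 ger0_norm ?solution_ge0//.
  by move=> h'; apply: le_trans h' _; rewrite ler_wpM2r ?sqr_ge0.
have r21 : M * r ^+ 2 <= M by rewrite ler_piMr ?(ltW M0)// expr_le1// ltW.
have der t : t1 <= t <= t2 -> 2 * M / (t2 - t1) <= derive1 (u x) t.
  move=> ht; have uxt := ux t ht.
  have up := solution_gt0 sol t Ox.
  have hx : `|x| <= k.
    apply: (le_trans (ler_normD _ _)); rewrite lerD2l; apply: le_trans (norm_le_enorm _) _.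
    by rewrite er ltW.
  have [_ hs _] := hN t (int t ht) I x hx.
  have r11 : 0 < (1 : R) <= 1 by rewrite ltr01 lexx.
  have hB z : enorm z <= 1 -> - (2 * M) * enorm z ^+ 2 <= sdiff (u ^~ t) x z.
    move=> z1; have := hs z z1; rewrite ler_norml => /andP[h _]; apply: le_trans h.
    by rewrite mulNr lerN2 ler_wpM2r ?sqr_ge0//; lra.
  apply: le_trans (time_derivative_ge_cst Ox r11 (ltW M0) hB (le_trans uxt r21)).
  rewrite -/Q; apply: (@le_trans _ _ (2 * M / (t2 - t1) + G + Q - G - Q)); first lra.
  apply: lerB => //; have : `|f (u x t)| <= G by apply: hG; apply/andP; split; lra.
  rewrite ler_norml => /andP[hfG _].
  have := ler_powR_neg up uxt (ltW p0) => hp.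
  have := ler_wpM2l (ltW c1) hp; lra.
have t12' : t1 < t2 by lra.
have ct : {within `[t1, t2], continuous (u x)}.
  by apply: continuous_subspaceT; exact: solution_cts.
have isd t : t \in `]t1, t2[%R -> is_derive t 1 (u x) (derive1 (u x) t).
  by move=> _; rewrite derive1E; apply: derivableP; exact: (solution_derivable sol).
have [c ctt E] := MVT t12' isd ct.
have /andP[c1' c2'] : t1 <= c <= t2 by move: ctt; rewrite in_itv /= => /andP[? ?]; rewrite !ltW.
have := der c; rewrite c1' c2' => /(_ isT) h.
have : 2 * M <= derive1 (u x) c * (t2 - t1) by rewrite -ler_pdivrMr.
rewrite -E; have := ux t2; rewrite lexx ltW// => /(_ isT).
have := solution_ge0 x t1; lra.
Qed.

End solution.

(** * Absence of dips in time *)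

Lemma continuous_sum (R : realType) (T : topologicalType) (I : Type) (r : seq I)
    (F : I -> T -> R) : (forall i, continuous (F i)) ->
  continuous (fun x => \sum_(i <- r) F i x).
Proof.
move=> cF; elim: r => [|i r IH].
  rewrite (_ : (fun x => _) = cst 0); first exact: cst_continuous.
  by apply/funext => x; rewrite big_nil.
rewrite (_ : (fun x => _) = (fun x => F i x + \sum_(j <- r) F j x)).
  by move=> x; apply: cvgD; [exact: cF|exact: IH].
by apply/funext => x; rewrite big_cons.
Qed.

Lemma left_decrease (R : realType) (g : R -> R) (t al : R) : derivable g t 1 ->
  al < derive1 g t ->
  exists2 e : R, 0 < e & forall t', t - e < t' < t -> g t' + al * (t - t') < g t.
Proof.
move=> dg; rewrite derive1E => ad.
have : \forall h \near (0 : R)^', al < h^-1 *: ((g \o shift t) (h *: 1) - g t).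
  by apply: cvgr_gt ad; exact: dg.
move=> /nbhs_ballP[e /= e0 he]; exists e => // t' /andP[h1 h2].
have h0 : t' - t != 0 by rewrite subr_eq0 lt_eqF.
have := he (t' - t); rewrite /ball /= sub0r normrN ltr0_norm ?subr_lt0// opprB => /(_ _ h0).
have -> : t - t' < e by lra.
move=> /(_ isT); rewrite [(t' - t) *: 1]mulr1 subrK /GRing.scale /=.
have hn : t' - t < 0 by lra.
by rewrite -(ltr_nM2l hn) mulVKf//; lra.
Qed.

Section comparison.
Context (R : realType) (X : Type) (K : set X) (q : X -> R -> R) (a b : R).

(** The maximum over [K] cannot have become positive: going back from [b], a positive maximum
    persists at limits from the right by the uniform semicontinuity, and can be continued to the
    left at each time reached. Neither step needs the maximum to be continuous in [t]. *)
Lemma sup_comparison : a <= b ->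
  (forall t, a <= t <= b -> exists2 x, K x & forall y, K y -> q y t <= q x t) ->
  (forall t (d : R), a <= t < b -> 0 < d -> exists2 e : R, 0 < e &
     forall t' x, t < t' < t + e -> t' <= b -> K x -> q x t' <= q x t + d) ->
  (forall t x, a < t <= b -> K x -> (forall y, K y -> q y t <= q x t) -> 0 < q x t ->
     exists2 e : R, 0 < e & forall t', t - e < t' < t -> q x t <= q x t') ->
  (forall x, K x -> q x a <= 0) ->
  forall x, K x -> q x b <= 0.
Proof.
move=> ab att rusc left init x0 Kx0; rewrite leNgt; apply/negP => qb0.
set m := q x0 b.
(* The times back to which the maximum stays at least [m]; its infimum is shown to be [a]. *)
pose S := [set t | a <= t <= b /\ forall t', t <= t' <= b -> exists2 x, K x & m <= q x t'].
have Sb : S b.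
  split; first by rewrite ab lexx.
  move=> t' h; exists x0 => //.
  by have -> : t' = b by apply/eqP; rewrite eq_le andbC.
have hS : has_inf S by split; [exists b|exists a => t [/andP[]]].
set c := inf S.
have ac : a <= c by apply: lb_le_inf; [exists b|move=> t [/andP[]]].
have cb : c <= b by apply: ge_inf => //; exact: hS.2.
have above t : c < t <= b -> exists2 x, K x & m <= q x t.
  move=> /andP[ct tb]; have [t' [_ h] t't] := inf_lt hS.1 ct.
  by apply: h; rewrite tb ltW.
have atc : exists2 x, K x & m <= q x c.
  have [cb'|] := ltP c b; last first.
    by move=> bc; exists x0 => //; rewrite (_ : c = b)//; apply/eqP; rewrite eq_le cb.
  have [xc Kxc hxc] := att c (introT andP (conj ac cb)).
  have [h|h] := leP m (q xc c); first by exists xc.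
  have d0 : 0 < (m - q xc c) / 2 by lra.
  have [e e0 he] := rusc c _ (introT andP (conj ac cb')) d0.
  pose t := Num.min b (c + e / 2).
  have ct : c < t by rewrite lt_min cb'; lra.
  have tb : t <= b by rewrite ge_min lexx.
  have te : t <= c + e / 2 by rewrite ge_min lexx orbT.
  have [x Kx hx] := above t (introT andP (conj ct tb)).
  have tt : c < t < c + e by rewrite ct /=; lra.
  have h1 := he t x tt tb Kx; have h2 := hxc x Kx.
  by exfalso; lra.
have [xc Kxc hxc] : exists2 x, K x & forall y, K y -> q y c <= q x c.
  by apply: att; rewrite ac cb.
have mxc : m <= q xc c by have [x Kx h] := atc; apply: le_trans h (hxc x Kx).
have m0 : 0 < m by [].
have [ac'|] := ltP a c; last first.
  move=> ca; have cE : c = a by apply/eqP; rewrite eq_le ca.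
  by have := init xc Kxc; rewrite -cE; lra.
have cab : a < c <= b by rewrite ac' cb.
have [e e0 he] := left c xc cab Kxc hxc (lt_le_trans m0 mxc).
pose t := Num.max a (c - e / 2).
have ta : a <= t by rewrite le_max lexx.
have te : c - e / 2 <= t by rewrite le_max lexx orbT.
have tc : t < c by rewrite gt_max ac' /=; lra.
have : S t.
  split; first by rewrite ta (le_trans (ltW tc)).
  move=> t' /andP[tt' t'b].
  have [ct'|] := ltP c t'; first by apply: above; rewrite ct' t'b.
  rewrite le_eqVlt => /predU1P[->//|t'c].
  exists xc => //; apply: le_trans mxc _; apply: he; apply/andP; split=> //; lra.
by move=> /(ge_inf hS.2); rewrite -/c; lra.
Qed.

End comparison.

Section no_dips.
Context (R : realType) (n : nat) (hn : (2 <= n)%N) (s p : R) (f : R -> R).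
Context (Omega : set 'rV[R]_n) (u : 'rV[R]_n -> R -> R).
Context (s01 : 0 < s < 1) (cf : continuous f) (p0 : p < 0).
Context (sol : classical_solution hn s p f Omega u).
Context (pos : forall x, Omega x -> 0 <= coord1 hn x).
Local Notation mu := (lebesgue_rV R n).
Local Notation kern := (@kern R n s).
Local Notation k0 := (frac_lap_const hn s).
Implicit Types (x y z c : 'rV[R]_n) (t : R).

(** A ball of the sup norm, that is a cube: compact, with explicit volume. *)
Definition sball c (r : R) : set 'rV[R]_n := [set x | `|x - c| <= r].

Lemma compact_sball c (r : R) : compact (sball c r).
Proof.
rewrite (_ : sball c r =
    [set v : 'rV[R]_n | forall i, `[c ord0 i - r, c ord0 i + r]%classic (v ord0 i)]).
  by apply: (@rV_compact _ n (fun i => `[c ord0 i - r, c ord0 i + r]%classic)) => i; exact: segment_compact.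
apply/seteqP; split => x /= h.
  move=> i; rewrite in_itv /= -ler_distl; apply: le_trans h.
  by have := coord_le_norm (x - c) i; rewrite !mxE.
rewrite /sball /= [`|_|]mx_normrE; apply: bigmax_le => [|[i j] _ /=].
  have [i|] := pselect (exists i : 'I_n, True); last first.
    by move=> /forallNP/(_ (Ordinal (ltnW hn))).
  by have [j _] := i; have := h j; rewrite in_itv /= => /andP[h1 h2]; lra.
by rewrite (ord1 i) !mxE ler_distl; have := h j; rewrite in_itv.
Qed.

Lemma solution_cts_x t : continuous (u ^~ t).
Proof. by move=> x; apply: differentiable_continuous; have [] := solution_C11loc sol t. Qed.

Lemma cts_sqr_enorm c : continuous (fun x : 'rV[R]_n => enorm (x - c) ^+ 2).
Proof.
rewrite (_ : (fun x => _) = (fun x : 'rV[R]_n => \sum_(i < n) (x - c) ord0 i ^+ 2)); last first.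
  by apply/funext => x; rewrite sqr_enorm.
apply: (@continuous_sum R 'rV[R]_n 'I_n _ (fun i x => (x - c) ord0 i ^+ 2)) => i x.
have cx : continuous (fun x : 'rV[R]_n => x ord0 i - c ord0 i).
  by move=> y; exact: (cvgB (@coord_continuous R 1 n ord0 i y) (cvg_cst _)).
have -> : (fun x : 'rV[R]_n => (x - c) ord0 i ^+ 2) =
  (fun x : 'rV[R]_n => (x ord0 i - c ord0 i) * (x ord0 i - c ord0 i)).
  by apply/funext => y; rewrite !mxE expr2.
exact: (cvgM (cx x) (cx x)).
Qed.

(** Only strictly smaller cubes are required, which leaves room for small cubes around each of their
    points. *)
Definition no_dip c (rho t : R) := forall th d : R, th < rho -> 0 < d ->
  exists2 e : R, 0 < e & forall t' x, t < t' < t + e -> sball c th x -> u x t - d <= u x t'.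

(** [sup_comparison] for [phi + al (t - a) - u]. The absence of dips is exactly the semicontinuity
    required there, and [u_t > al] at a positive maximum makes the difference larger just before. *)
Lemma barrier_comparison c (r : R) (phi : 'rV[R]_n -> R) (al a b : R) :
  0 <= r -> a <= b -> sball c r `<=` Omega -> continuous phi ->
  (forall t (d : R), a <= t < b -> 0 < d -> exists2 e : R, 0 < e &
    forall t' x, t < t' < t + e -> sball c r x -> u x t - d <= u x t') ->
  (forall x, sball c r x -> phi x <= u x a) ->
  (forall t x, a < t <= b -> sball c r x ->
     (forall y, sball c r y -> phi y - u y t <= phi x - u x t) ->
     0 < phi x + al * (t - a) - u x t -> al < derive1 (u x) t) ->
  forall x, sball c r x -> phi x + al * (b - a) <= u x b.
Proof.
move=> r0 ab KO cphi nd init dyn x Kx.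
pose q x t := phi x + al * (t - a) - u x t.
suff : q x b <= 0 by rewrite /q; lra.
have att t : exists2 x, sball c r x & forall y, sball c r y -> phi y - u y t <= phi x - u x t.
  have Kne : sball c r !=set0 by exists c; rewrite /sball /= subrr normr0.
  have cq : {within sball c r, continuous (fun y => phi y - u y t)}.
    by apply: continuous_subspaceT => y; exact: (cvgB (cphi y) (@solution_cts_x t y)).
  by have [y + hy] := EVT_max_rV Kne (@compact_sball c r) cq; rewrite inE => Ky; exists y => // z Kz; apply: hy; rewrite inE.
apply: (@sup_comparison R _ (sball c r) q a b ab) => //.
- move=> t _; have [y Ky hy] := att t; exists y => // z /hy; rewrite /q; lra.
- move=> t d tab d0; have d20 : 0 < d / 2 by lra.
  have [e e0 he] := nd t _ tab d20.
  pose m := Num.min e (d / (2 * (`|al| + 1))).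
  have al0 : 0 < `|al| + 1 by rewrite ltr_wpDl.
  exists m; first by rewrite lt_min e0 /=; rewrite divr_gt0// mulr_gt0.
  move=> t' y /andP[h1 h2] _ Ky.
  have [me md] : m <= e /\ m <= d / (2 * (`|al| + 1)) by rewrite /m !ge_min !lexx orbT.
  have hu : u y t - d / 2 <= u y t' by apply: he => //; rewrite h1 /=; lra.
  have hal : al * (t' - t) <= d / 2.
    apply: (@le_trans _ _ ((`|al| + 1) * (d / (2 * (`|al| + 1))))).
      apply: (@le_trans _ _ (`|al| * (t' - t))).
        by rewrite ler_wpM2r ?ler_norm//; lra.
      apply: ler_pM => //; lra.
    by rewrite le_eqVlt; apply/orP; left; apply/eqP; field; rewrite gt_eqF.
  by rewrite /q; lra.
- move=> t y tab Ky hy qy.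
  have [Oy hyt] : Omega y /\ (forall z, sball c r z -> phi z - u z t <= phi y - u y t).
    by split; [exact: KO|move=> z /hy; rewrite /q; lra].
  have D : derivable (u y) t 1 by exact: (solution_derivable sol).
  have [e e0 he] := left_decrease D (dyn t y tab Ky hyt qy).
  by exists e => // t' /he; rewrite /q; lra.
- by move=> y /init; rewrite /q subrr mulr0 addr0; lra.
Qed.

Lemma sdiff_paraboloid c (k : R) x z :
  sdiff (fun x => k * enorm (x - c) ^+ 2) x z = 2 * k * enorm z ^+ 2.
Proof.
rewrite /sdiff !sqr_enorm -[X in _ = X]mulrA; rewrite !mulr_sumr -!big_split /= -sumrB.
by apply: eq_bigr => i _; rewrite !mxE; ring.
Qed.

(** The barrier is [u(., a)] minus a steep paraboloid: at a contact point the second differences of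
    [u] at the later time inherit a lower bound from time [a], so [C] depends on [r] and the
    regularity at [a] alone. *)
Lemma no_dip_persistence (r N : R) : 0 < r <= 1 -> 0 <= N ->
  exists2 C : R, 0 <= C & forall c x0 (th rho k a b : R), th < rho ->
    sball x0 r `<=` sball c th -> sball x0 r `<=` Omega ->
    (forall x, sball x0 r x -> `|x| <= k) ->
    (forall t, a <= t < b -> no_dip c rho t) -> regular u k N a ->
    forall t, a <= t < b -> u x0 a - C * (t - a) <= u x0 t.
Proof.
move=> /andP[r0 r1] N0.
have [G G0 hG] := f_bounded cf N.
have k00 := frac_lap_const_gt0 hn s01.
(* A contact point has [kap |x - x0|^2 < N + 1], that is [|x - x0| < r / 2], so that balls of radius
   [r / 2] around it stay in the cube. [2 B] collects the second differences of [u(., a)] and of the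
   paraboloid. *)
pose kap := 4 * (N + 1) / r ^+ 2; pose B := (N + 2 * kap) / 2.
have kap0 : 0 < kap by rewrite divr_gt0 ?exprn_gt0// mulr_gt0//; lra.
have B0 : 0 <= B by rewrite /B; lra.
pose P := k0 * (B * ((r / 2) `^ (2 - 2 * s) * momentc n s) + N * ((r / 2) `^ (- (2 * s)) * tailc n s)).
have P0 : 0 <= P.
  by rewrite mulr_ge0 ?(ltW k00)// addr_ge0// mulr_ge0// mulr_ge0 ?powR_ge0 ?momentc_ge0 ?tailc_ge0.
exists (P + G + 1); first lra.
move=> c x0 th rho k a b thr Kth KO Kk nd reg t /andP[at_ tb].
pose phi x := u x a - kap * enorm (x - x0) ^+ 2.
have cphi : continuous phi.
  move=> x; apply: (cvgB (@solution_cts_x a x)); apply: cvgMr; exact: cts_sqr_enorm.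
have nd' t' (d : R) : a <= t' < t -> 0 < d -> exists2 e : R, 0 < e &
    forall t'' x, t' < t'' < t' + e -> sball x0 r x -> u x t' - d <= u x t''.
  move=> /andP[h1 h2] d0; have t'b : a <= t' < b by rewrite h1 (lt_trans h2).
  have [e e0 he] := nd t' t'b th d thr d0.
  by exists e => // t'' x ht /Kth; apply: he.
have Kx0 : sball x0 r x0 by rewrite /sball /= subrr normr0 ltW.
have init x : sball x0 r x -> phi x <= u x a.
  by move=> _; rewrite /phi lerBlDr lerDl mulr_ge0 ?sqr_ge0// ltW.
have := barrier_comparison (al := - (P + G + 1)) (ltW r0) at_ KO cphi nd' init.
move=> H; have : phi x0 + - (P + G + 1) * (t - a) <= u x0 t; last first.
  by rewrite /phi subrr enorm0 expr0n /= mulr0 subr0; lra.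
apply: H => // {tb nd' at_} t' x /andP[at' tt] Kx hmax; move: t' at' hmax {tt} => {}t at' hmax.
move=> hpos.
have ta0 : 0 <= (P + G + 1) * (t - a) by rewrite mulr_ge0//; lra.
have ux0 := solution_ge0 sol x t.
have [h1 h2 _] := reg x (Kk x Kx).
have uaN : u x a <= N by apply: le_trans (ler_norm _) h1.
have pe : kap * enorm (x - x0) ^+ 2 < N + 1 by move: hpos; rewrite /phi; lra.
have uxN : u x t <= N.
  have : 0 <= kap * enorm (x - x0) ^+ 2 by rewrite mulr_ge0 ?sqr_ge0// ltW.
  by move: hpos; rewrite /phi; lra.
have xr : enorm (x - x0) <= r / 2.
  rewrite -(@ler_pXn2r _ 2)// ?nnegrE ?enorm_ge0//; last lra.
  have : enorm (x - x0) ^+ 2 < (N + 1) / kap by rewrite ltr_pdivlMr// mulrC.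
  have -> : (N + 1) / kap = (r / 2) ^+ 2.
    by rewrite /kap; field; apply/andP; split; rewrite gt_eqF//; lra.
  by move/ltW.
have xzK z : enorm z <= r / 2 -> sball x0 r (x + z).
  move=> zr; rewrite /sball /=; have -> : x + z - x0 = (x - x0) + z by rewrite addrAC.
  apply: (le_trans (ler_normD _ _)).
  by have := norm_le_enorm (x - x0); have := norm_le_enorm z; lra.
have hB z : enorm z <= r / 2 -> - (2 * B) * enorm z ^+ 2 <= sdiff (u ^~ t) x z.
  move=> zr; have z1 : enorm z <= 1 by lra.
  have m1 := hmax _ (xzK z zr).
  have m2 : phi (x - z) - u (x - z) t <= phi x - u x t.
    by apply: hmax; apply: xzK; rewrite enormN.
  have := h2 z z1; rewrite ler_norml => /andP[h2' _].
  have E1 := sdiff_paraboloid x0 kap x z.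
  have E2 : sdiff phi x z = sdiff (u ^~ a) x z - sdiff (fun x => kap * enorm (x - x0) ^+ 2) x z.
    by rewrite /sdiff /phi; ring.
  rewrite E1 in E2; move: E2 m1 m2 h2'; rewrite {1}/sdiff [sdiff (u ^~ t) _ _]/sdiff /B.
  set w := phi (x + z); set w' := phi (x - z).
  move=> E2 m1 m2 h2'; rewrite [- (2 * _) * _](_ : _ = - N * enorm z ^+ 2 - 2 * kap * enorm z ^+ 2); last by field.
  lra.
have Ox := KO x Kx.
have r2 : 0 < r / 2 <= 1 by apply/andP; split; lra.
have := time_derivative_ge_cst s01 sol Ox r2 B0 hB uxN; rewrite -/P.
have : `|f (u x t)| <= G by apply: hG; apply/andP; split; lra.
rewrite ler_norml => /andP[hf _].
have : 0 <= coord1 hn x * u x t `^ p by rewrite mulr_ge0 ?powR_ge0 ?pos.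
lra.
Qed.

End no_dips.

(** * Dini derivatives and the L^2 energy estimate *)

Lemma le_limn_einf (R : realType) (F : (\bar R)^nat) (G : R) :
  (forall e : R, 0 < e -> \forall k \near \oo, ((G - e)%:E <= F k)%E) ->
  (G%:E <= limn_einf F)%E.
Proof.
move=> h; rewrite limn_einf_lim; apply/lee_addgt0Pr => e e0.
suff : ((G - e)%:E <= limn (einfs F))%E by rewrite EFinB leeBlDr.
apply: lime_ge; first exact: is_cvg_einfs.
have [k0 _ hk0] := h e e0; exists k0 => // k /= k0k.
by apply: le_ereal_inf_tmp => _ [j /= kj <-]; apply: hk0; exact: leq_trans kj.
Qed.

Lemma limn_einf_le (R : realType) (F : (\bar R)^nat) (c : \bar R) :
  (forall k, (F k <= c)%E) -> (limn_einf F <= c)%E.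
Proof.
move=> h; rewrite limn_einf_lim; apply: lime_le; first exact: is_cvg_einfs.
near=> k; apply: le_trans (h k); apply: ereal_inf_lbound; exists k => //=.
Unshelve. all: by end_near. Qed.

(** The growth condition is imposed after [a] only. The argument starts at [a0 > a] with an
    arbitrarily small slope, and continuity lets [a0] tend to [a]; this is how a dip at the initial
    time is tolerated. *)
Lemma dini_nonpos (R : realType) (J : R -> R) (a b : R) : a <= b ->
  {in `[a, b]%classic, continuous J} ->
  (forall t d : R, a < t < b -> 0 < d -> exists2 e : R, 0 < e &
     forall t', t < t' < t + e -> J t' <= J t + d * (t' - t)) ->
  J b <= J a.
Proof.
move=> ab cJ dini; move: ab; rewrite le_eqVlt => /predU1P[->//|ab].
have incr (a0 d : R) : a < a0 < b -> 0 < d -> J b <= J a0 + d * (b - a0).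
  move=> /andP[aa0 a0b] d0.
  pose S := [set t | a0 <= t <= b /\ forall t', a0 <= t' <= t -> J t' <= J a0 + d * (t' - a0)].
  have Sa0 : S a0.
    split; first by rewrite lexx ltW.
    by move=> t' h; have -> : t' = a0 by [apply/eqP; rewrite eq_le andbC]; rewrite subrr mulr0 addr0.
  have hS : has_sup S by split; [exists a0|exists b => t [/andP[]]].
  set c := sup S.
  have a0c : a0 <= c by apply: ub_le_sup => //; exact: hS.2.
  have cb : c <= b by apply: ge_sup; [exists a0|move=> t [/andP[]]].
  have below t : a0 <= t < c -> J t <= J a0 + d * (t - a0).
    move=> /andP[h1 h2]; have [t' [_ h] t't] := sup_gt hS.1 h2.
    by apply: h; rewrite h1 ltW.
  have atc : J c <= J a0 + d * (c - a0).
    rewrite leNgt; apply/negP => hc; have d20 : 0 < (J c - (J a0 + d * (c - a0))) by lra.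
    have ac' : c \in `[a, b]%classic by rewrite inE /= in_itv /=; apply/andP; split; lra.
    have /cvgrPdist_lt/(_ _ d20) /nbhs_ballP[e /= e0 he] := cJ c ac'.
    have [h|ac0] := leP c a0.
      have E : c = a0 by apply/eqP; rewrite eq_le h.
      by move: d20; rewrite E; lra.
    pose t := Num.max a0 (c - e / 2).
    have ta0 : a0 <= t by rewrite le_max lexx.
    have te : c - e / 2 <= t by rewrite le_max lexx orbT.
    have tc : t < c by rewrite gt_max ac0 /=; lra.
    have bt : ball c e t by rewrite /ball /= ltr_norml; apply/andP; split; lra.
    have := he t bt; rewrite ltr_norml => /andP[_ h2].
    have := below t; rewrite ta0 tc => /(_ isT) h3.
    have : d * (t - a0) <= d * (c - a0) by rewrite ler_wpM2l ?(ltW d0)//; lra.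
    lra.
  suff -> : b = c by [].
  apply/eqP; rewrite eq_le cb andbT leNgt; apply/negP => cb'.
  have acb : a < c < b by rewrite cb' andbT; lra.
  have [e e0 he] := dini c d acb d0.
  pose t := Num.min b (c + e / 2).
  have ct : c < t by rewrite lt_min cb' /=; lra.
  have tb : t <= b by rewrite ge_min lexx.
  have te : t <= c + e / 2 by rewrite ge_min lexx orbT.
  have : S t.
    split; first by rewrite tb (le_trans a0c)// ltW.
    move=> t' /andP[h1 h2]; have [h3|] := ltP t' c; first by apply: below; rewrite h1.
    rewrite le_eqVlt => /predU1P[<-//|ct'].
    have tt : c < t' < c + e by rewrite ct' /=; lra.
    have := he t' tt; lra.
  by move=> /(ub_le_sup hS.2); rewrite -/c; lra.
apply/ler_addgt0Pr => e e0.
pose d := e / (2 * (b - a)).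
have ba : 0 < b - a by lra.
have d0 : 0 < d by rewrite divr_gt0// mulr_gt0.
have e20 : 0 < e / 2 by lra.
have aab : a \in `[a, b]%classic by rewrite inE /= in_itv /= lexx ltW.
have /cvgrPdist_lt/(_ _ e20) /nbhs_ballP[e1 /= e10 he] := cJ a aab.
pose a0 := Num.min ((a + b) / 2) (a + e1 / 2).
have aa0 : a < a0 by rewrite lt_min; apply/andP; split; lra.
have a0b : a0 <= (a + b) / 2 by rewrite ge_min lexx.
have a0e : a0 <= a + e1 / 2 by rewrite ge_min lexx orbT.
have ba0 : ball a e1 a0 by rewrite /ball /= ltr_norml; apply/andP; split; lra.
have := he a0 ba0; rewrite ltr_norml => /andP[h1 _].
have aa0b : a < a0 < b by rewrite aa0; lra.
have := incr a0 d aa0b d0.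
have : d * (b - a0) <= e / 2.
  apply: (@le_trans _ _ (d * (b - a))); first by rewrite ler_wpM2l ?(ltW d0)//; lra.
  by rewrite /d le_eqVlt; apply/orP; left; apply/eqP; field; rewrite gt_eqF.
lra.
Qed.

Section energy.
Context (R : realType) (n : nat) (s : R) (s01 : 0 < s < 1).
Local Notation mu := (lebesgue_rV R n).
Local Notation kern := (@kern R n s).
Local Notation moment := (@moment R n s).
Implicit Types (x z : 'rV[R]_n).

Definition near_far (B N r : R) z := if enorm z <= r then B * moment z else N * kern z.

Lemma near_far_ge0 B N r z : 0 <= B -> 0 <= N -> 0 <= near_far B N r z.
Proof.
by move=> B0 N0; rewrite /near_far; case: ifP => _; rewrite mulr_ge0 ?moment_ge0 ?kern_ge0.
Qed.

Lemma measurable_near_far B N r : measurable_fun setT (near_far B N r).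
Proof.
apply: measurable_fun_ifT.
- by apply: measurable_fun_ler; [exact: measurable_enorm|exact: measurable_cst].
- by apply: measurable_funM => //; exact: measurable_moment.
- by apply: measurable_funM => //; exact: measurable_kern.
Qed.

Lemma near_far_integral B N e r : 0 < r -> 0 <= B -> 0 <= N ->
  mu.-integrable [set z | e < enorm z] (EFin \o near_far B N r) /\
  \int[mu]_(z in [set z | e < enorm z]) near_far B N r z <=
    B * (r `^ (2 - 2 * s) * momentc n s) + N * (r `^ (- (2 * s)) * tailc n s).
Proof.
move=> r0 B0 N0.
have mD := @measurable_enorm_gt R n e.
have mA := @measurable_enorm_le R n r.
have mT := @measurable_enorm_gt R n r.
have mW : measurable_fun setT (EFin \o near_far B N r).
  by apply/measurable_EFinP; exact: measurable_near_far.
have W0 z : (0 <= (EFin \o near_far B N r) z)%E by rewrite lee_fin near_far_ge0.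
pose A := [set z : 'rV[R]_n | enorm z <= r]; pose T := [set z : 'rV[R]_n | r < enorm z].
have DAT : [set z : 'rV[R]_n | e < enorm z] `<=` A `|` T.
  by move=> z _; rewrite /A /T /=; case: leP; [left|right].
have EA : (\int[mu]_(z in A) (EFin \o near_far B N r) z =
    (B * (r `^ (2 - 2 * s) * momentc n s))%:E)%E.
  have E : (\int[mu]_(z in A) (EFin \o near_far B N r) z =
      \int[mu]_(z in A) (B%:E * (moment z)%:E))%E.
    by apply: eq_integral => z; rewrite inE /A /= /near_far => ->; rewrite EFinM.
  rewrite E ge0_integralZl_EFin//.
  - by rewrite moment_integral.
  - by move=> z _; rewrite lee_fin moment_ge0.
  - by apply/measurable_EFinP; apply: measurable_funTS; exact: measurable_moment.
have ET : (\int[mu]_(z in T) (EFin \o near_far B N r) z =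
    (N * (r `^ (- (2 * s)) * tailc n s))%:E)%E.
  have E : (\int[mu]_(z in T) (EFin \o near_far B N r) z =
      \int[mu]_(z in T) (N%:E * (kern z)%:E))%E.
    apply: eq_integral => z; rewrite inE /T /= /near_far leNgt => ->.
    by rewrite /= EFinM.
  rewrite E ge0_integralZl_EFin//.
  - by rewrite tail_integral.
  - by move=> z _; rewrite lee_fin kern_ge0.
  - by apply/measurable_EFinP; apply: measurable_funTS; exact: measurable_kern.
have le : (\int[mu]_(z in [set z | (e < enorm z)%R]) (EFin \o near_far B N r) z <=
    (B * (r `^ (2 - 2 * s) * momentc n s) + N * (r `^ (- (2 * s)) * tailc n s))%:E)%E.
  apply: (@le_trans _ _ (\int[mu]_(z in A `|` T) (EFin \o near_far B N r) z)%E).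
    apply: ge0_subset_integral DAT => //; first exact: measurableU.
    exact: measurable_funTS.
  rewrite EFinD -EA -ET; exact: (ge0_le_integral_setU mu mA mT mW W0).
have I0 : (0 <= \int[mu]_(z in [set z | (e < enorm z)%R]) (EFin \o near_far B N r) z)%E.
  by apply: integral_ge0.
split.
  apply/integrableP; split; first exact: measurable_funTS.
  rewrite (eq_integral (EFin \o near_far B N r)); last first.
    by move=> z _ /=; rewrite ger0_norm ?near_far_ge0.
  exact: (le_lt_trans le (ltry _)).
rewrite -lee_fin /Rintegral fineK//.
by rewrite ge0_fin_numE//; exact: (le_lt_trans le (ltry _)).
Qed.

Lemma integrable_bounded_kern (H : 'rV[R]_n -> R) (M e : R) : 0 < e ->
  measurable_fun setT H -> (forall z, `|H z| <= M) ->
  mu.-integrable [set z | e < enorm z] (EFin \o (fun z => H z * kern z)).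
Proof.
move=> e0 mH HM; have mD := @measurable_enorm_gt R n e.
apply: (le_integrable mD _ _ (integrable_kern n s01 M e0)).
  apply/measurable_EFinP; apply: measurable_funTS.
  by apply: measurable_funM => //; exact: measurable_kern.
move=> z _; rewrite lee_fin normrM (ger0_norm (kern_ge0 _ _)).
by apply: (le_trans _ (ler_norm _)); rewrite ler_wpM2r ?kern_ge0.
Qed.

(* The Dirichlet form of [Q] is nonnegative: [Q x Q y <= (Q x ^2 + Q y ^2) / 2]. *)
Lemma trunc_lap_energy (v Q : 'rV[R]_n -> R) x (M B N e r : R) : L2s s v ->
  0 < e -> 0 < r -> 0 <= B -> 0 <= N ->
  measurable_fun setT Q -> (forall z, 0 <= Q z <= M) ->
  (forall z, enorm z <= r ->
     - sdiff v x z <= 2 * B * enorm z ^+ 2 + (Q (x + z) + Q (x - z) - 2 * Q x)) ->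
  (forall z, r < enorm z ->
     - sdiff v x z <= 2 * N + (Q (x + z) + Q (x - z) - 2 * Q x)) ->
  2 * Q x * trunc_lap s v x e <=
  2 * Q x * (B * (r `^ (2 - 2 * s) * momentc n s) + N * (r `^ (- (2 * s)) * tailc n s)) +
  2^-1 * \int[mu]_(z in [set z | e < enorm z]) (Q (x + z) ^+ 2 * kern z) +
  2^-1 * \int[mu]_(z in [set z | e < enorm z]) (Q (x - z) ^+ 2 * kern z) -
  Q x ^+ 2 * (e `^ (- (2 * s)) * tailc n s).
Proof.
move=> hv e0 r0 B0 N0 mQ QM h1 h2.
have mD := @measurable_enorm_gt R n e.
have [is_ ->] := trunc_lap_sym s01 hv x e0.
have [iW leW] := near_far_integral e r0 B0 N0.
have Q2 z : `|Q z ^+ 2| <= M ^+ 2.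
  have /andP[q0 qM] := QM z; rewrite ger0_norm ?sqr_ge0// ler_pXn2r ?nnegrE//.
  exact: le_trans qM.
have iP : mu.-integrable [set z | e < enorm z] (EFin \o (fun z => Q (x + z) ^+ 2 * kern z)).
  apply: (@integrable_bounded_kern _ (M ^+ 2)) => //.
  by apply: measurable_funX; exact: measurable_shift.
have iN : mu.-integrable [set z | e < enorm z] (EFin \o (fun z => Q (x - z) ^+ 2 * kern z)).
  apply: (@integrable_bounded_kern _ (M ^+ 2)) => //.
  by apply: measurable_funX; exact: measurable_opp.
have iC := integrable_kern n s01 (- Q x ^+ 2) e0.
rewrite -(mulNr (Q x ^+ 2)) -(Rtail_integral n s01 _ e0).
have i1 := integrableZl_EFin (Q x) mD is_.
have i2 := integrableZl_EFin (2 * Q x) mD iW.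
have i3 := integrableZl_EFin 2^-1 mD iP.
have i4 := integrableZl_EFin 2^-1 mD iN.
have -> : 2 * Q x * (2^-1 * \int[mu]_(z in [set z | e < enorm z]) (- sdiff v x z * kern z)) =
   \int[mu]_(z in [set z | e < enorm z]) (Q x * (- sdiff v x z * kern z)).
  by rewrite RintegralZl//; move: (\int[mu]_(z in _) _) => I; field.
apply: (@le_trans _ _ (\int[mu]_(z in [set z | e < enorm z])
   (2 * Q x * near_far B N r z + 2^-1 * (Q (x + z) ^+ 2 * kern z) +
    2^-1 * (Q (x - z) ^+ 2 * kern z) + (- Q x ^+ 2) * kern z))).
  apply: le_Rintegral => //.
    apply: (eq_integrable mD (fun z => (EFin \o (fun z => 2 * Q x * near_far B N r z)%R) z +
      (EFin \o (fun z => 2^-1 * (Q (x + z) ^+ 2 * kern z))%R) z +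
      (EFin \o (fun z => 2^-1 * (Q (x - z) ^+ 2 * kern z))%R) z +
      (EFin \o (fun z => - Q x ^+ 2 * kern z)%R) z)%E).
      by move=> z _ /=; rewrite !EFinD.
    by do 3 apply: integrableD => //.
  move=> z _.
  have /andP[q0 _] := QM x.
  have key : Q x * (Q (x + z) + Q (x - z) - 2 * Q x) <=
      2^-1 * Q (x + z) ^+ 2 + 2^-1 * Q (x - z) ^+ 2 - Q x ^+ 2.
    by have := sqr_ge0 (Q (x + z) - Q x); have := sqr_ge0 (Q (x - z) - Q x); nra.
  pose E := 2^-1 * Q (x + z) ^+ 2 + 2^-1 * Q (x - z) ^+ 2 - Q x ^+ 2.
  rewrite mulrA /near_far /moment; case: (leP (enorm z) r) => zr.
    have h : Q x * - sdiff v x z <= 2 * Q x * B * enorm z ^+ 2 + E.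
      by apply: (le_trans (ler_wpM2l q0 (h1 z zr))); rewrite mulrDr; apply: lerD => //; lra.
    apply: (le_trans (ler_wpM2r (kern_ge0 s z) h)).
    by rewrite le_eqVlt; apply/orP; left; apply/eqP; rewrite /E; ring.
  have h : Q x * - sdiff v x z <= 2 * Q x * N + E.
    by apply: (le_trans (ler_wpM2l q0 (h2 z zr))); rewrite mulrDr; apply: lerD => //; lra.
  apply: (le_trans (ler_wpM2r (kern_ge0 s z) h)).
  by rewrite le_eqVlt; apply/orP; left; apply/eqP; rewrite /E; ring.
have i12 := integrableD mD i2 i3; have i123 := integrableD mD i12 i4.
rewrite RintegralD// RintegralD// RintegralD//.
rewrite (RintegralZl _ _ iW)// (RintegralZl _ _ iP)// (RintegralZl _ _ iN)//.
have /andP[q0 _] := QM x.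
by rewrite !lerD2r ler_wpM2l// mulr_ge0.
Qed.

(** Tonelli, then translation invariance in [x] for each fixed [z]; the kernel integrates to its
    tail mass. *)
Lemma pair_integral (H : 'rV[R]_n -> R) (l e : R) : `|l| = 1 -> 0 < e ->
  measurable_fun setT H -> (forall z, 0 <= H z) ->
  measurable_fun setT
    (fun x => \int[mu]_(z in [set z | (e < enorm z)%R]) (H (x + l *: z) * kern z)%:E)%E /\
  (\int[mu]_x \int[mu]_(z in [set z | (e < enorm z)%R]) (H (x + l *: z) * kern z)%:E =
  (e `^ (- (2 * s)) * tailc n s)%:E * \int[mu]_x (H x)%:E)%E.
Proof.
move=> l1 e0 mH H0; have mD := @measurable_enorm_gt R n e.
have l0 : l != 0 by rewrite -normr_gt0 l1.
pose kt (z : 'rV[R]_n) := if e < enorm z then kern z else 0.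
have kt0 z : 0 <= kt z by rewrite /kt; case: ifP => _ //; exact: kern_ge0.
have mkt : measurable_fun setT kt.
  apply: measurable_fun_ifT => //; last exact: measurable_kern.
  by apply: measurable_fun_ltr; [exact: measurable_cst|exact: measurable_enorm].
have restr (g : 'rV[R]_n -> R) :
    (\int[mu]_(z in [set z | (e < enorm z)%R]) (g z * kern z)%:E =
     \int[mu]_z (g z * kt z)%:E)%E.
  rewrite integral_mkcond; apply: eq_integral => z _.
  rewrite patchE /kt; case: ifPn => h; first by rewrite inE /= in h; rewrite h.
  by rewrite notin_setE /= in h; rewrite (negbTE (introN idP h)) mulr0.
pose F (xz : 'rV[R]_n * 'rV[R]_n) := (H (xz.1 + l *: xz.2) * kt xz.2)%:E.
have F0 xz : (0 <= F xz)%E by rewrite lee_fin mulr_ge0.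
have mF : measurable_fun setT F.
  apply/measurable_EFinP; apply: measurable_funM.
    apply: (measurableT_comp mH); apply: measurable_fun_rV => i.
    rewrite (_ : (fun t => _) = (fun t : 'rV[R]_n * 'rV[R]_n => t.1 ord0 i + l * t.2 ord0 i)).
      apply: measurable_funD; first exact: (measurableT_comp (@measurable_coordR R n i) measurable_fst).
      apply: measurable_funM => //.
      exact: (measurableT_comp (@measurable_coordR R n i) measurable_snd).
    by apply/funext => t; rewrite !mxE.
  exact: (measurableT_comp mkt measurable_snd).
have E1 : (fun x => \int[mu]_(z in [set z | (e < enorm z)%R]) (H (x + l *: z) * kern z)%:E)%E
    = (fun x => \int[mu]_z F (x, z))%E.
  by apply/funext => x; exact: (restr (fun z => H (x + l *: z))).
rewrite E1; split; first exact: measurable_tonelli_rV.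
rewrite (tonelli_rV mF F0).
set I := (\int[mu]_x (H x)%:E)%E.
have inner z : (\int[mu]_x F (x, z) = I * (kt z)%:E)%E.
  have E : (\int[mu]_x F (x, z) = \int[mu]_x ((kt z)%:E * (H (1 *: x + l *: z)%R)%:E))%E.
    by apply: eq_integral => x _; rewrite /F /= scale1r mulrC EFinM.
  have mH1 : measurable_fun setT (EFin \o H) by apply/measurable_EFinP.
  have H01 (x : 'rV[R]_n) : setT x -> (0 <= (EFin \o H) x)%E by rewrite lee_fin.
  have := ge0_integral_rV_affine_in (l *: z) (oner_neq0 R) measurableT mH1 H01.
  rewrite normr1 expr1n mul1e preimage_setT => E2.
  rewrite E ge0_integralZl_EFin//.
  - by rewrite muleC /I -E2.
  - by move=> x _; rewrite lee_fin.
  - have := @measurable_fun_rV_affine R n 1 (l *: z) _ _ measurableT mH1.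
    by rewrite preimage_setT.
rewrite (eq_integral _ _ (fun z _ => inner z)).
have mk : measurable_fun setT (EFin \o kt) by apply/measurable_EFinP.
have k0' (x : 'rV[R]_n) : setT x -> (0 <= (EFin \o kt) x)%E by rewrite lee_fin.
have I0 : (0 <= I)%E by apply: integral_ge0 => x _; rewrite lee_fin.
rewrite (ge0_integralZl mu measurableT mk k0' I0) muleC; congr (_ * _)%E.
rewrite -tail_integral//.
have E3 := restr (fun=> 1).
have E4 : (\int[mu]_(z in [set z | (e < enorm z)%R]) (1 * kern z)%:E =
   \int[mu]_(z in [set z | (e < enorm z)%R]) (kern z)%:E)%E.
  by apply: eq_integral => z _; rewrite mul1r.
have E5 : (\int[mu]_z (1 * kt z)%:E = \int[mu]_z (EFin \o kt) z)%E.
  by apply: eq_integral => z _; rewrite mul1r.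
by rewrite -E5 -E3 E4.
Qed.

End energy.

Lemma right_increase (R : realType) (g : R -> R) t al : derivable g t 1 ->
  al < derive1 g t ->
  exists2 e : R, 0 < e & forall h, 0 < h < e -> g t + al * h <= g (t + h).
Proof.
move=> dg; rewrite derive1E => ad.
have : \forall h \near (0 : R)^', al < h^-1 *: ((g \o shift t) (h *: 1) - g t).
  by apply: cvgr_gt ad; exact: dg.
move=> /nbhs_ballP[e /= e0 he]; exists e => // h /andP[h1 h2].
have h0 : h != 0 by rewrite gt_eqF.
have := he h; rewrite /ball /= sub0r normrN gtr0_norm// => /(_ h2 h0).
rewrite [h *: 1]mulr1 /GRing.scale /= -(ltr_pM2l h1) mulVKf// (addrC h t).
lra.
Qed.

Section fatou_energy.
Context (R : realType) (n : nat) (s : R) (s01 : 0 < s < 1).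
Local Notation mu := (lebesgue_rV R n).
Local Notation kern := (@kern R n s).
Implicit Types (x z : 'rV[R]_n).

(** With [c] the tail mass, [c H - tail_average H] is the truncated Laplacian of [H], symmetrised;
    its integral over the whole space is 0 when [H] is integrable. *)
Definition tail_average (H : 'rV[R]_n -> R) (e : R) x :=
  2^-1 * \int[mu]_(z in [set z | e < enorm z]) (H (x + z) * kern z) +
  2^-1 * \int[mu]_(z in [set z | e < enorm z]) (H (x - z) * kern z).

Lemma tail_average_ge0 (H : 'rV[R]_n -> R) (e : R) x : (forall z, 0 <= H z) -> 0 <= tail_average H e x.
Proof.
move=> H0; rewrite addr_ge0// mulr_ge0// /Rintegral; apply: fine_ge0;
  by apply: integral_ge0 => z _; rewrite lee_fin mulr_ge0 ?kern_ge0.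
Qed.

Lemma tail_average_integral (H : 'rV[R]_n -> R) (M e : R) : 0 < e -> measurable_fun setT H ->
  (forall z, 0 <= H z <= M) ->
  measurable_fun setT (EFin \o tail_average H e) /\
  (\int[mu]_x (tail_average H e x)%:E =
  (e `^ (- (2 * s)) * tailc n s)%:E * \int[mu]_x (H x)%:E)%E.
Proof.
move=> e0 mH HM.
have H0 z : 0 <= H z by have /andP[] := HM z.
have HM' z : `|H z| <= M by have /andP[h1 h2] := HM z; rewrite ger0_norm.
pose I l x := (\int[mu]_(z in [set z | (e < enorm z)%R]) (H (x + l *: z)%R * kern z)%:E)%E.
have I0 l x : (0 <= I l x)%E.
  by apply: integral_ge0 => z _; rewrite lee_fin mulr_ge0 ?kern_ge0.
have n1 : `|-1 : R| = 1 by rewrite normrN1.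
have [m1 E1] := pair_integral s01 (normr1 R) e0 mH H0.
have [m2 E2] := pair_integral s01 n1 e0 mH H0.
have mD := @measurable_enorm_gt R n e.
have fin1 x : I 1%R x = (\int[mu]_(z in [set z | e < enorm z]) (H (x + z) * kern z))%:E.
  have i := integrable_bounded_kern s01 e0 (measurable_shift x mH) (fun z => HM' (x + z)).
  rewrite /Rintegral fineK; last exact: integrable_fin_num.
  by apply: eq_integral => z _; rewrite scale1r.
have fin2 x : I (-1)%R x = (\int[mu]_(z in [set z | e < enorm z]) (H (x - z) * kern z))%:E.
  have i := integrable_bounded_kern s01 e0 (measurable_opp x mH) (fun z => HM' (x - z)).
  rewrite /Rintegral fineK; last exact: integrable_fin_num.
  by apply: eq_integral => z _; rewrite scaleN1r.
have E : EFin \o tail_average H e = (fun x => (2^-1)%R%:E * I 1%R x + (2^-1)%R%:E * I (-1)%R x)%E.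
  by apply/funext => x; rewrite /= fin1 fin2 /tail_average EFinD !EFinM.
have half0 : (0 <= 2^-1 :> R) by [].
have mI1 : measurable_fun setT (fun x => (2^-1)%R%:E * I 1%R x)%E by exact: measurable_funeM.
have mI2 : measurable_fun setT (fun x => (2^-1)%R%:E * I (-1)%R x)%E by exact: measurable_funeM.
split; first by rewrite E; exact: emeasurable_funD.
have -> : (\int[mu]_x (tail_average H e x)%:E =
    \int[mu]_x ((2^-1)%R%:E * I 1%R x + (2^-1)%R%:E * I (-1)%R x))%E.
  by rewrite -E.
have J10 x : setT x -> (0 <= (2^-1)%R%:E * I 1%R x)%E by move=> _; rewrite mule_ge0.
have J20 x : setT x -> (0 <= (2^-1)%R%:E * I (-1)%R x)%E by move=> _; rewrite mule_ge0.
rewrite (ge0_integralD mu measurableT J10 mI1 J20 mI2).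
rewrite (ge0_integralZl_EFin mu measurableT (fun x _ => I0 1 x) m1 half0).
rewrite (ge0_integralZl_EFin mu measurableT (fun x _ => I0 (-1) x) m2 half0).
rewrite E1 E2 -ge0_muleDl ?lee_fin// -EFinD.
by rewrite (_ : 2^-1 + 2^-1 = 1 :> R) ?mul1e//; lra.
Qed.

(** In the application [F k = D - (difference quotient of the squared excess)]: the constant [D]
    makes it nonnegative, as Fatou's lemma requires, and [d] is the supposed growth of the energy.
    In the limit the nonlocal terms have the good sign, because [H] lives on [K] while
    [tail_average H] spreads beyond it. *)
Lemma fatou_energy (K : set 'rV[R]_n) (H : 'rV[R]_n -> R) (F : nat -> 'rV[R]_n -> R)
    (M D d k0 e : R) : measurable K -> (mu K < +oo)%E -> 0 < e -> 0 <= k0 -> 0 <= D ->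
  measurable_fun setT H -> (forall z, 0 <= H z <= M) -> (forall z, ~ K z -> H z = 0) ->
  (forall k, measurable_fun setT (F k)) -> (forall k x, K x -> 0 <= F k x) ->
  (forall k, \int[mu]_(x in K) (F k x)%:E <= (D * fine (mu K) - d)%:E)%E ->
  (forall x eta, K x -> 0 < eta -> \forall k \near \oo,
     D + k0 * (e `^ (- (2 * s)) * tailc n s) * H x - k0 * tail_average H e x - eta <= F k x) ->
  d <= 0.
Proof.
move=> mK Koo e0 k00 D0 mH HM HK mF F0 FD hpt.
set c := e `^ (- (2 * s)) * tailc n s in hpt *.
have c0 : 0 <= c by rewrite mulr_ge0 ?powR_ge0 ?tailc_ge0.
have H0 z : 0 <= H z by have /andP[] := HM z.
have [mT ET] := tail_average_integral e0 mH HM; rewrite -/c in ET.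
have T0 x := tail_average_ge0 e x H0.
pose L x := limn_einf (fun k => (F k x)%:E).
have mFE k : measurable_fun K (fun x => (F k x)%:E).
  by apply/measurable_EFinP; exact: measurable_funTS.
have mL : measurable_fun K L.
  rewrite /L /limn_einf; apply: (measurableT_comp (@oppe_measurable R setT)).
  apply: measurable_fun_limn_esup => k; apply: (measurableT_comp (@oppe_measurable R setT)).
  exact: mFE.
have L0 x : K x -> (0 <= L x)%E.
  move=> Kx; apply: le_limn_einf => eta eta0; near=> k.
  by rewrite lee_fin; have := F0 k x Kx; lra.
(* The average is moved to the right so that only nonnegative functions are integrated. *)
have Lge x : K x -> ((D + k0 * c * H x)%:E <= L x + k0%:E * (tail_average H e x)%:E)%E.
  move=> Kx; rewrite -leeBlDr; last by rewrite -EFinM.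
  rewrite -EFinM -EFinB; apply: le_limn_einf => eta eta0.
  by have := hpt x eta Kx eta0; apply: filterS => k; rewrite lee_fin.
have IL : (\int[mu]_(x in K) L x <= (D * fine (mu K) - d)%:E)%E.
  apply: (le_trans (fatou mu mK mFE (fun k x Kx => F0 k x Kx))).
  by apply: limn_einf_le.
have HKE : (\int[mu]_x (H x)%:E = \int[mu]_(x in K) (H x)%:E)%E.
  rewrite [RHS]integral_mkcond; apply: eq_integral => x _; rewrite patchE.
  by case: ifPn => // /negP xK; rewrite HK// => Kx; apply: xK; rewrite inE.
have mHK : measurable_fun K (EFin \o H).
  by apply/measurable_EFinP; exact: measurable_funTS.
have muK : mu K = (fine (mu K))%:E by rewrite fineK// ge0_fin_numE.
set IH := (\int[mu]_(x in K) (H x)%:E)%E in HKE.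
have IH0 : (0 <= IH)%E by apply: integral_ge0 => x _; rewrite lee_fin.
have IHoo : (IH < +oo)%E.
  apply: (@le_lt_trans _ _ (\int[mu]_(x in K) (cst M%:E) x)%E).
    by apply: ge0_le_integral => // [x _|x _]; rewrite lee_fin; have /andP[h1 h2] := HM x => //; exact: le_trans h2.
  by rewrite integral_cst// muK ltry.
have mTK : measurable_fun K (EFin \o tail_average H e) by exact: measurable_funTS.
have I1 : (\int[mu]_(x in K) (D%:E + (k0 * c)%:E * (H x)%:E) =
    (D * fine (mu K))%:E + (k0 * c)%:E * IH)%E.
  have kc : 0 <= k0 * c by rewrite mulr_ge0.
  have a1 x : K x -> (0 <= (cst D%:E) x)%E by move=> _; rewrite lee_fin.
  have a2 : measurable_fun K (cst D%:E) by exact: measurable_cst.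
  have a3 x : K x -> (0 <= (k0 * c)%:E * (H x)%:E)%E by move=> _; rewrite mule_ge0// lee_fin.
  have a4 : measurable_fun K (fun x => (k0 * c)%:E * (H x)%:E)%E by exact: measurable_funeM.
  have a5 x : K x -> (0 <= (H x)%:E)%E by move=> _; rewrite lee_fin.
  rewrite (ge0_integralD mu mK a1 a2 a3 a4) (integral_cst mu mK) muK -EFinM.
  by rewrite (ge0_integralZl_EFin mu mK a5 mHK kc).
have I2 : (\int[mu]_(x in K) (L x + k0%:E * (tail_average H e x)%:E) <=
    (D * fine (mu K) - d)%:E + (k0 * c)%:E * IH)%E.
  have a1 x : K x -> (0 <= k0%:E * (tail_average H e x)%:E)%E by move=> _; rewrite mule_ge0// lee_fin.
  have a2 : measurable_fun K (fun x => k0%:E * (tail_average H e x)%:E)%E by exact: measurable_funeM.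
  have a3 x : K x -> (0 <= (tail_average H e x)%:E)%E by move=> _; rewrite lee_fin.
  rewrite (ge0_integralD mu mK L0 mL a1 a2); apply: leeD => //.
  rewrite (ge0_integralZl_EFin mu mK a3 mTK k00) EFinM -muleA -HKE -ET.
  apply: lee_wpmul2l; first by rewrite lee_fin.
  apply: ge0_subset_integral => // x _; rewrite lee_fin; exact: T0.
have le12 : (\int[mu]_(x in K) (D%:E + (k0 * c)%:E * (H x)%:E) <=
    \int[mu]_(x in K) (L x + k0%:E * (tail_average H e x)%:E))%E.
  apply: ge0_le_integral => //.
  - by move=> x _; rewrite adde_ge0 ?lee_fin// mulr_ge0// mulr_ge0.
  - by apply: emeasurable_funD => //; exact: measurable_funeM.
  - by apply: emeasurable_funD => //; exact: measurable_funeM.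
have := le_trans le12 I2; rewrite I1.
have fI : ((k0 * c)%:E * IH)%E \is a fin_num by rewrite fin_numM// ge0_fin_numE.
by rewrite -(fineK fI) -!EFinD lee_fin; lra.
Unshelve. all: by end_near. Qed.

End fatou_energy.

Lemma linear_decrease (R : realType) (X Y C v b h w w' : R) : w + (v - b) * h <= w' ->
  X - (Y + C * h) - w' <= X - Y - w - (C + v - b) * h.
Proof. by rewrite !mulrDl mulNr; lra. Qed.

Lemma half_split (R : realType) (eta A1 A2 A3 : R) : A1 <= eta / 2 -> A2 <= eta / 2 ->
  - (A3 - A2) + A1 <= - (A3 - eta).
Proof. lra. Qed.

(** The square of the positive part is dominated by the square of the linear bound, whatever the
    sign of the latter. *)
Lemma sqr_pos_quotient (R : realType) (q q' gam h : R) : 0 < h -> q' <= q - gam * h ->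
  h^-1 * (Num.max q' 0 ^+ 2 - q ^+ 2) <= - (2 * q * gam) + gam ^+ 2 * h.
Proof.
move=> h0 qq'; have : Num.max q' 0 ^+ 2 <= (q - gam * h) ^+ 2.
  case: (leP q' 0) => hq; first by rewrite expr0n sqr_ge0.
  by rewrite ler_pXn2r ?nnegrE ?(ltW hq)//; lra.
by rewrite ler_pdivrMl// sqrrB; lra.
Qed.

Section excess.
Context (R : realType) (n : nat) (hn : (2 <= n)%N) (s p : R) (f : R -> R).
Context (Omega : set 'rV[R]_n) (u : 'rV[R]_n -> R -> R).
Context (s01 : 0 < s < 1) (cf : continuous f) (p0 : p < 0).
Context (sol : classical_solution hn s p f Omega u).
Context (pos : forall x, Omega x -> 0 <= coord1 hn x).
Local Notation mu := (lebesgue_rV R n).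
Local Notation kern := (@kern R n s).
Local Notation k0 := (frac_lap_const hn s).
Implicit Types (x y z c : 'rV[R]_n) (t : R).

Lemma measurable_sball c (r : R) : measurable (sball c r).
Proof.
have <- : (fun z => 1 *: z + - c) @^-1` (@cube R n r) = sball c r.
  apply/seteqP; split => z; rewrite /sball /cube /= scale1r => h.
    rewrite [`|_|]mx_normrE; apply: bigmax_le => [|[i j] _ /=].
      have := h (Ordinal (ltnW hn)); lra.
    by rewrite (ord1 i) ler_norml.
  by move=> i; rewrite -ler_norml; apply: le_trans h; exact: coord_le_norm.
by apply: measurable_preimage_affine_rV; exact: measurable_cube.
Qed.

Lemma lebesgue_sball c (r : R) : 0 <= r -> mu (sball c r) = ((r *+ 2) ^+ n)%:E.
Proof.
move=> r0; have mK := measurable_sball c r.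
have E0 : (fun z => 1 *: z + c) @^-1` (sball c r) = @cube R n r.
  apply/seteqP; split => z; rewrite /sball /cube /= scale1r addrK => h.
    by move=> i; rewrite -ler_norml; apply: le_trans h; exact: coord_le_norm.
  rewrite [`|_|]mx_normrE; apply: bigmax_le => [|[i j] _ /=]; first by [].
  by rewrite (ord1 i) ler_norml.
have E1 : (\int[mu]_(z in sball c r) (cst 1%E) z = mu (sball c r))%E.
  by rewrite integral_cst// mul1e.
rewrite -E1 (ge0_integral_rV_affine_in c (oner_neq0 R) mK (measurable_cst _))//.
rewrite E0 normr1 expr1n mul1e -lebesgue_rV_cube//.
by rewrite integral_cst ?mul1e//; exact: measurable_cube.
Qed.

Context (x0 : 'rV[R]_n) (r N C a : R) (r01 : 0 < r <= 1) (N0 : 0 <= N) (C0 : 0 <= C).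

Definition steep := 4 * (N + 1) / r ^+ 2.

Lemma steep_gt0 : 0 < steep.
Proof.
have /andP[r0 _] := r01.
by rewrite divr_gt0 ?exprn_gt0// mulr_gt0// ltr_wpDl.
Qed.

Definition excess t x := u x a - steep * enorm (x - x0) ^+ 2 - C * (t - a) - u x t.

(** The paraboloid makes the excess nonpositive near the edge of the cube from time [a] on, so the
    cut-off does not truncate positive values there. *)
Definition excess_pos t x := Num.max (excess t x) 0 * \1_(sball x0 r) x.

Lemma excess_posE t x : sball x0 r x -> excess_pos t x = Num.max (excess t x) 0.
Proof. by move=> Kx; rewrite /excess_pos indicE mem_set ?mulr1. Qed.

Lemma excess_pos_out t x : ~ sball x0 r x -> excess_pos t x = 0.
Proof. by move=> Kx; rewrite /excess_pos indicE memNset ?mulr0. Qed.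

Lemma measurable_excess t : measurable_fun setT (excess t).
Proof.
apply: measurable_funB; last exact: L2s_measurable (solution_L2s sol t).
apply: measurable_funB => //; apply: measurable_funB; first exact: L2s_measurable (solution_L2s sol a).
apply: measurable_funM => //; apply: measurable_funX.
have := @measurable_affine_rV R n 1 (- x0).
move=> /(measurableT_comp (@measurable_enorm R n)).
by congr measurable_fun; apply/funext => z; rewrite /= scale1r.
Qed.

Lemma measurable_excess_pos t : measurable_fun setT (excess_pos t).
Proof.
apply: measurable_funM; last exact: (@measurable_indic _ _ R setT _ (measurable_sball x0 r)).
by apply: measurable_maxr => //; exact: measurable_excess.
Qed.

Context (k : R) (Kk : forall x, sball x0 r x -> `|x| <= k) (reg : regular u k N a).

Lemma excess_le t x : a <= t -> sball x0 r x -> excess t x + u x t <= N.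
Proof.
move=> at_ Kx; have [h _ _] := reg (Kk Kx).
have : 0 <= C * (t - a) by rewrite mulr_ge0//; lra.
have : 0 <= steep * enorm (x - x0) ^+ 2 by rewrite mulr_ge0 ?sqr_ge0// ltW ?steep_gt0.
by have := ler_norm (u x a); rewrite /excess; lra.
Qed.

Lemma excess_pos_bound t x : a <= t -> 0 <= excess_pos t x <= N.
Proof.
move=> at_; have [Kx|Kx] := pselect (sball x0 r x); last by rewrite excess_pos_out// lexx.
rewrite excess_posE// le_max lexx orbT ge_max N0 andbT.
by have := excess_le at_ Kx; have := solution_ge0 sol x t; lra.
Qed.

Lemma excess_near t x : a <= t -> sball x0 r x -> 0 < excess t x -> enorm (x - x0) <= r / 2.
Proof.
move=> at_ Kx e0; have /andP[r0 r1] := r01; have N0' := N0.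
rewrite -(@ler_pXn2r _ 2)// ?nnegrE ?enorm_ge0//; last lra.
have [h _ _] := reg (Kk Kx).
have ta0 : 0 <= C * (t - a) by rewrite mulr_ge0//; lra.
have pe : steep * enorm (x - x0) ^+ 2 < N + 1.
  by move: e0; have := solution_ge0 sol x t; have := ler_norm (u x a); rewrite /excess; lra.
have : enorm (x - x0) ^+ 2 < (N + 1) / steep by rewrite ltr_pdivlMr ?steep_gt0// mulrC.
have -> : (N + 1) / steep = (r / 2) ^+ 2.
  by rewrite /steep; field; apply/andP; split; rewrite gt_eqF//; lra.
by move/ltW.
Qed.

Context (G : R) (hG : forall v : R, - N <= v <= N -> `|f v| <= G).

(** The first summand bounds the operator on the barrier, [G] bounds [f], and 1 pays for the part of
    the principal value inside the excised ball. *)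
Definition excess_rate :=
  k0 * ((N + 2 * steep) / 2 * ((r / 2) `^ (2 - 2 * s) * momentc n s) +
        N * ((r / 2) `^ (- (2 * s)) * tailc n s)) + G + 1.

(** The equation tested with the positive part [Q] of the excess. As the excess decreases at rate
    [C + u_t], this bounds the decrease of [Q^2] below by a truncated Laplacian of [Q^2], which
    integrates to 0. *)
Lemma excess_slope t x (Nt e : R) : a <= t -> Omega x -> sball x0 r x -> 0 < excess t x ->
  C = excess_rate -> 0 < e <= 1 -> 0 <= Nt ->
  (forall z, enorm z <= 1 -> `|sdiff (u ^~ t) x z| <= Nt * enorm z ^+ 2) ->
  k0 * (Nt / 2 * (e `^ (2 - 2 * s) * momentc n s)) <= 1 ->
  k0 * (e `^ (- (2 * s)) * tailc n s) * excess_pos t x ^+ 2 -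
  k0 * tail_average s (fun y => excess_pos t y ^+ 2) e x <=
  2 * excess_pos t x * (C + derive1 (u x) t).
Proof.
move=> at_ Ox Kx q0 CE /andP[e0 e1] Nt0 hNt esm; have /andP[r0 r1] := r01; have N0' := N0.
have k00 := frac_lap_const_gt0 hn s01.
have st0 := steep_gt0.
have Qx : excess_pos t x = excess t x by rewrite excess_posE// max_l// ltW.
have uN := excess_le at_ Kx.
have u0 := solution_ge0 sol x t.
have Q0 y : 0 <= excess_pos t y by have /andP[] := excess_pos_bound y at_.
have phiu y : sball x0 r y -> u y a - steep * enorm (y - x0) ^+ 2 - C * (t - a) - excess_pos t y <= u y t.
  move=> Ky; rewrite excess_posE//.
  have : excess t y <= Num.max (excess t y) 0 by rewrite le_max lexx.
  by rewrite {1}/excess; lra.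
have xr := excess_near at_ Kx q0.
have xzK z : enorm z <= r / 2 -> sball x0 r (x + z).
  move=> zr; rewrite /sball /=; have -> : x + z - x0 = (x - x0) + z by rewrite addrAC.
  apply: (le_trans (ler_normD _ _)).
  by have := norm_le_enorm (x - x0); have := norm_le_enorm z; lra.
have [h1 h2 _] := reg (Kk Kx).
have B0 : 0 <= (N + 2 * steep) / 2 by lra.
have r20 : 0 < r / 2 by lra.
have := trunc_lap_energy s01 (solution_L2s sol t) e0 r20 B0 N0
  (measurable_excess_pos t) (fun z => excess_pos_bound z at_) (x := x).
have hi z : enorm z <= r / 2 ->
    - sdiff (u ^~ t) x z <= 2 * ((N + 2 * steep) / 2) * enorm z ^+ 2 +
      (excess_pos t (x + z) + excess_pos t (x - z) - 2 * excess_pos t x).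
  move=> zr; have z1 : enorm z <= 1 by lra.
  have m1 := phiu _ (xzK z zr).
  have nzr : enorm (- z) <= r / 2 by rewrite enormN.
  have m2 := phiu _ (xzK (- z) nzr).
  have := h2 z z1; rewrite ler_norml => /andP[h2' _].
  have E1 := sdiff_paraboloid x0 steep x z.
  move: E1 m1 m2 h2'; rewrite {1}/sdiff /= Qx /excess [sdiff (u ^~ t) _ _]/sdiff [sdiff (u ^~ a) _ _]/sdiff.
  have -> : 2 * ((N + 2 * steep) / 2) * enorm z ^+ 2 = N * enorm z ^+ 2 + 2 * steep * enorm z ^+ 2 by field.
  by move=> E1 m1 m2 h2'; lra.
have far z : r / 2 < enorm z ->
    - sdiff (u ^~ t) x z <= 2 * N +
      (excess_pos t (x + z) + excess_pos t (x - z) - 2 * excess_pos t x).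
  move=> _; have := Q0 (x + z); have := Q0 (x - z); rewrite Qx /sdiff.
  by have := solution_ge0 sol (x + z) t; have := solution_ge0 sol (x - z) t; lra.
move=> /(_ hi far) main.
have := solution_eq sol t Ox; rewrite frac_lapE//; last exact: (solution_L2s sol).
have Nt20 : 0 <= Nt / 2 by rewrite divr_ge0.
have hNe z : enorm z <= e -> `|sdiff (u ^~ t) x z| <= Nt * enorm z ^+ 2.
  by move=> ze; apply: hNt; exact: le_trans ze e1.
have hBe z : enorm z <= e -> - (2 * (Nt / 2)) * enorm z ^+ 2 <= sdiff (u ^~ t) x z.
  move=> ze; have := hNe z ze; rewrite ler_norml => /andP[h _].
  by rewrite (_ : 2 * (Nt / 2) = Nt) ?mulNr//; field.
have := pv_lap_le_trunc s01 (solution_L2s sol t) e0 Nt0 Nt20 hNe hBe.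
move=> /(ler_wpM2l (ltW k00)); rewrite mulrDr => hpv heq.
have uN' : - N <= u x t <= N.
  by apply/andP; split; [apply: le_trans u0; rewrite oppr_le0|apply: le_trans uN; rewrite lerDr ltW].
have := hG uN'; rewrite ler_norml => /andP[hf _].
have hx : 0 <= coord1 hn x * u x t `^ p by rewrite mulr_ge0 ?powR_ge0 ?pos.
(* The term [x_1 u^p] is dropped, being nonnegative; 1 covers the second differences inside radius
   [e]. *)
have slope : - (k0 * trunc_lap s (u ^~ t) x e) - 1 - G <= derive1 (u x) t.
  by clear main uN u0 uN' xr h1 B0 r20 Nt20 r0 r1 e0 e1 q0 at_ hNe hBe hi far; lra.
have slope' : 2 * excess_pos t x * (C - (k0 * trunc_lap s (u ^~ t) x e) - 1 - G) <=
    2 * excess_pos t x * (C + derive1 (u x) t).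
  by apply: ler_wpM2l; [rewrite mulr_ge0|clear main uN u0 uN' xr h1 B0 r20 Nt20 r0 r1 e0 e1 q0 at_ heq hf hx hpv esm; lra].
apply: le_trans slope'; rewrite CE /excess_rate.
have := ler_wpM2l (ltW k00) main.
rewrite /tail_average.
set I1 := \int[mu]_(z in _) _; set I2 := \int[mu]_(z in _) _.
set P := (_ / 2 * _ + _); set c' := e `^ _ * _; set T := trunc_lap _ _ _ _; set Qv := excess_pos t x.
move=> main'.
have -> : 2 * Qv * (k0 * P + G + 1 - k0 * T - 1 - G) = k0 * (2 * Qv * P) - k0 * (2 * Qv * T).
  by ring.
have -> : k0 * c' * Qv ^+ 2 - k0 * (2^-1 * I1 + 2^-1 * I2) =
  k0 * (2 * Qv * P) - k0 * (2 * Qv * P + 2^-1 * I1 + 2^-1 * I2 - Qv ^+ 2 * c') by ring.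
by rewrite lerD2l lerN2.
Qed.

Lemma integrable_sball (g : 'rV[R]_n -> R) (M : R) : measurable_fun setT g ->
  (forall x, sball x0 r x -> `|g x| <= M) -> mu.-integrable (sball x0 r) (EFin \o g).
Proof.
move=> mg gM; have mK := measurable_sball x0 r; have /andP[r0 _] := r01.
apply: (@le_integrable _ _ _ mu _ mK _ (cst M%:E)).
- by apply/measurable_EFinP; exact: measurable_funTS.
- move=> x Kx; rewrite lee_fin; apply: le_trans (gM x Kx) _; exact: ler_norm.
- apply/integrableP; split; first exact: measurable_cst.
  rewrite (eq_integral (cst (`|M|%:E)%E))//.
  by rewrite integral_cst// lebesgue_sball ?(ltW r0)// -EFinM ltry.
Qed.

Definition excess_energy t := \int[mu]_(x in sball x0 r) (excess_pos t x ^+ 2).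

Lemma integrable_excess t : a <= t ->
  mu.-integrable (sball x0 r) (EFin \o (fun x => excess_pos t x ^+ 2)).
Proof.
move=> at_; apply: (@integrable_sball _ (N ^+ 2)).
  by apply: measurable_funX; exact: measurable_excess_pos.
move=> x _; have /andP[h1 h2] := excess_pos_bound x at_.
by rewrite ger0_norm ?sqr_ge0// ler_pXn2r ?nnegrE.
Qed.

(** [u] is differentiable in time only pointwise in [x], so the energy is not differentiated under
    the integral. Persistence from time [t] bounds the difference quotients on one side, which
    suffices for Fatou's lemma; [Ct] and [Nt] may depend on [t]. *)
Lemma excess_dini t t1 (Ct Nt d : R) : C = excess_rate -> sball x0 r `<=` Omega ->
  a < t < t1 -> 0 <= Ct -> 0 <= Nt -> regular u k Nt t -> 0 < d ->
  (forall x t', sball x0 r x -> t <= t' < t1 -> u x t - Ct * (t' - t) <= u x t') ->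
  exists2 e : R, 0 < e & forall t', t < t' < t + e ->
    excess_energy t' <= excess_energy t + d * (t' - t).
Proof.
move=> CE KO /andP[at_ tt1] Ct0 Nt0 regt d0 hCt; have /andP[r0 r1] := r01.
apply: contrapT => no.
have step (j : nat) : exists h : R, [/\ 0 < h, h < j.+1%:R^-1, t + h < t1 &
    excess_energy t + d * h < excess_energy (t + h)].
  apply: contrapT => noh; apply: no.
  exists (Num.min (j.+1%:R^-1) (t1 - t)).
    by rewrite lt_min invr_gt0 ltr0n /= subr_gt0.
  move=> t' /andP[h1 h2]; rewrite leNgt; apply/negP => h3; apply: noh.
  have [m1 m2] : Num.min (j.+1%:R^-1) (t1 - t) <= j.+1%:R^-1 /\ Num.min (j.+1%:R^-1) (t1 - t) <= t1 - t.
    by rewrite !ge_min !lexx orbT.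
  have h2' : t' - t < Num.min (j.+1%:R^-1) (t1 - t) by rewrite ltrBlDl.
  exists (t' - t); rewrite subrKC; split => //.
  - by rewrite subr_gt0.
  - exact: lt_le_trans h2' m1.
  - by rewrite -(ltrD2r (- t)); exact: lt_le_trans h2' m2.
have [h hh] := choice step.
have h0 j : 0 < h j by have [] := hh j.
have h1 j : h j < j.+1%:R^-1 by have [] := hh j.
have h_le1 j : h j <= 1.
  by apply: le_trans (ltW (h1 j)) _; rewrite invf_le1 ?ler1n ?ltr0n.
have hsmall (c e : R) : 0 <= c -> 0 < e -> \forall j \near \oo, c * h j <= e.
  move=> c0 e0; near=> j.
  apply: (@le_trans _ _ (c * j.+1%:R^-1)); first by rewrite ler_wpM2l// ltW.
  rewrite ler_pdivrMr ?ltr0n//.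
  have : c / e <= j.+1%:R.
    apply: (@le_trans _ _ (j%:R)); last by rewrite ler_nat.
    by near: j; exact: nbhs_infty_ger.
  by rewrite ler_pdivrMr// mulrC.
have k00 := frac_lap_const_gt0 hn s01.
(* The excision radius depends on the regularity at time [t]; the final estimate does not contain
   it. *)
have [e [e0 e1 esm]] : exists e : R, [/\ 0 < e, e <= 1 & k0 * (Nt / 2 * (e `^ (2 - 2 * s) * momentc n s)) <= 1].
  near (0 : R)^'+ => e; exists e; split.
  - by near: e; exact: nbhs_right_gt.
  - by near: e; apply: nbhs_right_le; exact: ltr01.
  - have : Nt / 2 * (e `^ (2 - 2 * s) * momentc n s) < k0^-1.
      by near: e; apply: moment_small => //; rewrite invr_gt0.
    by move=> /ltW; rewrite -(ler_pM2l k00) divff// gt_eqF.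
(* Upper bound of [((Q + Ct h)^2 - Q^2) / h] for [0 <= Q <= N] and [h <= 1]. *)
pose D := 2 * N * Ct + Ct ^+ 2.
have D0 : 0 <= D by rewrite addr_ge0 ?sqr_ge0// mulr_ge0// mulr_ge0.
have mK := measurable_sball x0 r.
have mKE := @lebesgue_sball x0 r (ltW r0).
have Koo : (mu (sball x0 r) < +oo)%E by rewrite mKE ltry.
pose H x := excess_pos t x ^+ 2.
pose F j x := D - (h j)^-1 * (excess_pos (t + h j) x ^+ 2 - excess_pos t x ^+ 2).
have qh j x : sball x0 r x -> excess (t + h j) x <= excess t x + Ct * h j.
  move=> Kx; have [_ _ hj _] := hh j.
  have ht : t <= t + h j < t1 by rewrite hj lerDl ltW.
  have := hCt x _ Kx ht; have : 0 <= C * h j by rewrite mulr_ge0// ltW.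
  rewrite /excess (addrC t (h j)) addrK -addrA mulrDr; lra.
suff : d <= 0 by rewrite leNgt d0.
apply: (@fatou_energy R n s s01 (sball x0 r) H F (N ^+ 2) D d k0 e) => //.
- exact: ltW.
- by apply: measurable_funX; exact: measurable_excess_pos.
- move=> z; have /andP[q0 qN] := excess_pos_bound z (ltW at_).
  by rewrite sqr_ge0 ler_pXn2r ?nnegrE.
- by move=> z Kz; rewrite /H excess_pos_out// expr0n.
- move=> j; apply: measurable_funB => //; apply: measurable_funM => //.
  by apply: measurable_funB; apply: measurable_funX; exact: measurable_excess_pos.
- move=> j x Kx; rewrite subr_ge0 ler_pdivrMl//.
  have /andP[q0 qN] := excess_pos_bound x (ltW at_).
  have hq : excess_pos (t + h j) x <= excess_pos t x + Ct * h j.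
    rewrite !excess_posE// ge_max; apply/andP; split.
      by apply: le_trans (qh j x Kx) _; rewrite lerD2r le_max lexx.
    by rewrite addr_ge0// ?le_max ?lexx ?orbT// mulr_ge0// ltW.
  have ath : a <= t + h j by have := h0 j; lra.
  have /andP[q0' _] := excess_pos_bound x ath.
  have Ch : 0 <= Ct * h j by rewrite mulr_ge0// ltW.
  have : excess_pos (t + h j) x ^+ 2 <= (excess_pos t x + Ct * h j) ^+ 2.
    by rewrite ler_pXn2r ?nnegrE// addr_ge0.
  have m1 : excess_pos t x * (Ct * h j) <= N * (Ct * h j) by rewrite ler_wpM2r.
  have m2 : (Ct * h j) ^+ 2 <= Ct ^+ 2 * h j.
    by rewrite exprMn ler_wpM2l ?sqr_ge0// expr2 ler_piMr// ltW.
  rewrite sqrrD /D; lra.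
- move=> j; have [_ _ _ hJ] := hh j.
  have ath : a <= t + h j by have := h0 j; lra.
  have i1 := integrable_excess ath; have i2 := integrable_excess (ltW at_).
  have i3 := integrableB mK i1 i2.
  have i3' : mu.-integrable (sball x0 r) (EFin \o (fun x => excess_pos (t + h j) x ^+ 2 - excess_pos t x ^+ 2)).
    by apply: eq_integrable i3 => // x _ /=; rewrite EFinB.
  have i4 := integrableZl_EFin (h j)^-1 mK i3'.
  have i5 : mu.-integrable (sball x0 r) (EFin \o (fun=> D)).
    by apply: (@integrable_sball _ D) => // x _; rewrite ger0_norm.
  have i6 := integrableB mK i5 i4.
  have i6' : mu.-integrable (sball x0 r) (EFin \o F j).
    by apply: eq_integrable i6 => // x _ /=; rewrite EFinB.
  have fin := integrable_fin_num mK i6'.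
  rewrite -(fineK fin) lee_fin.
  rewrite -[leLHS]/(\int[mu]_(x in sball x0 r) F j x) /F RintegralB// RintegralZl// RintegralB//.
  rewrite -/(excess_energy (t + h j)) -/(excess_energy t).
  have -> : \int[mu]_(x in sball x0 r) D = D * fine (mu (sball x0 r)) by rewrite Rintegral_cst.
  rewrite lerD2l lerN2 ler_pdivlMl//; lra.
- move=> x eta Kx eta0; rewrite /F.
  have T0 : 0 <= tail_average s H e x by apply: tail_average_ge0 => z; rewrite sqr_ge0.
  (* Where the excess is nonpositive, its positive part starts at 0 and is at most [Ct h], so the
     quotient of squares is [O(h)]. *)
  have [q0|q0] := ltP 0 (excess t x); last first.
    have Q0 : excess_pos t x = 0 by rewrite excess_posE// max_r.
    near=> j; have Ch : Ct ^+ 2 * h j <= eta by near: j; apply: hsmall => //; exact: sqr_ge0.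
    rewrite /H Q0 expr0n /= mulr0 addr0 subr0.
    have : (h j)^-1 * excess_pos (t + h j) x ^+ 2 <= Ct ^+ 2 * h j.
      rewrite ler_pdivrMl//.
      apply: (@le_trans _ _ ((Ct * h j) ^+ 2)); last by rewrite exprMn expr2 expr2; lra.
      have ath : a <= t + h j by have := h0 j; lra.
      have /andP[q0' _] := excess_pos_bound x ath.
      have Ch0 : 0 <= Ct * h j by rewrite mulr_ge0// ltW.
      rewrite ler_pXn2r ?nnegrE// excess_posE// ge_max Ch0 andbT.
      by have := qh j x Kx; lra.
    have : 0 <= k0 * tail_average s H e x by rewrite mulr_ge0// ltW.
    lra.
  have Ox := KO x Kx.
  have [_ hNt _] := regt x (Kk Kx).
  have e01 : 0 < e <= 1 by rewrite e0 e1.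
  have slope := excess_slope (ltW at_) Ox Kx q0 CE e01 Nt0 hNt esm.
  have QE : excess_pos t x = excess t x by rewrite excess_posE// max_l// ltW.
  set q := excess t x in q0 QE *.
  set v := derive1 (u x) t in slope *.
  rewrite -/H in slope; rewrite /H QE; rewrite QE in slope.
  (* The loss in the time derivative enters multiplied by [2 q], and must cost at most [eta / 2]. *)
  pose b := eta / (4 * (q + 1)).
  have b0 : 0 < b by rewrite divr_gt0// mulr_gt0//; lra.
  have vb : v - b < derive1 (u x) t by rewrite -/v; lra.
  have du : derivable (u x) t 1 by exact: (solution_derivable sol).
  have [e2 e20 he2] := right_increase du vb.
  pose gam := C + v - b.
  have Hb : 2 * q * b <= eta / 2.
    have -> : eta / 2 = 2 * (q + 1) * b by rewrite /b; field; rewrite gt_eqF//; lra.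
    by rewrite ler_wpM2r ?(ltW b0)//; lra.
  have e220 : 0 < e2 / 2 by rewrite divr_gt0.
  near=> j.
  have gh : gam ^+ 2 * h j <= eta / 2.
    by near: j; apply: hsmall; [exact: sqr_ge0|lra].
  have hj2 : h j < e2.
    have hj : 1 * h j <= e2 / 2 by near: j; exact: (hsmall _ _ ler01 e220).
    rewrite mul1r in hj; apply: le_lt_trans hj _.
    by rewrite ltr_pdivrMr// ltr_pMr// ltr1n.
  have hje : 0 < h j < e2 by rewrite h0 hj2.
  have uh := he2 _ hje.
  have qj : excess (t + h j) x <= q - gam * h j.
    have E : C * (t + h j - a) = C * (t - a) + C * h j by rewrite -mulrDr addrAC.
    by rewrite /q /excess E /gam; exact: linear_decrease.
  have Hf := sqr_pos_quotient (h0 j) qj; rewrite -excess_posE// in Hf.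
  have Eg : 2 * q * gam = 2 * q * (C + v) - 2 * q * b by rewrite /gam; ring.
  apply: (@le_trans _ _ (D + 2 * q * (C + v) - eta)).
    by rewrite lerD2r -addrA lerD2l.
  rewrite -addrA lerD2l lerNr; apply: le_trans Hf _; rewrite Eg.
  exact: half_split.
Unshelve. all: by end_near. Qed.

End excess.

(** * Persistence from a time that may be a dip *)

Section no_dips_open.
Context (R : realType) (n : nat) (hn : (2 <= n)%N) (s p : R) (f : R -> R).
Context (Omega : set 'rV[R]_n) (u : 'rV[R]_n -> R -> R).
Context (s01 : 0 < s < 1) (cf : continuous f) (p0 : p < 0).
Context (sol : classical_solution hn s p f Omega u).
Context (pos : forall x, Omega x -> 0 <= coord1 hn x).
Local Notation mu := (lebesgue_rV R n).
Local Notation k0 := (frac_lap_const hn s).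
Implicit Types (x y z c : 'rV[R]_n) (t : R).

(** Pointwise continuity of [u] in time and dominated convergence. It includes the initial time,
    whether or not there is a dip. *)
Lemma excess_energy_continuous x0 (r N C a k t1 : R) : 0 < r <= 1 -> 0 <= N -> 0 <= C ->
  (forall x, sball x0 r x -> `|x| <= k) -> regular u k N a ->
  {in `[a, t1]%classic, continuous (excess_energy u x0 r N C a)}.
Proof.
move=> r01 N0 C0 Kk reg t tI.
pose F (t : R) x := excess_pos u x0 r N C a t x ^+ 2.
have mK := measurable_sball hn x0 r.
have mF t' : measurable_fun setT (F t').
  by apply: measurable_funX; exact: (measurable_excess_pos sol).
(* The domain is widened to make [a] interior; before [a] the term [- C (t - a)] adds at most
   [C]. *)
have Fb t' x : a - 1 < t' -> sball x0 r x -> `|F t' x| <= (N + C) ^+ 2.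
  move=> ht Kx; rewrite /F ger0_norm ?sqr_ge0// excess_posE//.
  have [h _ _] := reg x (Kk x Kx).
  have hC : C * (a - t') <= C by rewrite -[leRHS]mulr1 ler_wpM2l//; lra.
  have : 0 <= steep r N * enorm (x - x0) ^+ 2.
    by rewrite mulr_ge0 ?sqr_ge0// ltW// steep_gt0.
  have := solution_ge0 sol x t'; have := ler_norm (u x a) => h1 h2 h3.
  have q : excess u x0 r N C a t' x <= N + C.
    by rewrite /excess (_ : t' - a = - (a - t')) ?mulrN; lra.
  rewrite ler_pXn2r ?nnegrE ?le_max ?lexx ?orbT ?addr_ge0//.
  by rewrite ge_max q addr_ge0.
have ig : mu.-integrable (sball x0 r) (EFin \o (fun=> (N + C) ^+ 2)).
  by apply: (integrable_sball hn r01 (M := (N + C) ^+ 2)) => // x _; rewrite ger0_norm ?sqr_ge0.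
have iF t' : `]a - 1, t1 + 1[%classic t' -> mu.-integrable (sball x0 r) (EFin \o F t').
  rewrite /= in_itv /= => /andP[ht _].
  by apply: (integrable_sball hn r01 (M := (N + C) ^+ 2)) => // x; exact: Fb.
have cF : \forall y \ae mu, sball x0 r y -> {in `]a - 1, t1 + 1[%classic, continuous (F ^~ y)}.
  apply: aeW => y Ky t' _.
  have -> : F ^~ y = (fun t => Num.max (excess u x0 r N C a t y) 0 * Num.max (excess u x0 r N C a t y) 0).
    by apply/funext => t''; rewrite /F excess_posE// expr2.
  have cq : continuous (fun t => excess u x0 r N C a t y).
    move=> t''; apply: cvgB; last exact: (solution_cts sol).
    apply: cvgB; first exact: cvg_cst.
    by apply: cvgMr; apply: cvgB; [exact: cvg_id|exact: cvg_cst].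
  have cm : {for t', continuous (fun t => Num.max (excess u x0 r N C a t y) 0)}.
    exact: (continuous_max (@cq t') (cvg_cst _)).
  exact: (cvgM cm cm).
have gb t' : `]a - 1, t1 + 1[%classic t' -> \forall y \ae mu, sball x0 r y -> `|F t' y| <= (N + C) ^+ 2.
  by rewrite /= in_itv /= => /andP[ht _]; apply: aeW => y; exact: Fb.
have := continuity_under_integral mK iF cF ig gb; apply.
move: tI; rewrite !inE /= !in_itv /=; lra.
Qed.

Lemma excess_energy_gt0 x0 (r N C a k t1 : R) : 0 < r <= 1 -> 0 <= N -> 0 <= C ->
  (forall x, sball x0 r x -> `|x| <= k) -> regular u k N a -> a <= t1 ->
  0 < excess u x0 r N C a t1 x0 -> 0 < excess_energy u x0 r N C a t1.
Proof.
move=> r01 N0 C0 Kk reg at1 q0; have /andP[r0 _] := r01.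
set q := excess u x0 r N C a t1 x0 in q0.
have cq : continuous (excess u x0 r N C a t1).
  move=> x; apply: (cvgB _ (@solution_cts_x _ _ _ _ _ _ _ _ sol t1 x)).
  apply: (cvgB _ (cvg_cst _)); apply: (cvgB (@solution_cts_x _ _ _ _ _ _ _ _ sol a x)).
  by apply: cvgMr; exact: cts_sqr_enorm.
have q20 : q / 2 < q by rewrite ltr_pdivrMr// ltr_pMr// ltr1n.
have /nbhs_ballP[e /= e0 he] : \forall x \near x0, q / 2 < excess u x0 r N C a t1 x.
  exact: (cvgr_gt _ (cq x0) _ q20).
pose r' := Num.min r (e / 2).
have r'0 : 0 < r' by rewrite lt_min r0 divr_gt0.
have [r'r r'e] : r' <= r /\ r' <= e / 2 by rewrite !ge_min !lexx orbT.
have sub : sball x0 r' `<=` sball x0 r by move=> x; rewrite /sball /= => h; exact: le_trans h r'r.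
have mK := measurable_sball hn x0 r; have mK' := measurable_sball hn x0 r'.
pose H x := excess_pos u x0 r N C a t1 x ^+ 2.
have mH : measurable_fun setT H by apply: measurable_funX; exact: (measurable_excess_pos sol).
have iH := integrable_excess sol r01 N0 C0 Kk reg at1.
have fin := integrable_fin_num mK iH.
rewrite -lte_fin /excess_energy /Rintegral fineK//.
apply: (@lt_le_trans _ _ (\int[mu]_(x in sball x0 r') (cst ((q / 2) ^+ 2)%:E) x)%E).
  rewrite integral_cst// lebesgue_sball ?(ltW r'0)// -EFinM lte_fin.
  by rewrite mulr_gt0 ?exprn_gt0 ?divr_gt0 ?mulrn_wgt0.
apply: (@le_trans _ _ (\int[mu]_(x in sball x0 r') (EFin \o H) x)%E).
  apply: ge0_le_integral => //.
  - by move=> x _; rewrite lee_fin sqr_ge0.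
  - by apply/measurable_EFinP; exact: measurable_funTS.
  - move=> x Kx; rewrite lee_fin /H excess_posE; last exact: sub.
    have : q / 2 < excess u x0 r N C a t1 x.
      apply: he; rewrite -ball_normE /ball_ /= -normrN opprB; apply: le_lt_trans Kx _.
      by apply: le_lt_trans r'e _; rewrite ltr_pdivrMr// ltr_pMr// ltr1n.
    move=> h; rewrite ler_pXn2r ?nnegrE ?le_max ?lexx ?orbT ?(ltW h)//.
    by rewrite divr_ge0// ltW.
apply: ge0_subset_integral => //.
- by apply/measurable_EFinP; exact: measurable_funTS.
- by move=> x _; rewrite lee_fin sqr_ge0.
Qed.

(** Comparison of maxima cannot start at [a], and starting just after [a] would use regularity
    constants that may blow up. The energy of the excess avoids both: it vanishes at [a], is
    continuous there, and does not increase afterwards. The radius is doubled because at later times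
    persistence is applied in a cube around each point of the inner cube. *)
Lemma no_dip_persistence_open (r N : R) : 0 < r <= 1 -> 0 <= N ->
  exists2 C : R, 0 <= C & forall c x0 (th rho k a b : R), th < rho ->
    sball x0 (2 * r) `<=` sball c th -> sball x0 (2 * r) `<=` Omega ->
    (forall x, sball x0 (2 * r) x -> `|x| <= k) ->
    (forall t, a < t < b -> no_dip u c rho t) -> regular u k N a ->
    forall t, a <= t < b -> u x0 a - C * (t - a) <= u x0 t.
Proof.
move=> r01 N0; have /andP[r0 _] := r01.
have [G G0 hG] := f_bounded cf N.
have k00 := frac_lap_const_gt0 hn s01.
pose C := excess_rate hn s r N G.
have C0 : 0 <= C.
  have st := @steep_gt0 R r N r01 N0.
  rewrite !addr_ge0// mulr_ge0 ?(ltW k00)// addr_ge0// mulr_ge0//.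
  - by rewrite divr_ge0// addr_ge0// mulr_ge0// ltW.
  - by rewrite mulr_ge0 ?powR_ge0 ?momentc_ge0.
  - by rewrite mulr_ge0 ?powR_ge0 ?tailc_ge0.
exists C => // c x0 th rho k a b thr Kth KO Kk nd reg t1 /andP[at1 t1b].
have rr : r <= 2 * r by lra.
have sub x : sball x0 r x -> sball x r `<=` sball x0 (2 * r).
  move=> h y hy; rewrite /sball /= in h hy *.
  have -> : y - x0 = (y - x) + (x - x0) by rewrite addrA subrK.
  by apply: le_trans (ler_normD _ _) _; lra.
have sub0 : sball x0 r `<=` sball x0 (2 * r) by move=> x; rewrite /sball /= => h; exact: le_trans h rr.
have KO' : sball x0 r `<=` Omega by move=> x /sub0/KO.
have Kk' x : sball x0 r x -> `|x| <= k by move=> /sub0/Kk.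
have Kx0 : sball x0 r x0 by rewrite /sball /= subrr normr0 ltW.
have kge : 0 <= k by apply: le_trans (Kk' _ Kx0); exact: normr_ge0.
rewrite leNgt; apply/negP => bad.
have q0 : 0 < excess u x0 r N C a t1 x0.
  by rewrite /excess subrr enorm0 expr0n /= mulr0 subr0; lra.
have := excess_energy_gt0 r01 N0 C0 Kk' reg at1 q0.
apply/negP; rewrite -leNgt.
have <- : excess_energy u x0 r N C a a = 0.
  have E x : x \in sball x0 r -> excess_pos u x0 r N C a a x ^+ 2 = 0.
    rewrite inE => Kx; rewrite excess_posE// max_r ?expr0n// /excess subrr mulr0 subr0.
    have : 0 <= steep r N * enorm (x - x0) ^+ 2.
      by rewrite mulr_ge0 ?sqr_ge0// ltW// steep_gt0.
    lra.
  by rewrite /excess_energy (eq_Rintegral mu E) Rintegral_cst ?mul0r//; exact: measurable_sball.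
apply: (dini_nonpos at1 (excess_energy_continuous r01 N0 C0 Kk' reg)).
move=> t d /andP[at_ tt1] d0.
have [Nt regt] := regular_exists sol t kge.
have Nt0 : 0 <= Nt%:R :> R by [].
have [Ct Ct0 hCt] := no_dip_persistence s01 cf sol pos r01 Nt0.
apply: (excess_dini s01 sol pos r01 N0 C0 Kk' reg hG _ KO' (t1 := b) _ Ct0 Nt0 regt d0) => //.
  by rewrite at_ (lt_trans tt1).
move=> x t' Kx ht'; apply: (hCt c x th rho k t b thr) => //.
- by move=> y /(sub x Kx)/Kth.
- by move=> y /(sub x Kx)/KO.
- by move=> y /(sub x Kx)/Kk.
- by move=> t'' /andP[h1 h2]; apply: nd; rewrite h2 (lt_le_trans at_).
Qed.

End no_dips_open.

(** * Exclusion of dips by Baire's theorem *)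

Section no_dip_everywhere.
Context (R : realType) (n : nat) (hn : (2 <= n)%N) (s p : R) (f : R -> R).
Context (Omega : set 'rV[R]_n) (u : 'rV[R]_n -> R -> R).
Context (s01 : 0 < s < 1) (cf : continuous f) (p0 : p < 0).
Context (sol : classical_solution hn s p f Omega u).
Context (pos : forall x, Omega x -> 0 <= coord1 hn x).
Implicit Types (x y z c : 'rV[R]_n) (t : R).

(** At [N]-regular times [u] has a common Lipschitz constant in [x], so pointwise continuity in time
    becomes uniform on the cube. *)
Lemma regular_equicontinuous c (th k N tau d : R) : (forall x, sball c th x -> `|x| <= k) ->
  0 <= N -> regular u k N tau -> 0 < d ->
  exists2 e : R, 0 < e & forall a x, `|a - tau| < e -> regular u k N a -> sball c th x ->
    `|u x a - u x tau| <= d.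
Proof.
move=> Kk N0 regtau d0.
have cK := @compact_sball R n hn c th.
have /compact_near_coveringP/(_ _ (nbhs tau)
  (fun a x => regular u k N a -> sball c th x -> `|u x a - u x tau| <= d) _) := cK.
move=> H; have {H} : \forall a \near tau, sball c th `<=`
    (fun x => regular u k N a -> sball c th x -> `|u x a - u x tau| <= d).
  apply: H => x Kx.
  pose eta := d / (4 * (N + 1)).
  have eta0 : 0 < eta by rewrite divr_gt0// mulr_gt0// ltr_wpDl.
  have Neta : N * eta <= d / 4.
    have -> : d / 4 = (N + 1) * eta by rewrite /eta; field; rewrite gt_eqF// ltr_wpDl.
    by rewrite ler_wpM2r ?(ltW eta0)// lerDl.
  have d4 : 0 < d / 4 by rewrite divr_gt0.
  have /cvgrPdist_lt/(_ _ d4) cx := @solution_cts _ _ _ _ _ _ _ _ sol x tau.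
  exists ([set y | `|x - y| < eta], [set a | `|u x tau - u x a| < d / 4]).
    split => /=; last exact: cx.
    apply/nbhs_ballP; exists eta => //= y; by rewrite -ball_normE.
  move=> [y a] [/= xy ua] rega Ky.
  have [_ _ /(_ y (Kk y Ky)) h1] := rega x (Kk x Kx).
  have [_ _ /(_ y (Kk y Ky)) h2] := regtau x (Kk x Kx).
  have h3 : N * `|x - y| <= d / 4 by apply: le_trans Neta; rewrite ler_wpM2l// ltW.
  have -> : u y a - u y tau = - (u x a - u y a) + (u x tau - u y tau) - (u x tau - u x a) by ring.
  apply: le_trans (ler_normB _ _) _; apply: le_trans (lerD (ler_normD _ _) (lexx _)) _.
  rewrite normrN; lra.
move=> /nbhs_ballP[e /= e0 he]; exists e => // a x ae rega Kx.
by apply: (he a) => //; rewrite /ball /= distrC.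
Unshelve. all: by end_near. Qed.

(** On an interval where the closure of the set of dips is uniformly regular, a dip [tau] is refuted
    by comparing a later time with the last time of that closure before it: equicontinuity links
    that time with [tau], persistence links it with the later time. *)
Lemma no_dip_everywhere c (rho t : R) : sball c rho `<=` Omega -> no_dip u c rho t.
Proof.
move=> KO; apply: contrapT => nd.
pose F := [set tau | ~ no_dip u c rho tau].
have cF : closed (closure F) by exact: closed_closure.
have Fne : closure F !=set0 by exists t; exact: subset_closure.
have rho0 : 0 <= rho.
  rewrite leNgt; apply/negP => rho0; apply: nd => th d thr d0; exists 1 => // t' x _.
  by rewrite /sball /= => h; have := normr_ge0 (x - c); lra.
pose k := `|c| + rho.
have k_ge0 : 0 <= k by rewrite addr_ge0.
have Kk x : sball c rho x -> `|x| <= k.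
  rewrite /sball /= => h; have -> : x = c + (x - c) by rewrite addrC subrK.
  by apply: le_trans (ler_normD _ _) _; rewrite lerD2l.
have [N [al [be [t0 [/andP[at0 t0b] Ft0 hN]]]]] :=
  baire_line Fne (fun N => @closed_regular _ _ _ _ _ _ _ _ sol k N%:R)
    (fun t => regular_exists sol t k_ge0).
have [tau [Ftau /andP[altau taube]]] : F `&` [set t | al < t < be] !=set0.
  apply: Ft0; apply/nbhs_ballP; exists (Num.min (t0 - al) (be - t0)).
    by rewrite /= lt_min !subr_gt0 at0.
  move=> t' /=; rewrite /ball /= lt_min !ltr_norml => /andP[/andP[h1 h2] /andP[h3 h4]].
  by apply/andP; split; lra.
have clFtau : closure F tau := subset_closure Ftau.
apply: Ftau => th d thr d0.
have regF a : al < a < be -> closure F a -> regular u k N%:R a by exact: hN.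
have altaube : al < tau < be by rewrite altau taube.
have [th0|th0] := ltP th 0.
  exists 1 => // t' x _; rewrite /sball /= => h; have := normr_ge0 (x - c); lra.
have Kk' x : sball c th x -> `|x| <= k.
  by move=> h; apply: Kk; rewrite /sball /= in h *; apply: le_trans h (ltW thr).
have d20 : 0 < d / 2 by rewrite divr_gt0.
have N0 : 0 <= N%:R :> R by [].
have [e1 e10 he1] := regular_equicontinuous Kk' N0 (regF _ altaube clFtau) d20.
(* Cubes of radius [2 r] around points of the cube of radius [th] stay within radius
   [(rho + th) / 2 < rho]. *)
pose r := Num.min 1 ((rho - th) / 4).
have r0 : 0 < r by rewrite lt_min ltr01 divr_gt0// subr_gt0.
have [r1 rth] : r <= 1 /\ r <= (rho - th) / 4 by rewrite !ge_min !lexx orbT.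
have r01 : 0 < r <= 1 by rewrite r0 r1.
have [C C0 hC] := no_dip_persistence_open s01 cf sol pos r01 N0.
pose th' := (rho + th) / 2.
have th'r : th' < rho by rewrite /th'; lra.
have sub x : sball c th x -> sball x (2 * r) `<=` sball c th'.
  move=> h y hy; rewrite /sball /= in h hy *.
  have -> : y - c = (y - x) + (x - c) by rewrite addrA subrK.
  by apply: le_trans (ler_normD _ _) _; rewrite /th'; lra.
have sub' x : sball c th x -> sball x (2 * r) `<=` sball c rho.
  by move=> h y /(sub x h); rewrite /sball /= => h'; exact: le_trans h' (ltW th'r).
pose e2 := d / (2 * (C + 1)).
have e20 : 0 < e2 by rewrite divr_gt0// mulr_gt0// ltr_wpDl.
have Ce2 : C * e2 <= d / 2.
  have -> : d / 2 = (C + 1) * e2 by rewrite /e2; field; rewrite gt_eqF// ltr_wpDl.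
  by rewrite ler_wpM2r ?(ltW e20)// lerDl.
exists (Num.min (be - tau) (Num.min e1 e2)).
  by rewrite !lt_min subr_gt0 taube e10 e20.
move=> t1 x /andP[t1a t1b] Kx.
have {t1b} [t1be t1e1 t1e2] : [/\ t1 < be, t1 - tau < e1 & t1 - tau < e2].
  have : t1 - tau < Num.min (be - tau) (Num.min e1 e2) by rewrite ltrBlDl.
  by rewrite !lt_min => /andP[h1 /andP[-> ->]]; split => //; rewrite ltrD2r in h1.
(* Its supremum is regular with the uniform [N], and no dip lies between it and [t1]. *)
pose S := [set a | tau <= a <= t1 /\ closure F a].
have Stau : S tau by split => //; rewrite lexx ltW.
have hS : has_sup S by split; [exists tau|exists t1 => a [/andP[]]].
set a := sup S.
have taua : tau <= a by apply: ub_le_sup => //; exact: hS.2.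
have at1 : a <= t1 by apply: ge_sup; [exists tau|move=> ? [/andP[]]].
have Fa : closure F a.
  apply: contrapT => h; have [e e0 he] := closed_notin_ball cF h.
  have [a' [/andP[h1 h2] Fa'] h3] := sup_adherent e0 hS.
  have h4 : a' <= a by apply: ub_le_sup; [exact: hS.2|split=> //; rewrite h1].
  by apply: (he a' _ Fa'); rewrite ler0_norm ?subr_le0// opprB ltrBlDl -ltrBlDr.
have ala : al < a < be by rewrite (lt_le_trans altau taua) (le_lt_trans at1 t1be).
have rega := regF a ala Fa.
have h1 : `|u x a - u x tau| <= d / 2.
  apply: he1 => //; rewrite ger0_norm ?subr_ge0//.
  by apply: le_lt_trans t1e1; rewrite lerD2r.
suff : u x a - C * (t1 - a) <= u x t1.
  move: h1; rewrite ler_norml => /andP[h1 _].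
  have : C * (t1 - a) <= C * e2 by rewrite ler_wpM2l//; lra.
  lra.
move: (at1); rewrite le_eqVlt => /predU1P[->|at1'].
  by rewrite subrr mulr0 subr0.
have nFt1 : ~ closure F t1.
  move=> Ft1; have : S t1 by split=> //; rewrite lexx (le_trans taua).
  by move=> /(ub_le_sup hS.2); rewrite leNgt at1'.
(* Persistence reaches times strictly before the end of a dip-free interval, so the interval is
   extended beyond [t1]. *)
have [e e0 he] := closed_notin_ball cF nFt1.
apply: (hC c x th' rho k a (t1 + e)) => //.
- exact: sub.
- by move=> y /(sub' x Kx)/KO.
- by move=> y /(sub' x Kx)/Kk.
- move=> t' /andP[h2 h3]; apply: contrapT => Ft'.
  have [t't1|t1t'] := leP t' t1.
    have : S t'.
      by split; [rewrite t't1 andbT (le_trans taua)// ltW|exact: subset_closure].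
    by move=> /(ub_le_sup hS.2); rewrite leNgt h2.
  apply: (he t'); last exact: subset_closure.
  by rewrite gtr0_norm ?subr_gt0// ltrBlDl.
- by rewrite at1 /=; lra.
Qed.

End no_dip_everywhere.

(** * Contact points in the half-space *)

Lemma half_space_pos (R : realType) (n : nat) (hn : (2 <= n)%N) (Omega : set 'rV[R]_n) :
  Omega = right_half_space hn -> forall x, Omega x -> 0 <= coord1 hn x.
Proof. by move=> -> x /ltW. Qed.

(** An approximate viscosity test. A parabola in [x_1] lies below [u] on a strip and a monotone
    profile [psi] everywhere; [u] at [(x0, t0)] exceeds the parabola by less than [sig^2]. Then the
    equation holds up to [sig] at some value [lam] of [u] near [m0]. The profile is shifted by [sig]
    because the contact point may lie that far to the left. *)
Lemma contact (R : realType) (n : nat) (hn : (2 <= n)%N) (s p : R) (f : R -> R)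
    (Omega : set 'rV[R]_n) (u : 'rV[R]_n -> R -> R) : 0 < s < 1 -> continuous f ->
  p < 0 -> classical_solution hn s p f Omega u -> Omega = right_half_space hn ->
  forall (x0 : 'rV[R]_n) (t0 sig eps m0 b A Mpsi : R) (psi : R -> R),
  0 < sig -> sig <= eps -> eps <= 1 -> 0 <= A -> 2 * sig < coord1 hn x0 ->
  measurable_fun setT psi -> {homo psi : a b / a <= b} -> (forall a, `|psi a| <= Mpsi) ->
  (forall x t, `|coord1 hn x - coord1 hn x0| <= 2 * eps ->
     m0 + b * (coord1 hn x - coord1 hn x0) - A * (coord1 hn x - coord1 hn x0) ^+ 2 <= u x t) ->
  (forall x t, psi (coord1 hn x - coord1 hn x0) <= u x t) ->
  u x0 t0 < m0 + sig ^+ 2 ->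
  exists2 lam : R, `|lam - m0| <= (`|b| + A + 1) * sig &
    frac_lap_const hn s * (\int[lebesgue_rV R n]_(z in [set z | eps < enorm z])
            ((psi (coord1 hn z - sig) - m0 - (`|b| + 1) * sig) * kern s z) -
          (A + 1) * (eps `^ (2 - 2 * s) * momentc n s)) +
    (coord1 hn x0 - sig) * (m0 + (`|b| + 1) * sig) `^ p + f lam <= sig.
Proof.
move=> s01 cf p0 sol OmegaE x0 t0 sig eps m0 b A Mpsi psi.
pose i1 := Ordinal (ltnW hn).
move=> sg0 sge e1 A0 x0s mpsi mono psiM hpar hpsi ux0.
apply: contrapT => no.
have e0 : 0 < eps by apply: lt_le_trans sge.
(* The paraboloid subtracted here localises the contact: beyond distance [sig] it costs more than
   the [sig^2] gained in time. *)
pose phi (x : 'rV[R]_n) := m0 + b * (coord1 hn x - coord1 hn x0) -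
  A * (coord1 hn x - coord1 hn x0) ^+ 2 - enorm (x - x0) ^+ 2.
have c1le (x y : 'rV[R]_n) : `|coord1 hn x - coord1 hn y| <= `|x - y|.
  by have := coord_le_norm (x - y) i1; rewrite !mxE.
have ccoord : continuous (fun x : 'rV[R]_n => coord1 hn x - coord1 hn x0).
  by move=> x; exact: (cvgB (@coord_continuous R 1 n ord0 i1 x) (cvg_cst _)).
have cb : continuous (fun x : 'rV[R]_n => b * (coord1 hn x - coord1 hn x0)).
  by move=> x; exact: (cvgM (cvg_cst b) (ccoord x)).
have cA : continuous (fun x : 'rV[R]_n => A * (coord1 hn x - coord1 hn x0) ^+ 2).
  rewrite (_ : (fun x => _) = (fun x : 'rV[R]_n => A * ((coord1 hn x - coord1 hn x0) * (coord1 hn x - coord1 hn x0)))).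
    by move=> x; exact: (cvgM (cvg_cst A) (cvgM (ccoord x) (ccoord x))).
  by apply/funext => x; rewrite expr2.
have cphi : continuous phi.
  move=> x; exact: (cvgB (cvgB (cvgD (cvg_cst m0) (cb x)) (cA x)) (@cts_sqr_enorm R n x0 x)).
have KO (r : R) : r < 2 * sig -> sball x0 r `<=` Omega.
  move=> rs x Kx; rewrite OmegaE /right_half_space /=; have := c1le x x0; rewrite ler_norml => /andP[h _].
  by rewrite /sball /= in Kx; lra.
have s32 : 3 / 2 * sig < 2 * sig by lra.
have s132 : sig < 3 / 2 * sig by lra.
have s12 : sig < 2 * sig by lra.
have nd (t d : R) : t0 - sig <= t < t0 -> 0 < d -> exists2 e : R, 0 < e &
    forall (t' : R) (x : 'rV[R]_n), t < t' < t + e -> sball x0 sig x -> u x t - d <= u x t'.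
  move=> _ d0; exact: (@no_dip_everywhere R n hn s p f Omega u s01 cf sol (half_space_pos OmegaE) x0 _ t (KO _ s32) _ _ s132 d0).
have init (x : 'rV[R]_n) : sball x0 sig x -> phi x <= u x (t0 - sig).
  move=> Kx; apply: le_trans (hpar x _ _); first by rewrite /phi gerBl sqr_ge0.
  by apply: le_trans (c1le _ _) _; rewrite /sball /= in Kx; lra.
have t0s : t0 - sig <= t0 by lra.
have K0 : sball x0 sig x0 by rewrite /sball /= subrr normr0 ltW.
(* If [u_t > sig] at every positive maximum, the barrier gives [m0 + sig^2 <= u x0 t0], a
   contradiction. *)
have BC := barrier_comparison sol (al := sig) (ltW sg0) t0s (KO _ s12) cphi nd init.
suff : forall (t : R) (x : 'rV[R]_n), t0 - sig < t <= t0 -> sball x0 sig x ->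
     (forall y : 'rV[R]_n, sball x0 sig y -> phi y - u y t <= phi x - u x t) ->
     0 < phi x + sig * (t - (t0 - sig)) - u x t -> sig < derive1 (u x) t.
  move=> H; have := BC H x0 K0; rewrite /phi !subrr enorm0 !expr0n /= !mulr0 !subr0 addr0.
  by rewrite opprB addrCA subrr addr0 -expr2; move: ux0; clear; lra.
move=> t x /andP[t1 t2] Kx hmax q0.
rewrite ltNge; apply/negP => ut; apply: no.
have tsig : sig * (t - (t0 - sig)) <= sig ^+ 2 by rewrite expr2 ler_wpM2l ?(ltW sg0)//; move: t2; clear; lra.
set z1 := coord1 hn x - coord1 hn x0.
have xz1 : `|z1| <= sig by apply: le_trans (c1le _ _) Kx.
have /andP[z1a z1b] : - sig <= z1 <= sig by rewrite -ler_norml.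
have z1e : `|z1| <= 2 * eps by move: xz1 sge e0; clear; lra.
have ux1 := hpar x t z1e; rewrite -/z1 in ux1.
have A1 : 0 <= A * z1 ^+ 2 by rewrite mulr_ge0 ?sqr_ge0.
have sg1 : sig <= 1 by apply: le_trans e1.
have sg2 : sig ^+ 2 <= sig by rewrite expr2 ler_piMr// ltW.
have bz : `|b * z1| <= `|b| * sig by rewrite normrM ler_wpM2l.
have /andP[bz1 bz2] : - (`|b| * sig) <= b * z1 <= `|b| * sig by rewrite -ler_norml.
have Az : A * z1 ^+ 2 <= A * sig.
  rewrite ler_wpM2l//; apply: le_trans sg2.
  by rewrite -real_normK ?num_real// ler_pXn2r ?nnegrE// ltW.
have en0 := sqr_ge0 (enorm (x - x0)).
have ux2 : u x t < m0 + b * z1 - A * z1 ^+ 2 + sig ^+ 2.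
  by move: q0 tsig en0; rewrite /phi -/z1; clear; lra.
have uup : u x t <= m0 + (`|b| + 1) * sig by rewrite mulrDl mul1r; move: ux2 bz2 A1 sg2; clear; lra.
exists (u x t).
  rewrite ler_norml !mulrDl mul1r; move: ux1 ux2 bz1 bz2 Az A1 sg2 sg0; rewrite /phi; clear; move=> *; apply/andP; split; lra.
(* A maximum over the small cube is one over the whole strip, so second differences may be taken up
   to radius [eps], which does not shrink with [sig]. *)
have gmax (y : 'rV[R]_n) : `|coord1 hn y - coord1 hn x0| <= 2 * eps -> phi y - u y t <= phi x - u x t.
  move=> hy; have [Ky|Ky] := pselect (sball x0 sig y); first exact: hmax.
  have eny : sig < enorm (y - x0).
    by rewrite ltNge; apply/negP => h; apply: Ky; exact: le_trans (norm_le_enorm _) h.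
  have : sig ^+ 2 < enorm (y - x0) ^+ 2 by rewrite ltr_pXn2r ?nnegrE ?enorm_ge0// ltW.
  have := hpar y t hy; move: q0 tsig; rewrite /phi; have := en0; clear; lra.
have Ox : Omega x by exact: KO s12 _ Kx.
have e01 : 0 < eps <= 1 by rewrite e0 e1.
have A10 : 0 <= A + 1 by rewrite addr_ge0.
have c1D (y z : 'rV[R]_n) : coord1 hn (y + z) = coord1 hn y + coord1 hn z by rewrite /coord1 mxE.
have c1N (z : 'rV[R]_n) : coord1 hn (- z) = - coord1 hn z by rewrite /coord1 mxE.
have c1en (z : 'rV[R]_n) : `|coord1 hn z| <= enorm z by exact: coord_le_enorm.
have hB (z : 'rV[R]_n) : enorm z <= eps -> - (2 * (A + 1)) * enorm z ^+ 2 <= sdiff (u ^~ t) x z.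
  move=> ze; have cz := le_trans (c1en z) ze.
  have m1 : phi (x + z) - u (x + z) t <= phi x - u x t.
    apply: gmax; rewrite c1D addrAC -/z1; apply: le_trans (ler_normD _ _) _; move: xz1 cz sge; clear; lra.
  have m2 : phi (x - z) - u (x - z) t <= phi x - u x t.
    apply: gmax; rewrite c1D c1N addrAC -/z1; apply: le_trans (ler_normB _ _) _; move: xz1 cz sge; clear; lra.
  have E := sdiff_paraboloid x0 1 x z; rewrite /sdiff !mul1r in E.
  have c2 : coord1 hn z ^+ 2 <= enorm z ^+ 2.
    by rewrite -real_normK ?num_real// ler_pXn2r ?nnegrE ?enorm_ge0.
  have Ac2 := ler_wpM2l A0 c2.
  rewrite /phi !c1D c1N in m1 m2.
  have E1 : (coord1 hn x + coord1 hn z - coord1 hn x0) ^+ 2 + (coord1 hn x - coord1 hn z - coord1 hn x0) ^+ 2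
     = 2 * (coord1 hn x - coord1 hn x0) ^+ 2 + 2 * coord1 hn z ^+ 2 by ring.
  have E2 := congr1 (fun a => A * a) E1; rewrite /= !mulrDr in E2.
  by rewrite /sdiff mulNr mulrDr mulrDl mulr1; move: m1 m2 E E2 Ac2; clear; lra.
have mg : (lebesgue_rV R n).-integrable [set z | eps < enorm z]
    (EFin \o (fun z => (psi (coord1 hn z - sig) - m0 - (`|b| + 1) * sig) * kern s z)).
  apply: (@integrable_bounded_kern R n s s01 _ (Mpsi + `|m0| + (`|b| + 1) * sig)) => //.
    apply: measurable_funB => //; apply: measurable_funB => //.
    apply: (measurableT_comp mpsi); apply: measurable_funB => //.
    exact: measurable_coordR.
  move=> z; apply: le_trans (ler_normB _ _) _; apply: lerD; last first.
    by rewrite ger0_norm// mulr_ge0 ?(ltW sg0)// addr_ge0.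
  by apply: le_trans (ler_normB _ _) _; rewrite lerD2r.
have hg (z : 'rV[R]_n) : eps < enorm z ->
    psi (coord1 hn z - sig) - m0 - (`|b| + 1) * sig <= u (x + z) t - u x t.
  move=> _; have h1 := hpsi (x + z) t.
  have h2 : psi (coord1 hn z - sig) <= psi (coord1 hn (x + z) - coord1 hn x0).
    by apply: mono; rewrite c1D addrAC -/z1; move: z1a; clear; lra.
  by move: h1 h2 uup; clear; lra.
have main := time_derivative_ge s01 sol Ox e01 A10 hB mg hg.
have ux0' := solution_gt0 sol t Ox.
have hp := ler_powR_neg ux0' uup (ltW p0).
have hx : coord1 hn x0 - sig <= coord1 hn x by move: z1a; rewrite /z1; clear; lra.
have c0 : 0 <= coord1 hn x by exact: (half_space_pos OmegaE).
have hxp : (coord1 hn x0 - sig) * (m0 + (`|b| + 1) * sig) `^ p <= coord1 hn x * u x t `^ p.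
  by apply: ler_pM => //; [move: x0s sg0; clear; lra|exact: powR_ge0].
by move: main hxp ut; clear; move: (frac_lap_const hn s * _) => K; lra.
Qed.

(** * The lowest value beyond a hyperplane and its inf-convolution *)

Section lowest_value.
Context (R : realType) (n : nat) (hn : (2 <= n)%N) (s p : R) (f : R -> R).
Context (Omega : set 'rV[R]_n) (u : 'rV[R]_n -> R -> R).
Context (s01 : 0 < s < 1) (cf : continuous f) (p0 : p < 0).
Context (sol : classical_solution hn s p f Omega u).
Context (OmegaE : Omega = right_half_space hn).
Local Notation mu := (lebesgue_rV R n).
Local Notation kern := (@kern R n s).
Local Notation k0 := (frac_lap_const hn s).
Local Notation i1 := (Ordinal (ltnW hn)).
Implicit Types (x y z c : 'rV[R]_n) (t r : R).

Lemma coord1D x y : coord1 hn (x + y) = coord1 hn x + coord1 hn y.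
Proof. by rewrite /coord1 mxE. Qed.

Lemma coord1Z (l : R) : coord1 hn (l *: delta_mx ord0 i1) = l.
Proof. by rewrite /coord1 !mxE !eqxx mulr1. Qed.

Definition lowest r := inf [set v | exists x t, r <= coord1 hn x /\ v = u x t].

Let has_inf_lowest r : has_inf [set v | exists x t, r <= coord1 hn x /\ v = u x t].
Proof.
split; last by exists 0 => v [x [t [_ ->]]]; exact: solution_ge0 sol x t.
by exists (u (r *: delta_mx ord0 i1) 0), (r *: delta_mx ord0 i1), 0; rewrite coord1Z.
Qed.

Lemma lowest_le r x t : r <= coord1 hn x -> lowest r <= u x t.
Proof. by move=> h; apply: ge_inf; [exact: (has_inf_lowest r).2|exists x, t]. Qed.

Lemma le_lowest r a : (forall x t, r <= coord1 hn x -> a <= u x t) -> a <= lowest r.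
Proof.
move=> h; apply: lb_le_inf; first exact: (has_inf_lowest r).1.
by move=> v [x [t [hx ->]]]; exact: h.
Qed.

Lemma lowest_lt r a : lowest r < a -> exists x t, r <= coord1 hn x /\ u x t < a.
Proof. by move=> /(inf_lt (has_inf_lowest r).1)[v [x [t [h ->]]] hv]; exists x, t. Qed.

Lemma lowest_ge0 r : 0 <= lowest r.
Proof. by apply: le_lowest => x t _; exact: solution_ge0 sol x t. Qed.

Lemma lowest_mono : {homo lowest : r r' / r <= r'}.
Proof.
by move=> r r' rr'; apply: le_lowest => x t h; apply: lowest_le; exact: le_trans h.
Qed.

Lemma lowest_le0 r : r <= 0 -> lowest r = 0.
Proof.
move=> r0; apply/eqP; rewrite eq_le lowest_ge0 andbT.
rewrite -(solution_eq0 sol (x := r *: delta_mx ord0 i1) 0); last first.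
  by rewrite OmegaE /right_half_space /= coord1Z; apply/negP; rewrite -leNgt.
by apply: lowest_le; rewrite coord1Z.
Qed.

(** The penalty is one-sided: points beyond [r] are free, which keeps the function monotone and
    below [lowest]. *)
Definition infconv (A r : R) :=
  inf [set v | exists x t, v = u x t + A * Num.max (r - coord1 hn x) 0 ^+ 2].

Let has_inf_infconv A r : 0 <= A ->
  has_inf [set v | exists x t, v = u x t + A * Num.max (r - coord1 hn x) 0 ^+ 2].
Proof.
move=> A0; split; first by eexists; exists 0, 0; reflexivity.
exists 0 => v [x [t ->]].
by rewrite addr_ge0 ?(solution_ge0 sol)// mulr_ge0 ?sqr_ge0.
Qed.

Lemma infconv_le A r x t : 0 <= A ->
  infconv A r <= u x t + A * Num.max (r - coord1 hn x) 0 ^+ 2.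
Proof. by move=> A0; apply: ge_inf; [exact: (has_inf_infconv r A0).2|exists x, t]. Qed.

Lemma le_infconv A r (a : R) : 0 <= A ->
  (forall x t, a <= u x t + A * Num.max (r - coord1 hn x) 0 ^+ 2) -> a <= infconv A r.
Proof.
move=> A0 h; apply: lb_le_inf; first exact: (has_inf_infconv r A0).1.
by move=> v [x [t ->]].
Qed.

Lemma infconv_lt A r (a : R) : 0 <= A -> infconv A r < a ->
  exists x t, u x t + A * Num.max (r - coord1 hn x) 0 ^+ 2 < a.
Proof. by move=> A0 /(inf_lt (has_inf_infconv r A0).1)[v [x [t ->]] hv]; exists x, t. Qed.

Lemma infconv_le_lowest A r : 0 <= A -> infconv A r <= lowest r.
Proof.
move=> A0; apply: le_lowest => x t hx; apply: le_trans (infconv_le r x t A0) _.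
by rewrite max_r ?subr_le0// expr0n /= mulr0 addr0.
Qed.

Lemma infconv_contact A r x0 (t0 sig eps Mpsi : R) (psi : R -> R) :
  let d0 := Num.max (r - coord1 hn x0) 0 in let m0 := infconv A r - A * d0 ^+ 2 in
  0 < sig -> sig <= eps -> eps <= 1 -> 0 <= A -> 2 * sig < coord1 hn x0 ->
  measurable_fun setT psi -> {homo psi : a b / a <= b} -> (forall a, `|psi a| <= Mpsi) ->
  (forall x t, psi (coord1 hn x - coord1 hn x0) <= u x t) ->
  u x0 t0 + A * d0 ^+ 2 < infconv A r + sig ^+ 2 ->
  exists2 lam : R, `|lam - m0| <= (2 * A * d0 + A + 1) * sig &
    k0 * (\int[mu]_(z in [set z | eps < enorm z])
            ((psi (coord1 hn z - sig) - m0 - (2 * A * d0 + 1) * sig) * kern z) -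
          (A + 1) * (eps `^ (2 - 2 * s) * momentc n s)) +
    (coord1 hn x0 - sig) * (m0 + (2 * A * d0 + 1) * sig) `^ p + f lam <= sig.
Proof.
move=> d0 m0 sg0 sge e1 A0 x0s mpsi mono psiM hpsi hu.
have d00 : 0 <= d0 by rewrite le_max lexx orbT.
have b0 : 0 <= 2 * A * d0 by rewrite mulr_ge0// mulr_ge0.
have := contact s01 cf p0 sol OmegaE sg0 sge e1 A0 x0s mpsi mono psiM
  (b := 2 * A * d0) (m0 := m0) (t0 := t0).
rewrite (ger0_norm b0); apply => //; last by rewrite /m0; lra.
move=> x t _; set z1 := coord1 hn x - coord1 hn x0.
(* Expanding this square gives the touching parabola, with slope [2 A d0]. *)
have : A * Num.max (r - coord1 hn x) 0 ^+ 2 <= A * (d0 - z1) ^+ 2.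
  rewrite ler_wpM2l// -[leRHS]real_normK ?num_real// ler_pXn2r ?nnegrE ?le_max ?lexx ?orbT//.
  rewrite ge_max normr_ge0 andbT; apply: le_trans (ler_norm _).
  have : r - coord1 hn x0 <= d0 by rewrite le_max lexx.
  by rewrite /z1; lra.
have := infconv_le r x t A0; rewrite /m0 sqrrB; lra.
Qed.

(** Move an almost minimal point slightly in the direction of [x_1]; [u] is continuous in [x]. *)
Lemma lowest_right r (d : R) : 0 < d -> exists2 e : R, 0 < e & lowest (r + e) <= lowest r + d.
Proof.
move=> d0; have : lowest r < lowest r + d by rewrite ltrDl.
move=> /lowest_lt[x [t [rx ux]]].
have /cvgr_lt/(_ _ ux) := @solution_cts_x _ _ _ _ _ _ _ _ sol t x.
move=> /nbhs_ballP[e /= e0 he].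
have den : `|delta_mx ord0 i1 : 'rV[R]_n| <= 1.
  by apply: le_trans (norm_le_enorm _) _; rewrite enorm_delta.
exists (e / 2); first by rewrite divr_gt0.
apply: (@le_trans _ _ (u (x + (e / 2) *: delta_mx ord0 i1) t)).
  by apply: lowest_le; rewrite coord1D coord1Z lerD2r.
apply/ltW/he; rewrite -ball_normE /ball_ /= opprD addrA subrr sub0r normrN normrZ.
rewrite gtr0_norm ?divr_gt0//; apply: (@le_lt_trans _ _ (e / 2)).
  by rewrite ler_piMr// divr_ge0// ltW.
by rewrite ltr_pdivrMr// ltr_pMr// ltr1n.
Qed.

End lowest_value.

(** * Left continuity of the lowest value *)

Section lowest_left.
Context (R : realType) (n : nat) (hn : (2 <= n)%N) (s p : R) (f : R -> R).
Context (Omega : set 'rV[R]_n) (u : 'rV[R]_n -> R -> R).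
Context (s01 : 0 < s < 1) (cf : continuous f) (p0 : p < 0).
Context (sol : classical_solution hn s p f Omega u).
Context (OmegaE : Omega = right_half_space hn).
Local Notation mu := (lebesgue_rV R n).
Local Notation kern := (@kern R n s).
Local Notation k0 := (frac_lap_const hn s).
Local Notation i1 := (Ordinal (ltnW hn)).
Implicit Types (x y z c : 'rV[R]_n) (t r : R).

Lemma Rintegral_indic_kern (D S : set 'rV[R]_n) : measurable D -> measurable S -> S `<=` D ->
  \int[mu]_(z in D) (\1_S z * kern z) = \int[mu]_(z in S) kern z.
Proof.
move=> mD mS SD; rewrite /Rintegral.
suff -> : (\int[mu]_(z in D) (\1_S z * kern z)%:E = \int[mu]_(z in S) (kern z)%:E)%E by [].
rewrite integral_mkcond [RHS]integral_mkcond; apply: eq_integral => z _.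
rewrite !patchE indicE; case: (boolP (z \in S)) => zS.
  have zD : z \in D by rewrite inE; apply: SD; rewrite inE in zS.
  by rewrite zD mul1r.
by case: ifP => // _; rewrite mul0r.
Qed.

Lemma integrable_indic_kern (S : set 'rV[R]_n) (e : R) : 0 < e -> measurable S ->
  mu.-integrable [set z | e < enorm z] (EFin \o (fun z => \1_S z * kern z)).
Proof.
move=> e0 mS; apply: (@integrable_bounded_kern R n s s01 _ 1) => //.
by move=> z; rewrite indicE; case: (_ \in _); rewrite ?normr1 ?normr0.
Qed.

(** Three contributions to the nonlocal term: the jump [h] seen on one side, a small oscillation
    [tau] on the whole tail, and the trivial loss [a] at a fixed distance. *)
Lemma step_integral_ge (g : 'rV[R]_n -> R) (h tau a e e' : R) : 0 < e -> e <= e' ->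
  mu.-integrable [set z | e < enorm z] (EFin \o (fun z => g z * kern z)) ->
  (forall z, e < enorm z ->
     h * \1_[set z | 3 * e < coord1 hn z] z - tau - a * \1_[set z | e' < enorm z] z <= g z) ->
  h * ((3 * e) `^ (- (2 * s)) * rightc s i1) - tau * (e `^ (- (2 * s)) * tailc n s) -
  a * (e' `^ (- (2 * s)) * tailc n s) <=
  \int[mu]_(z in [set z | e < enorm z]) (g z * kern z).
Proof.
move=> e0 ee' ig hg; have e'0 : 0 < e' by apply: lt_le_trans ee'.
have e30 : 0 < 3 * e by rewrite mulr_gt0.
have mD := @measurable_enorm_gt R n e; have mT := @measurable_enorm_gt R n e'.
have mS := @measurable_coord_gt R n i1 (3 * e).
set S := [set z : 'rV[R]_n | 3 * e < coord1 hn z]; set T := [set z : 'rV[R]_n | e' < enorm z].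
have SD : S `<=` [set z : 'rV[R]_n | e < enorm z].
  move=> z h1; apply: (@right_sub_tail R n i1); rewrite /S /= in h1 *.
  by apply: le_lt_trans h1; rewrite ler_peMl ?(ltW e0)//; lra.
have TD : T `<=` [set z : 'rV[R]_n | e < enorm z].
  by move=> z; rewrite /T /=; exact: le_lt_trans.
have i2 := integrableZl_EFin h mD (integrable_indic_kern e0 mS).
have i3 := integrable_kern n s01 (- tau) e0.
have i4 := integrableZl_EFin (- a) mD (integrable_indic_kern e0 mT).
have <- : h * \int[mu]_(z in [set z | e < enorm z]) (\1_S z * kern z) =
    h * ((3 * e) `^ (- (2 * s)) * rightc s i1).
  by rewrite Rintegral_indic_kern// /Rintegral (right_integral s01 i1 e30).
have <- : a * \int[mu]_(z in [set z | e < enorm z]) (\1_T z * kern z) =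
    a * (e' `^ (- (2 * s)) * tailc n s).
  by rewrite Rintegral_indic_kern// /Rintegral tail_integral.
rewrite -mulNr -[in X in _ + X]mulNr -(Rtail_integral n s01 _ e0).
have iS := integrable_indic_kern e0 mS; have iT := integrable_indic_kern e0 mT.
rewrite -(RintegralZl h mD iS) -(RintegralZl (- a) mD iT).
have i23 := integrableD mD i2 i3.
rewrite -RintegralD// -RintegralD//.
apply: le_Rintegral => //.
  exact: (integrableD mD i23 i4).
move=> z ez; have := ler_wpM2r (kern_ge0 s z) (hg z ez).
rewrite -/S -/T; apply: le_trans.
by rewrite le_eqVlt; apply/orP; left; apply/eqP; ring.
Qed.

(** The profile for [contact]: the value after the jump, the value a little before it, and 0, which
    is all that is known further left. *)
Definition step3 (a b v w : R) (x : R) := if a <= x then v else if b <= x then w else 0.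

Lemma step3_mono (a b v w : R) : b <= a -> 0 <= w -> w <= v -> {homo step3 a b v w : x y / x <= y}.
Proof.
move=> ba w0 wv x y xy; rewrite /step3.
case: (leP a x) => ax; first by rewrite (le_trans ax xy).
case: (leP b x) => bx.
  by rewrite (le_trans bx xy); case: ifP.
by case: ifP => _; [exact: le_trans wv|case: ifP].
Qed.

Lemma measurable_step3 (a b v w : R) : measurable_fun setT (step3 a b v w).
Proof.
apply: measurable_fun_ifT => //.
  by apply: measurable_fun_ler; [exact: measurable_cst|exact: measurable_id].
apply: measurable_fun_ifT => //.
by apply: measurable_fun_ler; [exact: measurable_cst|exact: measurable_id].
Qed.

Lemma step3_bound (a b v w x : R) : 0 <= w -> w <= v -> `|step3 a b v w x| <= v.
Proof.
move=> w0 wv; have v0 := le_trans w0 wv; rewrite /step3.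
by case: ifP => _; [|case: ifP => _]; rewrite ger0_norm.
Qed.

End lowest_left.

(* A jump [h] of [lowest] at [r] would make the nonlocal term of size
   [h d^(-2s)] at distance [d] from it, more than any other term. *)
Lemma lowest_left (R : realType) (n : nat) (hn : (2 <= n)%N) (s p : R) (f : R -> R)
    (Omega : set 'rV[R]_n) (u : 'rV[R]_n -> R -> R) : 0 < s < 1 -> continuous f ->
  p < 0 -> classical_solution hn s p f Omega u -> Omega = right_half_space hn ->
  forall r h : R, 0 < h -> exists2 e : R, 0 < e & lowest hn u r - h <= lowest hn u (r - e).
Proof.
move=> s01 cf p0 sol OmegaE r h.
pose mu := lebesgue_rV R n; pose k0 := frac_lap_const hn s; pose i1 := Ordinal (ltnW hn).
move=> h0; have [r0|r0] := leP r 0.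
  exists 1 => //; rewrite (lowest_le0 sol OmegaE r0) sub0r.
  by apply: le_trans (lowest_ge0 sol _); rewrite oppr_le0 ltW.
apply: contrapT => no.
have low e : 0 < e -> lowest hn u (r - e) < lowest hn u r - h.
  by move=> e0; rewrite ltNge; apply/negP => ge; apply: no; exists e.
pose S := [set v | exists2 e : R, 0 < e & v = lowest hn u (r - e)].
have hS : has_sup S.
  split; first by exists (lowest hn u (r - 1)), 1.
  by exists (lowest hn u r - h) => v [e e0 ->]; exact/ltW/low.
set a := sup S.
have alow e : 0 < e -> lowest hn u (r - e) <= a.
  by move=> e0; apply: ub_le_sup; [exact: hS.2|exists e].
have ah : a + h <= lowest hn u r.
  by rewrite -lerBrDr; apply: ge_sup; [exact: hS.1|move=> v [e e0 ->]; exact/ltW/low].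
have a0 : 0 <= a by apply: le_trans (alow 1 ltr01); exact: (lowest_ge0 sol).
have s0 : 0 < 2 * s by case/andP: s01 => ? _; rewrite mulr_gt0.
have c1 := rightc_gt0 s01 i1; have ct := tailc_ge0 n s; have cm := momentc_ge0 n s.
have k00 := frac_lap_const_gt0 hn s01.
set ctt := tailc n s in ct *; set cmm := momentc n s in cm *.
pose H3 := h * (3 `^ (- (2 * s)) * rightc s i1).
have H30 : 0 < H3 by rewrite mulr_gt0// mulr_gt0// powR_gt0.
(* After multiplication by [d^(2s)] the jump contributes [H3], and the terms with [tau] contribute
   at most [tau (2 ctt + 4 cmm)], to be at most [H3 / 4]. *)
pose tau := H3 / (4 * (2 * ctt + 4 * cmm + 1)).
have den0 : 0 < 2 * ctt + 4 * cmm + 1 by lra.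
have tau0 : 0 < tau by rewrite divr_gt0// mulr_gt0.
have tauH : tau * (2 * ctt + 4 * cmm) <= H3 / 4.
  have -> : H3 / 4 = tau * (2 * ctt + 4 * cmm + 1) by rewrite /tau; field; rewrite gt_eqF.
  by rewrite ler_wpM2l ?(ltW tau0)// lerDl.
have [_ [d1 d10 ->] ad1] := sup_adherent tau0 hS; rewrite -/a in ad1.
set L1 := lowest hn u (r - d1) in ad1.
have L10 : 0 <= L1 by exact: (lowest_ge0 sol).
have L1a : L1 <= a by exact: alow.
have [G G0 hG] := f_bounded cf (a + 2).
pose K := a * ((d1 / 4) `^ (- (2 * s)) * ctt) + (G + 1) / k0.
have K0 : 0 <= K.
  apply: addr_ge0; first by rewrite mulr_ge0// mulr_ge0 ?powR_ge0.
  by rewrite divr_ge0 ?(ltW k00)// addr_ge0.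
have a10 : 0 < a + 1 by rewrite ltr_wpDl.
have cm10 : 0 < cmm + 1 by rewrite ltr_wpDl.
have d14 : 0 < d1 / 4 by rewrite divr_gt0.
have r4 : 0 < r / 8 by rewrite divr_gt0.
have td0 : 0 < tau * d1 ^+ 2 / (a + 1) by rewrite divr_gt0// mulr_gt0// exprn_gt0.
have H3c : 0 < H3 / 4 / (cmm + 1) by rewrite divr_gt0// divr_gt0.
have [d [d_gt0 d_1 dd1 [dr dtau dcm dK]]] : exists d : R, [/\ 0 < d, d <= 1, d <= d1 / 4 &
    [/\ d <= r / 8, d <= tau * d1 ^+ 2 / (a + 1), d <= H3 / 4 / (cmm + 1) & d `^ (2 * s) * K < H3 / 4]].
  near (0 : R)^'+ => d; exists d; split; [| | |split]; near: d.
  - exact: nbhs_right_gt.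
  - by apply: nbhs_right_le; exact: ltr01.
  - exact: nbhs_right_le.
  - exact: nbhs_right_le.
  - exact: nbhs_right_le.
  - exact: nbhs_right_le.
  - have c : d `^ (2 * s) * K @[d --> 0^'+] --> 0 * K by apply: cvgMl; exact: powR_cvg0.
    by apply: cvgr_lt c _ _; rewrite mul0r divr_gt0.
have d2d : d ^+ 2 <= d by rewrite expr2 ler_piMr// ltW.
have d20 : 0 < d ^+ 2 by rewrite exprn_gt0.
have d2a : d ^+ 2 * (a + 1) <= tau * d1 ^+ 2.
  by apply: (@le_trans _ _ (d * (a + 1))); [rewrite ler_wpM2r// ltW|rewrite -ler_pdivlMr].
have d2cm : d ^+ 2 * cmm <= H3 / 4.
  apply: (@le_trans _ _ (d * (cmm + 1))); last by rewrite -ler_pdivlMr.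
  by apply: ler_pM => //; [exact: ltW|rewrite lerDl].
(* Strong enough to keep the almost minimal point within [d] of [rho], yet [B d^2] is small, so the
   moment term does not compete with the jump. *)
pose B := 4 * tau / d ^+ 2.
have B0 : 0 < B by rewrite divr_gt0// mulr_gt0.
have Bd : B * d ^+ 2 = 4 * tau by rewrite /B divfK// gt_eqF.
pose W := 2 * B * d + B + 1.
have W0 : 1 <= W.
  by rewrite /W lerDr addr_ge0// ?(ltW B0)// mulr_ge0 ?(ltW d_gt0)// mulr_ge0// ltW.
have W00 : 0 < W by apply: lt_le_trans W0.
pose m := Num.min 1 tau.
have [m1 mtau] : m <= 1 /\ m <= tau by rewrite !ge_min !lexx orbT.
have m0 : 0 < m by rewrite lt_min ltr01 tau0.
pose sig := Num.min d (m / W).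
have sig0 : 0 < sig by rewrite lt_min d_gt0 divr_gt0.
have [sigd sigW'] : sig <= d /\ sig <= m / W by rewrite !ge_min !lexx orbT.
have sigW : W * sig <= m by rewrite mulrC -ler_pdivlMr.
have sigm : sig <= m by apply: le_trans sigW; rewrite ler_peMl// ltW.
have sig1 : sig <= 1 by exact: le_trans m1.
have sig2 : sig ^+ 2 <= sig by rewrite expr2 ler_piMr// ltW.
pose rho := r - d.
pose I := infconv hn u B rho.
have Ia : I <= a.
  by apply: le_trans (alow d d_gt0); exact: (infconv_le_lowest sol _ (ltW B0)).
have : I < I + sig ^+ 2 by rewrite ltrDl exprn_gt0.
move=> /(infconv_lt sol (ltW B0))[x0 [t0 hx0]].
set y := coord1 hn x0 in hx0.
set d0 := Num.max (rho - y) 0 in hx0.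
have d00 : 0 <= d0 by rewrite le_max lexx orbT.
have yrho : rho - d0 <= y by rewrite lerBlDr addrC -lerBlDr le_max lexx.
have u0 := solution_ge0 sol x0 t0.
(* Localisation in two rounds. With only [u >= 0] the point is within [d1 / 2]; there
   [u >= L1 > a - tau], which then improves the distance to [d]. *)
have crude : d0 < d1 / 2.
  rewrite -(@ltr_pXn2r _ 2)// ?nnegrE//; last by rewrite divr_ge0// ltW.
  have h1 : 4 * tau * d0 ^+ 2 < 4 * tau * (d1 / 2) ^+ 2.
    rewrite -{1}Bd mulrAC; apply: (@lt_le_trans _ _ ((a + 1) * d ^+ 2)).
      by rewrite ltr_pM2r//; move: hx0 u0 Ia sig2 sig1; clear; lra.
    rewrite (_ : 4 * tau * (d1 / 2) ^+ 2 = tau * d1 ^+ 2); last by field.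
    by rewrite mulrC.
  by move: h1; rewrite ltr_pM2l// mulr_gt0.
have yr1 : r - d1 <= y by move: yrho crude dd1 d10; rewrite /rho; clear; lra.
have ul : L1 <= u x0 t0 by apply: (lowest_le sol).
have fine0 : d0 < d.
  rewrite -(@ltr_pXn2r _ 2)// ?nnegrE//; last exact: ltW.
  have h1 : 4 * tau * d0 ^+ 2 < 4 * tau * d ^+ 2.
    rewrite -{1}Bd mulrAC ltr_pM2r//.
    by move: hx0 Ia ul ad1 sig2 sigm mtau tau0; clear; lra.
  by move: h1; rewrite ltr_pM2l// mulr_gt0.
have yr : r - 2 * d <= y by move: yrho fine0; rewrite /rho; clear; lra.
have y2 : 2 * sig < y by move: yr dr sigd r0; clear; lra.
(* As [y >= r - 2 d], moving by [2 d] passes the jump at [r], and moving back by [d1 / 2] stays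
   beyond [r - d1]. *)
pose psi := step3 (2 * d) (- (d1 / 2)) (a + h) L1.
have L1ah : L1 <= a + h by move: L1a h0; clear; lra.
have mono : {homo psi : x y / x <= y} by apply: (step3_mono (R := R)) => //; move: d_gt0 d10; clear; lra.
have hpsi x t : psi (coord1 hn x - coord1 hn x0) <= u x t.
  rewrite -/y /psi /step3; case: (leP (2 * d) (coord1 hn x - y)) => h1.
    by apply: le_trans ah _; apply: (lowest_le sol); move: h1 yr; clear; lra.
  by case: (leP (- (d1 / 2)) (coord1 hn x - y)) => h2; [apply: (lowest_le sol); move: h2 yr dd1; clear; lra|exact: (solution_ge0 sol)].
have [lam] := @infconv_contact R n hn s p f Omega u s01 cf p0 sol OmegaE B rho x0 t0 sig d (a + h) psi
  sig0 sigd d_1 (ltW B0) y2 (measurable_step3 _ _ _ _) mono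
  (fun v : R => step3_bound _ _ v L10 L1ah) hpsi hx0.
rewrite -/y -/d0 -/I; set m0' := I - B * d0 ^+ 2.
have b0 : 0 <= 2 * B * d0 by rewrite mulr_ge0// mulr_ge0// ltW.
have bd : 2 * B * d0 <= 2 * B * d by apply: ler_wpM2l; [rewrite mulr_ge0// ltW|exact: ltW].
have bW : (2 * B * d0 + B + 1) * sig <= m.
  by apply: le_trans sigW; rewrite ler_wpM2r ?(ltW sig0)// /W; move: bd; clear; lra.
have bW' : (2 * B * d0 + 1) * sig <= tau.
  apply: le_trans mtau; apply: le_trans bW; rewrite ler_wpM2r ?(ltW sig0)//; move: B0; clear; lra.
have m0a : m0' <= a.
  have : 0 <= B * d0 ^+ 2 by rewrite mulr_ge0 ?sqr_ge0// ltW.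
  by rewrite /m0'; move: Ia; clear; lra.
have m0l : - 1 <= m0' by rewrite /m0'; move: hx0 u0 sig2 sig1; clear; lra.
move=> /(le_trans)/(_ bW) /le_trans/(_ m1); rewrite ler_norml => /andP[lam1 lam2] main.
have : `|f lam| <= G by apply: hG; move: lam1 lam2 m0a m0l a0; clear; move=> *; apply/andP; split; lra.
rewrite ler_norml => /andP[hf _].
have xp : 0 <= (y - sig) * (m0' + (2 * B * d0 + 1) * sig) `^ p.
  by rewrite mulr_ge0 ?powR_ge0//; move: y2 sig0; clear; lra.
pose g z := psi (coord1 hn z - sig) - m0' - (2 * B * d0 + 1) * sig.
have ig : (lebesgue_rV R n).-integrable [set z | d < enorm z] (EFin \o (fun z => g z * kern s z)).
  apply: (@integrable_bounded_kern R n s s01 _ ((a + h) + (a + 1) + tau)) => //.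
    apply: measurable_funB => //; apply: measurable_funB => //.
    apply: (measurableT_comp (measurable_step3 _ _ _ _)); apply: measurable_funB => //.
    exact: measurable_coordR.
  move=> z; apply: le_trans (ler_normB _ _) _; apply: lerD.
    apply: le_trans (ler_normB _ _) _; apply: lerD; first exact: step3_bound.
    by rewrite ler_norml; move: m0a m0l a0; clear; move=> *; apply/andP; split; lra.
  by rewrite ger0_norm// mulr_ge0 ?(ltW sig0)//; move: b0; clear; lra.
have hg z : d < enorm z -> h * \1_[set z | 3 * d < coord1 hn z] z - 2 * tau -
    a * \1_[set z | d1 / 4 < enorm z] z <= g z.
  move=> _; rewrite !indicE /g /psi /step3.
  have A1 : 0 <= a * (z \in [set z | d1 / 4 < enorm z])%:R by rewrite mulr_ge0.
  case: (boolP (z \in [set z | 3 * d < coord1 hn z])) => [|hz].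
    rewrite inE /= => h3; have -> : 2 * d <= coord1 hn z - sig by move: h3 sigd; clear; lra.
    by rewrite mulr1; move: A1 bW' m0a tau0; clear; lra.
  rewrite mulr0; case: ifP => _; first by move: A1 bW' m0a tau0 h0; clear; lra.
  case: (leP (- (d1 / 2)) (coord1 hn z - sig)) => h4.
    by move: A1 bW' m0a tau0 ad1; clear; lra.
  rewrite mem_set ?mulr1 /=; first by move: bW' m0a tau0; clear; lra.
  have := coord_le_enorm z i1; rewrite ler_norml -/(coord1 hn z) => /andP[h5 _].
  by move: h5 h4 sigd dd1; clear; lra.
have := step_integral_ge s01 d_gt0 dd1 ig hg; rewrite -/ctt => hI.
have E0 : 0 < d `^ (2 * s) by rewrite powR_gt0.
have dn0 : d != 0 by rewrite gt_eqF.
have E1 : d `^ (2 * s) * d `^ (- (2 * s)) = 1.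
  by rewrite -powRD ?dn0 ?implybT// subrr powRr0.
have E2 : d `^ (2 * s) * (3 * d) `^ (- (2 * s)) = 3 `^ (- (2 * s)).
  by rewrite powRM ?(ltW d_gt0)// mulrCA E1 mulr1.
have E3 : d `^ (2 * s) * d `^ (2 - 2 * s) = d ^+ 2.
  by rewrite -powRD ?dn0 ?implybT// addrC subrK powR_mulrn// ltW.
move: main; rewrite -/cmm -/(g _).
set J := \int[lebesgue_rV R n]_(z in _) _.
have -> : J = \int[lebesgue_rV R n]_(z in [set z | d < enorm z]) (g z * kern s z) by [].
set J' := \int[lebesgue_rV R n]_(z in _) _ in hI *.
rewrite -/k0 => main.
have : k0 * (J' - (B + 1) * (d `^ (2 - 2 * s) * cmm)) <= G + 1.
  by move: main hf xp sig1; clear; lra.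
rewrite mulrC -ler_pdivlMr// => main2.
have main3 : h * ((3 * d) `^ (- (2 * s)) * rightc s i1) - 2 * tau * (d `^ (- (2 * s)) * ctt) -
    a * ((d1 / 4) `^ (- (2 * s)) * ctt) - (B + 1) * (d `^ (2 - 2 * s) * cmm) <= (G + 1) / k0.
  by move: hI main2; clear; lra.
(* Three groups of errors of at most [H3 / 4] each then dominate [H3], which is absurd. *)
have := ler_wpM2l (ltW E0) main3.
have -> : d `^ (2 * s) * (h * ((3 * d) `^ (- (2 * s)) * rightc s i1) - 2 * tau * (d `^ (- (2 * s)) * ctt) -
    a * ((d1 / 4) `^ (- (2 * s)) * ctt) - (B + 1) * (d `^ (2 - 2 * s) * cmm)) =
  h * ((d `^ (2 * s) * (3 * d) `^ (- (2 * s))) * rightc s i1) -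
  2 * tau * ((d `^ (2 * s) * d `^ (- (2 * s))) * ctt) -
  d `^ (2 * s) * (a * ((d1 / 4) `^ (- (2 * s)) * ctt)) -
  (B + 1) * ((d `^ (2 * s) * d `^ (2 - 2 * s)) * cmm) by ring.
rewrite E1 E2 E3 -/H3 mul1r.
have -> : (B + 1) * (d ^+ 2 * cmm) = 4 * tau * cmm + d ^+ 2 * cmm by rewrite -Bd; ring.
have E4 : tau * (2 * ctt + 4 * cmm) = 2 * tau * ctt + 4 * tau * cmm by ring.
rewrite E4 in tauH; move: dK; rewrite /K mulrDr => dK' fin.
by move: tauH d2cm H30 dK' fin; clear; lra.
Unshelve. all: by end_near. Qed.

(** * The capped inf-convolution and its inequality *)

Section capped.
Context (R : realType) (n : nat) (hn : (2 <= n)%N) (s p : R) (f : R -> R).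
Context (Omega : set 'rV[R]_n) (u : 'rV[R]_n -> R -> R).
Context (sol : classical_solution hn s p f Omega u).
Context (OmegaE : Omega = right_half_space hn).
Local Notation infconv := (@infconv R n hn u).
Local Notation lowest := (@lowest R n hn u).
Implicit Types (x : 'rV[R]_n) (t r : R).

Lemma infconv_ge0 (A r : R) : 0 <= A -> 0 <= infconv A r.
Proof.
move=> A0; apply: (le_infconv sol) => // x t.
by rewrite addr_ge0 ?(solution_ge0 sol)// mulr_ge0 ?sqr_ge0.
Qed.

Lemma infconv_mono (A : R) : 0 <= A -> {homo infconv A : r r' / r <= r'}.
Proof.
move=> A0 r r' rr'; apply: (le_infconv sol) => // x t.
apply: le_trans (infconv_le sol r x t A0) _; rewrite lerD2l ler_wpM2l//.
have m0 (v : R) : 0 <= Num.max v 0 by rewrite le_max lexx orbT.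
by rewrite ler_pXn2r ?nnegrE// ge_max m0 andbT le_max lerD2r rr'.
Qed.

Lemma infconv_monoA (A A' r : R) : 0 <= A -> A <= A' -> infconv A r <= infconv A' r.
Proof.
move=> A0 AA'; apply: (le_infconv sol); first exact: le_trans AA'.
move=> x t; apply: le_trans (infconv_le sol r x t A0) _.
by rewrite lerD2l ler_wpM2r ?sqr_ge0.
Qed.

Lemma infconv_le0 (A r : R) : 0 <= A -> r <= 0 -> infconv A r = 0.
Proof.
move=> A0 r0; apply/eqP; rewrite eq_le infconv_ge0// andbT.
by rewrite -(lowest_le0 sol OmegaE r0); exact: (infconv_le_lowest sol).
Qed.

Definition capped (M A r : R) := Num.min M (infconv A r).

Lemma capped_mono (M A : R) : 0 <= A -> {homo capped M A : r r' / r <= r'}.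
Proof.
move=> A0 r r' rr'; rewrite /capped le_min !ge_min lexx /=.
by rewrite (infconv_mono A0 rr') orbT.
Qed.

Lemma capped_bound (M A r : R) : 0 <= M -> 0 <= A -> 0 <= capped M A r <= M.
Proof. by move=> M0 A0; rewrite ge_min lexx le_min M0 infconv_ge0. Qed.

Lemma capped_le0 (M A r : R) : 0 <= M -> 0 <= A -> r <= 0 -> capped M A r = 0.
Proof. by move=> M0 A0 r0; rewrite /capped infconv_le0// min_r. Qed.

Lemma near_minimiser_distance (M A d : R) : 0 < A -> A * d ^+ 2 <= M + 1 -> d <= (M + 1) / A + 1.
Proof.
move=> A0 h; have hd : d ^+ 2 <= (M + 1) / A by rewrite ler_pdivlMr// mulrC.
by have := sqr_ge0 (d - 1); have := sqr_ge0 d; rewrite sqrrB; nra.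
Qed.

(** Below the cap an almost minimal point is at distance [d <= (M + 1) / A + 1]. Keeping it while
    [r] moves by [h] costs [A (2 d h + h^2)], hence the constant. *)
Lemma capped_lipschitz (M A r h : R) : 0 <= M -> 0 < A -> 0 <= h <= 1 ->
  capped M A (r + h) <= capped M A r + (2 * (M + 1) + 3 * A) * h.
Proof.
move=> M0 A0 /andP[h0 h1]; have Age0 := ltW A0.
have L0 : 0 <= 2 * (M + 1) + 3 * A by rewrite addr_ge0// mulr_ge0// addr_ge0.
have [Mr|rM] := leP M (infconv A r).
  rewrite {2}/capped min_l//; apply: (@le_trans _ _ M); first by rewrite ge_min lexx.
  by rewrite lerDl mulr_ge0.
rewrite {2}/capped min_r ?(ltW rM)// /capped ge_min; apply/orP; right.
apply/ler_addgt0Pr => e e0.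
have m0 : 0 < Num.min e 1 by rewrite lt_min e0 ltr01.
have : infconv A r < infconv A r + Num.min e 1 by rewrite ltrDl.
move=> /(infconv_lt sol Age0)[x [t]]; set d := Num.max (r - coord1 hn x) 0 => hx.
have [me m1] : Num.min e 1 <= e /\ Num.min e 1 <= 1 by rewrite !ge_min !lexx orbT.
have u0 := solution_ge0 sol x t.
have d0 : 0 <= d by rewrite le_max lexx orbT.
have dS : d <= (M + 1) / A + 1 by apply: near_minimiser_distance => //; lra.
apply: le_trans (infconv_le sol _ x t Age0) _.
have dh : Num.max (r + h - coord1 hn x) 0 <= d + h.
  rewrite ge_max addr_ge0// andbT; have : r - coord1 hn x <= d by rewrite le_max lexx.
  lra.
have : A * Num.max (r + h - coord1 hn x) 0 ^+ 2 <= A * (d + h) ^+ 2.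
  by rewrite ler_wpM2l// ler_pXn2r ?nnegrE ?le_max ?lexx ?orbT ?addr_ge0.
have : A * (d * h) <= (M + 1 + A) * h.
  have -> : M + 1 + A = A * ((M + 1) / A + 1) by field; rewrite gt_eqF.
  by rewrite -mulrA ler_wpM2l// ler_wpM2r.
have : A * h ^+ 2 <= A * h by rewrite ler_wpM2l// expr2 ler_piMr.
rewrite sqrrD; lra.
Qed.

Lemma capped_continuous (M A : R) : 0 <= M -> 0 < A -> continuous (capped M A).
Proof.
move=> M0 A0 r; apply/cvgrPdist_le => e e0.
have L0 : 0 < 2 * (M + 1) + 3 * A by rewrite addr_gt0 ?mulr_gt0// ltr_wpDl.
apply/nbhs_ballP; exists (Num.min 1 (e / (2 * (M + 1) + 3 * A))).
  by rewrite /= lt_min ltr01 divr_gt0.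
move=> r'; rewrite /ball /= lt_min => /andP[h1 h2].
have h2' : (2 * (M + 1) + 3 * A) * `|r - r'| <= e by rewrite mulrC -ler_pdivlMr// ltW.
have [rr'|r'r] := leP r r'.
  rewrite distrC ger0_norm ?subr_ge0 ?capped_mono ?(ltW A0)//.
  rewrite distrC ger0_norm ?subr_ge0// in h1 h2'.
  have hh : 0 <= r' - r <= 1 by rewrite subr_ge0 rr' ltW.
  by have := capped_lipschitz r M0 A0 hh; rewrite subrKC; lra.
rewrite ger0_norm ?subr_ge0 ?capped_mono ?(ltW A0) ?(ltW r'r)//.
rewrite gtr0_norm ?subr_gt0// in h1 h2'.
have hh : 0 <= r - r' <= 1 by rewrite subr_ge0 !ltW.
by have := capped_lipschitz r' M0 A0 hh; rewrite subrKC; lra.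
Qed.

(** A boundary point gives the value [A r^2]. Moving inwards by [q] saves about [2 A r q] and costs
    [O(q^2)], since [u] vanishes quadratically there. Almost minimal points therefore stay inside
    the domain. *)
Lemma infconv_lt_boundary (A r : R) : 0 < A -> 0 < r -> infconv A r < A * r ^+ 2.
Proof.
move=> A0 r0; have [N N0 hN] := solution_sdiff_bound sol 0 0.
have AN : 0 < A + N + 1 by rewrite -addrA ltr_wpDr// addr_ge0.
pose q := Num.min (Num.min 1 r) (A * r / (A + N + 1)).
have q0 : 0 < q by rewrite !lt_min ltr01 r0 divr_gt0// mulr_gt0.
have [q1 [qr qA]] : q <= 1 /\ q <= r /\ q <= A * r / (A + N + 1).
  by rewrite !ge_min !lexx !orbT.
have qA' : (A + N + 1) * q <= A * r by rewrite mulrC -ler_pdivlMr.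
pose e1 : 'rV[R]_n := delta_mx ord0 (Ordinal (ltnW hn)).
have ee : enorm e1 <= 1 by rewrite enorm_delta.
have eq : enorm (q *: e1) <= q by rewrite enormZ gtr0_norm// ler_piMr// ltW.
have := hN (q *: e1) (le_trans eq q1); rewrite /sdiff add0r sub0r.
have nO (x : 'rV[R]_n) : coord1 hn x <= 0 -> u x 0 = 0.
  by move=> h; rewrite (solution_eq0 sol)// OmegaE /right_half_space /=; apply/negP; rewrite -leNgt.
rewrite (nO 0) ?mulr0 ?subr0; last by rewrite /coord1 mxE.
rewrite (nO (- _)) ?addr0; last first.
  by rewrite -scaleN1r scalerA mulN1r coord1Z oppr_le0 ltW.
move=> h; have uq : u (q *: e1) 0 <= N * q ^+ 2.
  apply: le_trans (ler_norm _) _; apply: le_trans h _; rewrite ler_wpM2l//.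
  by rewrite ler_pXn2r ?nnegrE ?enorm_ge0// ltW.
apply: le_lt_trans (infconv_le sol r (q *: e1) 0 (ltW A0)) _.
rewrite coord1Z max_l ?subr_ge0//.
have : 0 < q ^+ 2 by rewrite exprn_gt0.
have : (A + N + 1) * q * q <= A * r * q by rewrite ler_wpM2r// ltW.
have : 0 < A * r * q by rewrite !mulr_gt0.
rewrite sqrrB expr2; lra.
Qed.

End capped.

(** Here [y] is the first coordinate of an almost minimal point and [e] its penalty, so [u] there is
    close to [Phi(r) - e]. The third conclusion makes [e] small once [lowest] is known to be
    continuous. *)
Lemma capped_inequality (R : realType) (n : nat) (hn : (2 <= n)%N) (s p : R) (f : R -> R)
    (Omega : set 'rV[R]_n) (u : 'rV[R]_n -> R -> R) : 0 < s < 1 -> continuous f ->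
  p < 0 -> classical_solution hn s p f Omega u -> Omega = right_half_space hn ->
  forall M A eps d r : R, 0 <= M -> 0 < A -> 0 < eps <= 1 -> 0 < d -> 0 < r ->
  infconv hn u A r < M ->
  exists y lam : R, let e := A * Num.max (r - y) 0 ^+ 2 in
  [/\ 0 < y, e <= M + 1, e <= lowest hn u r - lowest hn u y + d,
    `|lam - (capped hn u M A r - e)| <= d &
    frac_lap_const hn s *
      (\int[lebesgue_rV R n]_(z in [set z | eps < enorm z])
         ((capped hn u M A (r + coord1 hn z) - capped hn u M A r) * kern s z) -
       (A + 1) * (eps `^ (2 - 2 * s) * momentc n s)) +
    y * (M + 1) `^ p + f lam <= d].
Proof.
move=> s01 cf p0 sol OmegaE M A eps d r M0 A0 /andP[eps0 eps1] d_gt0 r0 rM.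
pose k0 := frac_lap_const hn s.
have k00 : 0 < k0 by exact: frac_lap_const_gt0.
have Age0 := ltW A0.
pose Phi := capped hn u M A.
pose I := infconv hn u A r.
have PhiI : Phi r = I by rewrite /Phi /capped min_r// ltW.
have I0 : 0 <= I by exact: (infconv_ge0 sol).
pose eta := A * r ^+ 2 - I.
have eta0 : 0 < eta by rewrite subr_gt0; exact: (infconv_lt_boundary sol OmegaE).
pose L := 2 * (M + 1) + 3 * A.
pose S := (M + 1) / A + 1.
pose c := eps `^ (- (2 * s)) * tailc n s.
have c0 : 0 <= c by rewrite mulr_ge0 ?powR_ge0 ?tailc_ge0.
have M10 : 0 < M + 1 by rewrite ltr_wpDl.
have S0 : 0 <= S by rewrite addr_ge0// divr_ge0// ltW.
have AS0 : 0 <= 2 * A * S by rewrite mulr_ge0// mulr_ge0.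
have L0 : 0 <= L by rewrite addr_ge0// mulr_ge0// ltW.
have P0 : 0 <= (M + 1) `^ p by exact: powR_ge0.
pose X := k0 * ((L + 2 * A * S + 1) * c).
have X0 : 0 <= X by rewrite mulr_ge0 ?(ltW k00)// mulr_ge0// addr_ge0// addr_ge0.
(* Sum of all coefficients with which [sig] enters as an error; [W sig <= d] absorbs them. *)
pose W := 1 + (2 * A * S + A + 1) + X + (M + 1) `^ p.
have W1 : 1 <= W.
  by move: AS0 A0 X0 P0; rewrite /W; clear; lra.
have W0 : 0 < W by apply: lt_le_trans W1.
pose m := Num.min 1 d.
have [m1 md] : m <= 1 /\ m <= d by rewrite !ge_min !lexx orbT.
have m0 : 0 < m by rewrite lt_min ltr01.
have Ar0 : 0 < 16 * (A * r) by rewrite !mulr_gt0.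
pose sig := Num.min (Num.min eps (eta / 4)) (Num.min (eta / (16 * (A * r))) (m / W)).
have sig0 : 0 < sig by rewrite !lt_min eps0 !divr_gt0.
have [sig_eps sig_eta sig_r sigW'] : [/\ sig <= eps, sig <= eta / 4, sig <= eta / (16 * (A * r)) & sig <= m / W].
  by rewrite !ge_min !lexx !orbT.
have sigr : 16 * (A * r) * sig <= eta by rewrite mulrC -ler_pdivlMr.
have sigW : W * sig <= m by rewrite mulrC -ler_pdivlMr.
have sigm : sig <= m by apply: le_trans sigW; rewrite ler_peMl// ltW.
have sig1 : sig <= 1 by exact: le_trans m1.
have sig2 : sig ^+ 2 <= sig by rewrite expr2 ler_piMr// ltW.
have : I < I + sig ^+ 2 by rewrite ltrDl exprn_gt0.
move=> /(infconv_lt sol Age0)[x0 [t0]].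
set y := coord1 hn x0; set d0 := Num.max (r - y) 0 => hx0.
have d00 : 0 <= d0 by rewrite le_max lexx orbT.
have yd0 : r - d0 <= y by rewrite lerBlDr addrC -lerBlDr le_max lexx.
have u0 := solution_ge0 sol x0 t0.
have Ad0 : A * d0 ^+ 2 <= M + 1 by move: hx0 u0 rM sig2 sig1; rewrite -/I; clear; lra.
have d0S : d0 <= S by exact: near_minimiser_distance.
(* Too close to the boundary the penalty alone would be nearly [A r^2], which exceeds the infimum by
   [eta]. *)
have y2 : 2 * sig < y.
  rewrite ltNge; apply/negP => ys.
  have : A * r ^+ 2 - 4 * (A * r) * sig <= A * d0 ^+ 2.
    have [r2|r2] := leP r (2 * sig).
      apply: (@le_trans _ _ 0); last by rewrite mulr_ge0 ?sqr_ge0.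
      have : A * r * r <= A * r * (2 * sig) by rewrite ler_wpM2l// mulr_ge0// ltW.
      have : 0 <= A * r * sig by rewrite !mulr_ge0// ltW.
      by rewrite expr2; clear; lra.
    have rd : r - 2 * sig <= d0 by move: yd0 ys; clear; lra.
    have : A * (r - 2 * sig) ^+ 2 <= A * d0 ^+ 2.
      by rewrite ler_wpM2l// ler_pXn2r ?nnegrE// subr_ge0 ltW.
    have : 0 <= A * sig ^+ 2 by rewrite mulr_ge0 ?sqr_ge0.
    by rewrite sqrrB; clear; lra.
  by move: hx0 u0 sig2 sig_eta sigr eta0; rewrite /eta; clear; lra.
have y0 : 0 < y by move: y2 sig0; clear; lra.
have Ox0 : Omega x0 by rewrite OmegaE.
have up := solution_gt0 sol t0 Ox0.
pose e := A * d0 ^+ 2.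
have e0 : 0 <= e by rewrite mulr_ge0 ?sqr_ge0.
pose psi v := Phi (r + v) - e.
have Phib v : 0 <= Phi v <= M by exact: (capped_bound sol).
have mono : {homo psi : a b / a <= b}.
  by move=> a b ab; rewrite lerD2r; apply: (capped_mono sol M Age0); rewrite lerD2l.
have cPhi : continuous Phi by exact: (capped_continuous sol).
have mPhi : measurable_fun setT Phi by exact: continuous_measurable_fun.
have mpsi : measurable_fun setT psi.
  apply: measurable_funB => //; apply: (measurableT_comp mPhi).
  exact: measurable_funD.
have psib v : `|psi v| <= M + (M + 1).
  have /andP[h1 h2] := Phib (r + v).
  by rewrite ler_norml /psi; move: h1 h2 e0 Ad0 M0; rewrite -/e; clear; move=> *; apply/andP; split; lra.
(* The inf-convolution at [r + (x_1 - y)] may be tested at [x] itself, with penalty exactly [e]: its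
   translate lies below [u] on the whole space. *)
have hpsi x t : psi (coord1 hn x - coord1 hn x0) <= u x t.
  rewrite /psi -/y lerBlDr; apply: (@le_trans _ _ (infconv hn u A (r + (coord1 hn x - y)))).
    by rewrite /Phi /capped ge_min lexx orbT.
  apply: le_trans (infconv_le sol _ x t Age0) _.
  by rewrite (_ : r + (coord1 hn x - y) - coord1 hn x = r - y)//; ring.
have [lam] := @infconv_contact R n hn s p f Omega u s01 cf p0 sol OmegaE A r x0 t0 sig eps _ psi
  sig0 sig_eps eps1 Age0 y2 mpsi mono psib hpsi hx0.
rewrite -/y -/d0 -/I -/e -/k0 => hlam main.
set b := 2 * A * d0 in hlam main.
have b0 : 0 <= b by rewrite mulr_ge0// mulr_ge0.
have bS : b <= 2 * A * S by rewrite ler_wpM2l// mulr_ge0.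
have bW : (b + A + 1) * sig <= W * sig.
  by rewrite ler_wpM2r ?(ltW sig0)//; move: bS X0 P0; rewrite /W; clear; lra.
have bsig1 : (b + 1) * sig <= 1.
  apply: le_trans m1; apply: le_trans sigW; apply: le_trans bW; rewrite ler_wpM2r ?(ltW sig0)//.
  by move: A0; clear; lra.
exists y, lam; rewrite -/d0 -/e -/Phi; split => //.
- have ly : lowest hn u y <= u x0 t0 by exact: (lowest_le sol).
  have Il : I <= lowest hn u r by exact: (infconv_le_lowest sol).
  by move: hx0 ly Il sig2 sigm md; rewrite -/e; clear; lra.
- by rewrite PhiI; apply: le_trans hlam _; apply: le_trans bW _; exact: le_trans sigW md.
pose g z := psi (coord1 hn z - sig) - (I - e) - (b + 1) * sig.
have mcoord : measurable_fun setT (fun z : 'rV[R]_n => coord1 hn z) by exact: measurable_coordR.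
have mD := @measurable_enorm_gt R n eps.
have ig : (lebesgue_rV R n).-integrable [set z | eps < enorm z] (EFin \o (fun z => g z * kern s z)).
  apply: (@integrable_bounded_kern R n s s01 _ ((M + (M + 1)) + (M + (M + 1)) + 1)) => //.
    apply: measurable_funB => //; apply: measurable_funB => //.
    by apply: (measurableT_comp mpsi); apply: measurable_funB.
  move=> z; apply: le_trans (ler_normB _ _) _; apply: lerD; last first.
    by rewrite ger0_norm// mulr_ge0 ?(ltW sig0)//; move: b0; clear; lra.
  apply: le_trans (ler_normB _ _) _; apply: lerD => //.
  by rewrite ler_norml; move: I0 e0 Ad0 rM M0; rewrite -/e -/I; clear; move=> *; apply/andP; split; lra.
have iPhi : (lebesgue_rV R n).-integrable [set z | eps < enorm z]
    (EFin \o (fun z => (Phi (r + coord1 hn z) - Phi r) * kern s z)).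
  apply: (@integrable_bounded_kern R n s s01 _ (M + M)) => //.
    apply: measurable_funB => //; apply: (measurableT_comp mPhi).
    exact: measurable_funD.
  move=> z; apply: le_trans (ler_normB _ _) _.
  have /andP[h1 h2] := Phib (r + coord1 hn z); have /andP[h3 h4] := Phib r.
  by apply: lerD; rewrite ger0_norm.
pose q := (L + 2 * A * S + 1) * sig.
have iq := integrable_kern n s01 (- q) eps0.
have key : \int[lebesgue_rV R n]_(z in [set z | eps < enorm z])
    ((Phi (r + coord1 hn z) - Phi r) * kern s z) - q * c <=
  \int[lebesgue_rV R n]_(z in [set z | eps < enorm z]) (g z * kern s z).
  rewrite -mulNr /c -(Rtail_integral n s01 _ eps0) -RintegralD//.
  apply: le_Rintegral => //; first exact: (integrableD mD iPhi iq).
  move=> z _; rewrite -mulrDl ler_wpM2r ?kern_ge0//.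
  have hs : 0 <= sig <= 1 by rewrite (ltW sig0) sig1.
  (* Undoes the shift of the profile by [sig], at cost [L sig]. *)
  have := capped_lipschitz sol (r + (coord1 hn z - sig)) M0 A0 hs.
  rewrite -addrA subrK -/Phi -/L /g /psi /q PhiI.
  have := ler_wpM2r (ltW sig0) bS.
  by rewrite !mulrDl; clear; lra.
have m0l : 0 < I - e + (b + 1) * sig.
  by move: hx0 up sig2 (mulr_ge0 b0 (ltW sig0)); rewrite -/e mulrDl; clear; lra.
have m0u : I - e + (b + 1) * sig <= M + 1 by move: rM e0 bsig1; rewrite -/I; clear; lra.
have hp := ler_powR_neg m0l m0u (ltW p0).
have hyp : (y - sig) * (M + 1) `^ p <= (y - sig) * (I - e + (b + 1) * sig) `^ p.
  by rewrite ler_wpM2l//; move: y2 sig0; clear; lra.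
have key' := ler_wpM2l (ltW k00) key.
have Xs : k0 * (q * c) = X * sig by rewrite /q /X; ring.
have Ws : sig + X * sig + (M + 1) `^ p * sig <= d.
  apply: le_trans md; apply: le_trans sigW.
  have := mulr_ge0 AS0 (ltW sig0); have := mulr_ge0 Age0 (ltW sig0).
  by move: sig0; rewrite /W !mulrDl; clear; lra.
move: main; rewrite -/(g _).
set J := \int[lebesgue_rV R n]_(z in _) _.
have -> : J = \int[lebesgue_rV R n]_(z in [set z | eps < enorm z]) (g z * kern s z) by [].
move: key' hyp Ws Xs; rewrite -/k0 !mulrBr.
clear; lra.
Qed.

(** * Antisymmetry of the nonlocal term *)

(** An open interval of length 2 contains at most two integers. *)
Lemma sum_indic_interval (R : realType) (J : nat) (x : R) :
  \sum_(k < J) ((x - 1 < k%:R) && (k%:R < x + 1))%:R <= 2%:R :> R.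
Proof.
have le1 (b : bool) : b%:R <= 1 :> R by case: b.
elim: J => [|J IH]; first by rewrite big_ord0.
rewrite big_ord_recr /=; case: (boolP (_ && _)) => [/andP[h1 h2]|_]; last by rewrite addr0.
case: J IH h1 h2 => [|J] _ h1 h2; first by rewrite big_ord0 add0r ler1n.
rewrite big_ord_recr /= big1 ?add0r; first by have := le1 ((x - 1 < J%:R) && (J%:R < x + 1)); rewrite -natr1; lra.
move=> i _; rewrite (_ : x - 1 < i%:R = false)//; apply/negbTE; rewrite -leNgt.
have : i%:R + 1 <= J%:R :> R by rewrite natr1 ler_nat.
by move: h2; rewrite -natr1; lra.
Qed.

Section staircase.
Context (R : realType) (Phi : R -> R) (M h delta : R).
Context (Phi_mono : {homo Phi : x y / x <= y}) (PhiM : forall x, 0 <= Phi x <= M).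
Context (h0 : 0 < h) (Phih : Phi h <= delta).
Context (Phi_delta : forall x, Phi (x + h) - Phi x <= delta).

(** The grid starts at [h], not at 0, since the inequality for the capped function holds at positive
    [r] only. *)
Definition grid (j : nat) : R := j.+1%:R * h.
Definition jump (j : nat) : R := Phi (grid j.+1) - Phi (grid j).

Let gridS j : grid j.+1 = grid j + h.
Proof. by rewrite /grid -[j.+2%:R]natr1 mulrDl mul1r. Qed.

Let grid_mono i j : (i <= j)%N -> grid i <= grid j.
Proof. by move=> ij; rewrite ler_wpM2r ?(ltW h0)// ler_nat. Qed.

Lemma jump_ge0 j : 0 <= jump j.
Proof. by rewrite subr_ge0; apply: Phi_mono; exact: grid_mono. Qed.

Lemma sum_jump J : \sum_(j < J) jump j = Phi (grid J) - Phi (grid 0).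
Proof.
elim: J => [|J IH]; first by rewrite big_ord0 subrr.
by rewrite big_ord_recr /= IH /jump addrC addrA subrK.
Qed.

Let Phi_ge_steps J (x : R) : \sum_(k < J) jump k * (grid k.+1 <= x)%R%:R <= Phi x.
Proof.
elim: J => [|J IH]; first by rewrite big_ord0; case/andP: (PhiM x).
rewrite big_ord_recr /=; case: (leP (grid J.+1) x) => hx; last by rewrite mulr0 addr0.
rewrite mulr1; have -> : \sum_(k < J) jump k * (grid k.+1 <= x)%R%:R = \sum_(k < J) jump k.
  apply: eq_bigr => i _; rewrite (le_trans _ hx) ?mulr1//; apply: grid_mono.
  by rewrite ltnS ltnW.
rewrite sum_jump /jump; have := Phi_mono hx; have /andP[] := PhiM (grid 0); lra.
Qed.

Definition stair_sum J (z : R) := \sum_(j < J) jump j * (Phi (grid j + z) - Phi (grid j)).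

(** Discrete form of: for a continuous measure [dPhi], almost every pair [(a, b)] satisfies
    [b < a + z] or [a < b - z]. The first event belongs to [z], the second to [-z] with the roles
    exchanged, so the two double sums cover all pairs and give about [S^2], which cancels
    [2 \int Phi dPhi]. *)
Lemma stair_sum_ge J (z : R) : - (4 * M * delta) <= stair_sum J z + stair_sum J (- z).
Proof.
have M0 : 0 <= M by have /andP[] := PhiM 0; exact: le_trans.
have delta0 : 0 <= delta by apply: le_trans Phih; have /andP[] := PhiM h.
pose a (w : R) (j k : nat) : R := (grid k.+1 <= grid j + w)%R%:R.
have lower w : \sum_(j < J) \sum_(k < J) jump j * jump k * a w j k - \sum_(j < J) jump j * Phi (grid j) <=
    stair_sum J w.
  rewrite /stair_sum -sumrB; apply: ler_sum => j _; rewrite mulrBr lerD2r.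
  rewrite (eq_bigr (fun k : 'I_J => jump j * (jump k * a w j k))); last by move=> k _; rewrite mulrA.
  by rewrite -mulr_sumr ler_wpM2l ?jump_ge0// Phi_ge_steps.
set S := \sum_(j < J) jump j.
have SE : S = Phi (grid J) - Phi (grid 0) by exact: sum_jump.
have /andP[p0 p1] := PhiM (grid J); have /andP[p2 _] := PhiM (grid 0).
have p3 : Phi (grid 0) <= delta by rewrite /grid mul1r.
have p4 : Phi (grid 0) <= Phi (grid J) by apply/Phi_mono/grid_mono.
have S0 : 0 <= S by rewrite SE subr_ge0.
have SM : S <= M by rewrite SE; lra.
(* Termwise [2 a (b - a) <= b^2 - a^2], then telescoping. *)
have energy : 2 * \sum_(j < J) jump j * Phi (grid j) <= Phi (grid J) ^+ 2 - Phi (grid 0) ^+ 2.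
  rewrite mulr_sumr; elim: {+}J => [|K IH]; first by rewrite big_ord0 subrr.
  rewrite big_ord_recr /=; have := sqr_ge0 (jump K).
  by rewrite /jump; move: IH; rewrite sqrrB !expr2; lra.
have pairs : \sum_(j < J) \sum_(k < J) jump j * jump k * a z j k +
    \sum_(j < J) \sum_(k < J) jump j * jump k * a (- z) j k >= S ^+ 2 - 2 * delta * S.
  rewrite [X in _ <= _ + X]exchange_big /= -big_split /=.
  have -> : S ^+ 2 - 2 * delta * S = \sum_(j < J) (jump j * S - jump j * (2 * delta)).
    by rewrite sumrB -!mulr_suml expr2 -/S; ring.
  apply: ler_sum => j _; rewrite -big_split /=.
  (* Both events fail only if [|k - x| < 1], that is for at most two [k], each of weight at most
     [delta]. *)
  pose x := j%:R + z / h.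
  have ab (k : 'I_J) : jump j * jump k * (1 - ((x - 1 < k%:R) && (k%:R < x + 1))%:R) <=
      jump j * jump k * a z j k + jump k * jump j * a (- z) k j.
    rewrite (mulrC (jump k)) -mulrDr ler_wpM2l ?mulr_ge0 ?jump_ge0// /a.
    have zE : z = z / h * h by rewrite divfK// gt_eqF.
    case: (leP (grid k.+1) (grid j + z)) => h1; case: (leP (grid j.+1) (grid k - z)) => h2 /=;
      case: (_ && _) / boolP => hx /=; rewrite ?subr0 ?subrr ?addr0 ?add0r; try lra.
    exfalso; move/negP: hx; apply; apply/andP; split.
      rewrite -(ltr_pM2r h0) /x mulrBl mulrDl -zE mul1r.
      by move: h1; rewrite /grid -!natr1 !mulrDl; lra.
    rewrite -(ltr_pM2r h0) /x !mulrDl -zE mul1r.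
    by move: h2; rewrite /grid -!natr1 !mulrDl; lra.
  apply: (@le_trans _ _ (\sum_(k < J) jump j * jump k * (1 - ((x - 1 < k%:R) && (k%:R < x + 1))%:R))); last first.
    by apply: ler_sum => k _; exact: ab.
  rewrite -mulrBr (eq_bigr (fun k : 'I_J => jump j * (jump k * (1 - ((x - 1 < k%:R) && (k%:R < x + 1))%:R)))); last first.
    by move=> k _; rewrite mulrA.
  rewrite -mulr_sumr ler_wpM2l ?jump_ge0//.
  rewrite (eq_bigr (fun k : 'I_J => jump k - jump k * ((x - 1 < k%:R) && (k%:R < x + 1))%:R)); last first.
    by move=> k _; rewrite mulrBr mulr1.
  rewrite sumrB -/S lerD2l lerN2.
  apply: (@le_trans _ _ (\sum_(k < J) delta * ((x - 1 < k%:R) && (k%:R < x + 1))%:R)).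
    apply: ler_sum => k _; rewrite ler_wpM2r//.
    by rewrite /jump gridS.
  by rewrite -mulr_sumr mulrC ler_wpM2r// sum_indic_interval.
have := lower z; have := lower (- z).
have : Phi (grid J) ^+ 2 - Phi (grid 0) ^+ 2 - S ^+ 2 <= 2 * (M * delta).
  rewrite SE (_ : _ - _ = 2 * ((Phi (grid J) - Phi (grid 0)) * Phi (grid 0))); last by ring.
  by rewrite ler_wpM2l// ler_pM// ?subr_ge0//; lra.
have : delta * S <= M * delta by rewrite mulrC ler_wpM2r.
move: pairs energy.
move: (\sum_(j < J) \sum_(k < J) _) (\sum_(j < J) \sum_(k < J) _) (\sum_(j < J) jump j * Phi (grid j)) => X1 X2 X3; lra.
Qed.

End staircase.

(** * Integrated form of the nonlocal term and of the nonlinearity *)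

Lemma uniform_on_segment (R : realType) (g : R -> R) (a b e : R) : continuous g -> 0 < e ->
  exists2 eta : R, 0 < eta & forall x y, a <= x <= b -> `|x - y| <= eta -> `|g x - g y| <= e.
Proof.
move=> cg e0.
have := @segment_compact R a b => /compact_near_coveringP.
move=> /(_ _ (0 : R)^'+ (fun eta x => forall y, `|x - y| <= eta -> `|g x - g y| <= e) _) H.
have : \forall eta \near (0 : R)^'+, `[a, b]%classic `<=`
    (fun x => forall y, `|x - y| <= eta -> `|g x - g y| <= e).
  apply: H => x _; have e20 : 0 < e / 2 by rewrite divr_gt0.
  have /cvgrPdist_lt/(_ _ e20)/nbhs_ballP[d /= d0 hd] := cg x.
  have d20 : 0 < d / 2 by rewrite divr_gt0.
  exists ([set x' | `|x - x'| < d / 2], [set eta | eta <= d / 2 - `|x - x| - 0]).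
    split => /=.
      by apply/nbhs_ballP; exists (d / 2).
    by rewrite subrr normr0 !subr0; exact: nbhs_right_le.
  move=> [x' eta] [/= h1]; rewrite subrr normr0 !subr0 => h2 y h3.
  have b1 : ball x d x' by rewrite /ball /=; lra.
  have b2 : ball x d y.
    rewrite /ball /=; have -> : x - y = (x - x') + (x' - y) by rewrite addrA subrK.
    by apply: le_lt_trans (ler_normD _ _) _; lra.
  have := hd x' b1; have := hd y b2 => g2 g1.
  have -> : g x' - g y = (g x - g y) - (g x - g x') by ring.
  by apply: le_trans (ler_normB _ _) _; lra.
move=> near_eta; near (0 : R)^'+ => eta; exists eta; first by near: eta; exact: nbhs_right_gt.
move=> x y xab; have : `[a, b]%classic `<=` (fun x => forall y, `|x - y| <= eta -> `|g x - g y| <= e).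
  by near: eta.
by apply; rewrite /= in_itv.
Unshelve. all: by end_near. Qed.

Section abs_primitive.
Context (R : realType) (f : R -> R).
Local Notation mu := (@lebesgue_measure R).
Context (fi : mu.-integrable setT (EFin \o f)).

Definition abs_primitive (v : R) : R := \int[mu]_(x in `]-oo, v]) `|f x|.

Let absi (D : set (measurableTypeR R)) : measurable D -> mu.-integrable D (EFin \o (fun x => `|f x|)).
Proof.
move=> mD; have := integrableS measurableT mD (@subsetT _ D) (integrable_abse fi).
exact: eq_integrable.
Qed.

Lemma abs_primitive_bound v : 0 <= abs_primitive v <= \int[mu]_x `|f x|.
Proof.
apply/andP; split.
  by apply: fine_ge0; apply: integral_ge0 => x _; rewrite lee_fin.
have i1 := absi measurableT; have mv : measurable (`]-oo, v] : set (measurableTypeR R)) by [].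
rewrite /abs_primitive /Rintegral fine_le//.
- exact: integrable_fin_num (absi mv).
- exact: integrable_fin_num.
- apply: ge0_subset_integral => //; first exact: (measurable_int _ i1).
Qed.

(** Converts a Riemann sum of [|f|] over the levels of [Phi] into a telescoping sum, bounded by the
    integral of [|f|] whatever [M] is. *)
Lemma abs_primitive_diff a b (m : R) : a <= b -> (forall v, a <= v <= b -> m <= `|f v|) ->
  (b - a) * m <= abs_primitive b - abs_primitive a.
Proof.
move=> ab hm.
have ma : measurable (`]-oo, a] : set (measurableTypeR R)) by [].
have mab : measurable (`]a, b] : set (measurableTypeR R)) by [].
have E : `]-oo, b]%classic = `]-oo, a] `|` `]a, b]%classic.
  apply/seteqP; split => x /=; rewrite !in_itv /=.
    by move=> xb; case: (leP x a) => h; [left|right; rewrite xb].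
  by move=> [h|/andP[]//]; exact: le_trans ab.
have -> : abs_primitive b = abs_primitive a + \int[mu]_(x in `]a, b]) `|f x|.
  rewrite /abs_primitive E Rintegral_setU//.
    by apply: absi; exact: measurableU.
  apply/disj_setPS => x /= []; rewrite !in_itv /= => h1 /andP[h2 _].
  by move: h2; rewrite ltNge h1.
rewrite [abs_primitive a + _]addrC addrK.
have muE : mu (`]a, b]%classic : set (measurableTypeR R)) = (b - a)%:E.
  rewrite lebesgue_measure_itv /= lte_fin; case: (ltP a b) => h; first by rewrite -EFinB.
  by have -> : a = b by [apply/eqP; rewrite eq_le ab]; rewrite subrr.
have -> : (b - a) * m = \int[mu]_(x in `]a, b]) m.
  by rewrite Rintegral_cst// [X in fine X]muE mulrC.
apply: le_Rintegral => //.
- apply/integrableP; split; first exact: measurable_cst.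
  by rewrite integral_cst// [X in (_ * X)%E]muE -EFinM ltry.
- exact: absi.
- move=> x /=; rewrite in_itv /= => /andP[h1 h2]; apply: hm.
  by rewrite h2 ltW.
Qed.

End abs_primitive.

Section stair_integral.
Context (R : realType) (n : nat) (hn : (2 <= n)%N) (s : R) (s01 : 0 < s < 1).
Context (Phi : R -> R) (M h delta : R).
Context (Phi_mono : {homo Phi : x y / x <= y}) (PhiM : forall x, 0 <= Phi x <= M).
Context (h0 : 0 < h) (Phih : Phi h <= delta).
Context (Phi_delta : forall x, Phi (x + h) - Phi x <= delta).
Context (cPhi : continuous Phi).
Local Notation mu := (lebesgue_rV R n).
Local Notation kern := (@kern R n s).

Let measurable_increment (a : R) :
  measurable_fun setT (fun z : 'rV[R]_n => Phi (a + coord1 hn z) - Phi a).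
Proof.
have mcoord : measurable_fun setT (fun z : 'rV[R]_n => coord1 hn z) by exact: measurable_coordR.
apply: measurable_funB => //; apply: (measurableT_comp (continuous_measurable_fun cPhi)).
exact: measurable_funD.
Qed.

Let increment_bound a b : `|Phi a - Phi b| <= M.
Proof.
have /andP[h1 h2] := PhiM a; have /andP[h3 h4] := PhiM b.
by rewrite ler_norml; apply/andP; split; lra.
Qed.

Let T J (z : 'rV[R]_n) := stair_sum Phi h J (coord1 hn z).

Let T_bound J : exists C : R, forall z, `|T J z| <= C.
Proof.
elim: J => [|J [C hC]]; first by exists 0 => z; rewrite /T /stair_sum big_ord0 normr0.
exists (C + `|jump Phi h J| * M) => z; rewrite /T /stair_sum big_ord_recr /=.
apply: le_trans (ler_normD _ _) _; apply: lerD; first exact: hC.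
by rewrite normrM ler_wpM2l.
Qed.

Let measurable_T J : measurable_fun setT (T J).
Proof.
elim: J => [|J IH].
  rewrite (_ : T 0 = cst 0); first exact: measurable_cst.
  by apply/funext => z; rewrite /T /stair_sum big_ord0.
rewrite (_ : T J.+1 = (fun z => T J z + jump Phi h J * (Phi (grid h J + coord1 hn z) - Phi (grid h J)))).
  by apply: measurable_funD => //; apply: measurable_funM.
by apply/funext => z; rewrite /T /stair_sum big_ord_recr.
Qed.

(** The kernel is even, so the integrand may be replaced by the mean of its values at [z] and [-z],
    bounded below by [stair_sum_ge]. *)
Lemma stair_integral J (e : R) : 0 < e ->
  - (2 * M * delta * (e `^ (- (2 * s)) * tailc n s)) <=
  \sum_(j < J) jump Phi h j * \int[mu]_(z in [set z | e < enorm z])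
     ((Phi (grid h j + coord1 hn z) - Phi (grid h j)) * kern z).
Proof.
move=> e0; have mD := @measurable_enorm_gt R n e.
have iT K : mu.-integrable [set z | e < enorm z] (EFin \o (fun z => T K z * kern z)).
  have [C hC] := T_bound K.
  exact: (integrable_bounded_kern s01 e0 (measurable_T K) hC).
have iP a : mu.-integrable [set z | e < enorm z]
    (EFin \o (fun z => (Phi (a + coord1 hn z) - Phi a) * kern z)).
  apply: (integrable_bounded_kern s01 e0 (measurable_increment a) (M := M)) => z.
  exact: increment_bound.
have -> : \sum_(j < J) jump Phi h j * \int[mu]_(z in [set z | e < enorm z])
     ((Phi (grid h j + coord1 hn z) - Phi (grid h j)) * kern z) =
  \int[mu]_(z in [set z | e < enorm z]) (T J z * kern z).
  elim: J => [|J IH].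
    rewrite big_ord0 (_ : (fun z => T 0 z * kern z) = (fun=> 0)); first by rewrite Rintegral_cst ?mul0r.
    by apply/funext => z; rewrite /T /stair_sum big_ord0 mul0r.
  rewrite big_ord_recr /= IH -(RintegralZl _ mD (iP _)).
  have iZ := integrableZl_EFin (jump Phi h J) mD (iP (grid h J)).
  rewrite -RintegralD//; apply: eq_Rintegral => z _.
  have -> : T J.+1 z = T J z + jump Phi h J * (Phi (grid h J + coord1 hn z) - Phi (grid h J)).
    by rewrite /T /stair_sum big_ord_recr.
  by ring.
pose T' z := T J (- z).
have NA : (fun z => -1 *: z + 0) @^-1` [set z : 'rV[R]_n | e < enorm z] = [set z | e < enorm z].
  by apply/seteqP; split => z; rewrite /= scaleN1r addr0 enormN.
pose F z := T J z * kern z; pose F' z := T' z * kern z.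
have FF' : (fun z => (EFin \o F) (-1 *: z + 0)) = EFin \o F'.
  by apply/funext => z; rewrite /F /F' /T' /= scaleN1r addr0 kernN.
have iF' : mu.-integrable [set z | e < enorm z] (EFin \o F').
  by have := integrable_rV_isometry 0 (normrN1 R) mD (iT J); rewrite NA FF'.
have E : \int[mu]_(z in [set z | e < enorm z]) F z = \int[mu]_(z in [set z | e < enorm z]) F' z.
  rewrite /Rintegral.
  by rewrite (integral_rV_isometry 0 (normrN1 R) mD (measurable_int _ (iT J))) NA FF'.
have key : - (4 * M * delta) * (e `^ (- (2 * s)) * tailc n s) <=
    \int[mu]_(z in [set z | e < enorm z]) F z + \int[mu]_(z in [set z | e < enorm z]) F' z.
  rewrite -(Rtail_integral n s01 _ e0) -(RintegralD mD (iT J) iF').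
  apply: le_Rintegral; [exact: mD|exact: integrable_kern|exact: (integrableD mD (iT J) iF')|].
  move=> z _; rewrite /F /F' -mulrDl ler_wpM2r ?kern_ge0//.
  have -> : T' z = stair_sum Phi h J (- coord1 hn z) by rewrite /T' /T /coord1 mxE.
  exact: stair_sum_ge.
rewrite -E in key; rewrite -/(F _).
have -> : \int[mu]_(z in [set z | e < enorm z]) (T J z * kern z) = \int[mu]_(z in [set z | e < enorm z]) F z by [].
by move: key; move: (\int[mu]_(z in _) _) (e `^ _ * _) => X Y; rewrite !mulNr -!mulrA; move: (M * (delta * Y)) => Z; lra.
Qed.

End stair_integral.

(** * Continuity and growth in the half-space *)

Section half_space_facts.
Context (R : realType) (n : nat) (hn : (2 <= n)%N) (s p : R) (f : R -> R).
Context (Omega : set 'rV[R]_n) (u : 'rV[R]_n -> R -> R).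
Context (s01 : 0 < s < 1) (cf : continuous f) (p0 : p < 0).
Context (sol : classical_solution hn s p f Omega u).
Context (OmegaE : Omega = right_half_space hn).
Local Notation lowest := (@lowest R n hn u).
Local Notation infconv := (@infconv R n hn u).

Lemma lowest_continuous : continuous lowest.
Proof.
move=> r; apply/cvgrPdist_le => e e0.
have [d1 d10 h1] := lowest_right sol r e0.
have [d2 d20 h2] := lowest_left s01 cf p0 sol OmegaE r e0.
apply/nbhs_ballP; exists (Num.min d1 d2); first by rewrite /= lt_min d10.
move=> r'; rewrite /ball /= lt_min !ltr_norml => /andP[/andP[a1 a2] /andP[a3 a4]].
have m1 : lowest r' <= lowest (r + d1) by apply: (lowest_mono sol); lra.
have m2 : lowest (r - d2) <= lowest r' by apply: (lowest_mono sol); lra.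
by rewrite ler_norml; apply/andP; split; lra.
Qed.

(** If the inf-convolution stayed below [M], the term [y (M + 1)^p] would be unbounded as [r] grows,
    while all other terms of the inequality remain bounded. *)
Lemma infconv_reaches (M : R) : 0 <= M -> exists2 r : R, 0 < r & M <= infconv 1 r.
Proof.
move=> M0; apply: contrapT => no.
have lt r : 0 < r -> infconv 1 r < M.
  by move=> r0; rewrite ltNge; apply/negP => h; apply: no; exists r.
have k00 := frac_lap_const_gt0 hn s01.
have [G G0 hG] := f_bounded cf (M + 2).
have P0 : 0 < (M + 1) `^ p by rewrite powR_gt0// ltr_wpDl.
pose X := frac_lap_const hn s * (M * (1 `^ (- (2 * s)) * tailc n s) +
  (1 + 1) * (1 `^ (2 - 2 * s) * momentc n s)).
have X0 : 0 <= X.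
  rewrite mulr_ge0 ?(ltW k00)// addr_ge0// mulr_ge0//.
    by rewrite mulr_ge0 ?powR_ge0 ?tailc_ge0.
  by rewrite mulr_ge0 ?powR_ge0 ?momentc_ge0.
pose Z := (1 + G + X) / (M + 1) `^ p.
have Z0 : 0 <= Z by rewrite divr_ge0 ?(ltW P0)// !addr_ge0.
(* A penalty of at most [M + 1] keeps the contact within [M + 2] of [r], so [y >= 1 + Z], and
   [Z (M + 1)^p] already equals the sum of the bounds. *)
pose r := M + 3 + Z.
have M0' := M0.
have r0 : 0 < r by rewrite /r; lra.
have e01 : 0 < (1 : R) <= 1 by rewrite ltr01 lexx.
have := capped_inequality s01 cf p0 sol OmegaE M0 ltr01 e01 ltr01 r0 (lt r r0).
move=> [y [lam]] /=; rewrite mul1r.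
set d := Num.max (r - y) 0; move=> [y0 dM _ hlam].
set I := \int[_]_(z in _) _ => main.
have d0 : 0 <= d by rewrite le_max lexx orbT.
have dM' : d <= M + 2 by have := sqr_ge0 (d - 1); rewrite sqrrB; lra.
have ryd : r - y <= d by rewrite le_max lexx.
have yr : 1 + Z <= y by rewrite /r in ryd; lra.
have /andP[c1 c2] := capped_bound sol r M0 ler01.
have : `|f lam| <= G.
  by apply: hG; move: hlam; rewrite ler_norml => /andP[h1 h2]; have := sqr_ge0 d; move=> h3; apply/andP; split; lra.
rewrite ler_norml => /andP[hf _].
have I0 : - (M * (1 `^ (- (2 * s)) * tailc n s)) <= I.
  rewrite -mulNr -(Rtail_integral n s01 _ ltr01).
  have mD := @measurable_enorm_gt R n 1.
  have cPhi := capped_continuous sol M0 ltr01.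
  apply: le_Rintegral => //.
  - exact: integrable_kern.
  - apply: (@integrable_bounded_kern R n s s01 _ (M + M)) => //.
      have mcoord : measurable_fun setT (fun z : 'rV[R]_n => coord1 hn z) by exact: measurable_coordR.
      apply: measurable_funB => //; apply: (measurableT_comp (continuous_measurable_fun cPhi)).
      exact: measurable_funD.
    move=> z; apply: le_trans (ler_normB _ _) _.
    have /andP[b1 b2] := capped_bound sol (r + coord1 hn z) M0 ler01.
    by apply: lerD; rewrite ger0_norm.
  - move=> z _; rewrite ler_wpM2r ?kern_ge0//.
    by have /andP[b1 b2] := capped_bound sol (r + coord1 hn z) M0 ler01; lra.
have hk := ler_wpM2l (ltW k00) I0.
have yP : (1 + Z) * (M + 1) `^ p <= y * (M + 1) `^ p by rewrite ler_wpM2r// ltW.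
have ZP : Z * (M + 1) `^ p = 1 + G + X by rewrite /Z divfK// gt_eqF.
rewrite mulrDl mul1r ZP /X in yP.
have P0' := P0; lra.
Qed.

End half_space_facts.

(** * Nonexistence *)

(** Jumps starting at levels below 1 reach at most level [1 + delta]. *)
Lemma sum_jump_above (R : realType) (Phi : R -> R) (h delta : R) (J : nat) :
  {homo Phi : x y / x <= y} -> 0 < h -> Phi h <= delta ->
  (forall x, Phi (x + h) - Phi x <= delta) ->
  Phi (grid h J) - 1 - delta <=
  \sum_(j < J) jump Phi h j * (1 <= Phi (grid h j))%R%:R.
Proof.
move=> mono h0 Phih dl; elim: J => [|J IH].
  by rewrite big_ord0 /grid mul1r; lra.
rewrite big_ord_recr /=; case: (leP 1 (Phi (grid h J))) => h1.
  by rewrite mulr1 /jump; lra.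
rewrite mulr0 addr0; apply: (@le_trans _ _ 0).
  have := dl (grid h J); rewrite (_ : grid h J + h = grid h J.+1); first lra.
  by rewrite /grid -[J.+2%:R]natr1 mulrDl mul1r.
by apply: sumr_ge0 => j _; rewrite mulr_ge0 ?jump_ge0.
Qed.

(** With [X = M + 1 >= 6] one has [X - 3 >= X / 2], so the product is at least [P0 X^(p+1) / 2]. *)
Lemma power_beats (R : realType) (p P0 F : R) : -1 < p -> 0 < P0 ->
  exists2 M : R, 3 <= M & F < P0 * (M + 1) `^ p * (M - 2).
Proof.
move=> p1 P00; pose Y := 2 * (`|F| + 1) / P0.
have Y0 : 0 < Y by rewrite divr_gt0// mulr_gt0// ltr_wpDl.
have p10 : 0 < p + 1 by lra.
pose X := Num.max 6 (Y `^ (p + 1)^-1).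
have X6 : 6 <= X by rewrite le_max lexx.
have X0 : 0 < X by lra.
have XY : Y <= X `^ (p + 1).
  have -> : Y = (Y `^ (p + 1)^-1) `^ (p + 1).
    by rewrite -powRrM mulVf ?gt_eqF// powRr1// ltW.
  rewrite ge0_ler_powR ?nnegrE ?powR_ge0 ?(ltW p10) ?(ltW X0)//.
  by rewrite le_max lexx orbT.
exists (X - 1); first lra.
rewrite subrK (_ : X - 1 - 2 = X - 3); last by ring.
have Xp : 0 < X `^ p by rewrite powR_gt0.
have XpX : X `^ (p + 1) = X `^ p * X.
  by rewrite powRD ?powRr1 ?(ltW X0)// gt_eqF ?implybT// (gt_eqF X0).
have h1 : `|F| + 1 <= P0 * (X `^ p * X) / 2.
  rewrite -XpX; have -> : `|F| + 1 = P0 * Y / 2 by rewrite /Y; field; rewrite gt_eqF.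
  by rewrite ler_wpM2r// ler_wpM2l// ltW.
have h2 : P0 * (X `^ p * X) / 2 <= P0 * X `^ p * (X - 3).
  rewrite -!mulrA ler_wpM2l ?(ltW P00)// ler_wpM2l ?(ltW Xp)//; lra.
by have := ler_norm F; lra.
Qed.

Lemma no_solution_half_space (R : realType) (n : nat) (hn : (2 <= n)%N) (s p : R) (f : R -> R)
    (Omega : set 'rV[R]_n) (u : 'rV[R]_n -> R -> R) : 0 < s < 1 -> continuous f ->
  lebesgue_measure.-integrable [set: R] (EFin \o f) -> -1 < p -> p < 0 ->
  classical_solution hn s p f Omega u -> Omega = right_half_space hn -> False.
Proof.
move=> s01 cf fi p1 p0 sol OmegaE.
pose V := lowest hn u; pose k0 := frac_lap_const hn s.
have k00 : 0 < k0 by exact: frac_lap_const_gt0.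
have cV : continuous V := @lowest_continuous R n hn s p f Omega u s01 cf p0 sol OmegaE.
have Vmono : {homo V : a b / a <= b} by move=> a b; exact: (lowest_mono sol).
(* Wherever [Phi >= 1] the argument exceeds [rho], so the weight [x_1] at the contact point is at
   least [rho / 2], independently of [M]. *)
have [rho rho0 hrho] : exists2 rho : R, 0 < rho & V rho < 1.
  have half : 0 < (2^-1 : R) by [].
  have [e e0] := lowest_right sol 0 half; rewrite add0r (lowest_le0 sol OmegaE (lexx 0)) add0r => h.
  by exists e => //; apply: le_lt_trans h _; lra.
pose F := \int[lebesgue_measure]_x `|f x|.
have F0 : 0 <= F by have /andP[h1 h2] := abs_primitive_bound fi 0; exact: le_trans h2.
have rho20 : 0 < rho / 2 by rewrite divr_gt0.
(* Of the 4, three come from three errors of [1 / M] per unit of [Phi], which increases by at most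
   [M]; the fourth is the discretisation error of the nonlocal term. *)
have [M M3 hM] := power_beats (F + 4) p1 rho20.
have M0 : 0 < M by lra.
have Mge0 := ltW M0.
have iM0 : 0 < M^-1 by rewrite invr_gt0.
have [R0 R00 hR0] := infconv_reaches s01 cf p0 sol OmegaE Mge0.
have [eta eta0 heta] := uniform_on_segment (- 2) (M + 2) cf iM0.
pose eta1 := Num.min eta 1.
have eta10 : 0 < eta1 by rewrite lt_min eta0 ltr01.
have [eta1e eta11] : eta1 <= eta /\ eta1 <= 1 by rewrite !ge_min !lexx orbT.
have eta40 : 0 < eta1 / 4 by rewrite divr_gt0.
have [w1 w10 hw1] := uniform_on_segment 0 R0 cV eta40.
pose w := Num.min w1 (rho / 2).
have w0 : 0 < w by rewrite lt_min w10.
have [ww1 wrho] : w <= w1 /\ w <= rho / 2 by rewrite !ge_min !lexx orbT.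
(* A penalty of at most [M + 1] then means a distance of at most [w]; [A >= 1] carries the growth of
   [infconv 1] over to [infconv A]. *)
pose A := Num.max 1 ((M + 1) / w ^+ 2).
have A1 : 1 <= A by rewrite le_max lexx.
have A0 : 0 < A by apply: lt_le_trans A1.
have Age0 := ltW A0.
have Aw : M + 1 <= A * w ^+ 2 by rewrite -ler_pdivrMr ?exprn_gt0// le_max lexx orbT.
have close (r y : R) : A * Num.max (r - y) 0 ^+ 2 <= M + 1 -> r - w <= y.
  move=> h; have m0 : 0 <= Num.max (r - y) 0 by rewrite le_max lexx orbT.
  have : Num.max (r - y) 0 <= w.
    rewrite -(@ler_pXn2r _ 2)// ?nnegrE ?(ltW w0)//.
    by rewrite -(ler_pM2l A0); exact: le_trans h Aw.
  by rewrite ge_max => /andP[h1 _]; move: h1; clear; lra.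
pose Phi := capped hn u M A.
have Phi_mono : {homo Phi : a b / a <= b} by exact: (capped_mono sol).
have PhiM x : 0 <= Phi x <= M by exact: (capped_bound sol).
have cPhi : continuous Phi by exact: (capped_continuous sol).
(* Chosen after [A], which multiplies the near part of the operator; the mesh in turn depends on
   [eps] through the tail mass [c]. *)
have [eps eps0 [eps1 heps]] : exists2 e : R, 0 < e & e <= 1 /\
    k0 * ((A + 1) * (e `^ (2 - 2 * s) * momentc n s)) <= M^-1.
  have c0 : 0 < M^-1 / k0 by rewrite divr_gt0.
  near (0 : R)^'+ => e; exists e; first by near: e; exact: nbhs_right_gt.
  split; first by near: e; apply: nbhs_right_le; exact: ltr01.
  have : (A + 1) * (e `^ (2 - 2 * s) * momentc n s) < M^-1 / k0 by near: e; exact: moment_small.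
  by move=> /ltW; rewrite ler_pdivlMr// mulrC.
pose c := eps `^ (- (2 * s)) * tailc n s.
have c0 : 0 <= c by rewrite mulr_ge0 ?powR_ge0 ?tailc_ge0.
pose L := 2 * (M + 1) + 3 * A.
have L0 : 0 < L by rewrite /L; move: M0 A0; clear; lra.
pose W := k0 * (2 * M * c) + 1.
have W0 : 0 < W by rewrite ltr_wpDl// mulr_ge0 ?(ltW k00)// mulr_ge0// mulr_ge0.
pose delta := Num.min (eta1 / 4) W^-1.
have delta0 : 0 < delta by rewrite lt_min eta40 invr_gt0.
have [deta dW] : delta <= eta1 / 4 /\ delta <= W^-1 by rewrite !ge_min !lexx orbT.
have dW1 : k0 * (2 * M * delta * c) <= 1.
  have : W * delta <= 1 by rewrite mulrC -ler_pdivlMr// mul1r.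
  by rewrite /W mulrDl mul1r; move: delta0; clear; lra.
have d1 : delta <= 1 by move: deta eta11; clear; lra.
pose h := Num.min 1 (delta / L).
have h0 : 0 < h by rewrite lt_min ltr01 divr_gt0.
have [h1 hL] : h <= 1 /\ h <= delta / L by rewrite !ge_min !lexx orbT.
have hL' : L * h <= delta by rewrite mulrC -ler_pdivlMr.
have h01 : 0 <= h <= 1 by rewrite (ltW h0) h1.
have Phi_delta x : Phi (x + h) - Phi x <= delta.
  by have := capped_lipschitz sol x Mge0 A0 h01; rewrite -/Phi -/L; move: hL'; clear; lra.
have Phi0 : Phi 0 = 0 by exact: (capped_le0 sol OmegaE).
have Phih : Phi h <= delta by have := Phi_delta 0; rewrite add0r Phi0 subr0.
have grid_gt0 j : 0 < grid h j by rewrite mulr_gt0.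
have PhiR r : R0 <= r -> Phi r = M.
  move=> rR; rewrite /Phi /capped min_l//.
  apply: le_trans hR0 _; apply: le_trans (infconv_monoA sol _ ler01 A1) _.
  exact: (infconv_mono sol).
pose J := (Num.truncn (R0 / h)).+1.
have gridJ : R0 <= grid h J.
  rewrite /grid -ler_pdivrMr//; apply: (@le_trans _ _ J%:R); first exact/ltW/truncnS_gt.
  by rewrite ler_nat.
pose P := rho / 2 * (M + 1) `^ p.
have P0 : 0 <= P by rewrite mulr_ge0 ?powR_ge0// ltW.
pose d := Num.min (eta1 / 4) M^-1.
have d0 : 0 < d by rewrite lt_min eta40.
have [de dM] : d <= eta1 / 4 /\ d <= M^-1 by rewrite !ge_min !lexx orbT.
pose Lam j := \int[lebesgue_rV R n]_(z in [set z | eps < enorm z])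
     ((Phi (grid h j + coord1 hn z) - Phi (grid h j)) * kern s z).
have step j : jump Phi h j * (k0 * Lam j) + P * (jump Phi h j * (1 <= Phi (grid h j))%R%:R) <=
    jump Phi h j * (3 * M^-1) + (abs_primitive f (Phi (grid h j.+1)) - abs_primitive f (Phi (grid h j))).
  set r := grid h j; have r0 : 0 < r by exact: grid_gt0.
  set D := jump Phi h j; have D0 : 0 <= D by exact: jump_ge0.
  have DE : D = Phi (grid h j.+1) - Phi r by [].
  (* At the cap there is no inequality, but the jump is 0 and both sides vanish. *)
  have [rM|Mr] := ltP (infconv hn u A r) M; last first.
    have E1 : Phi r = M by rewrite /Phi /capped min_l.
    have E2 : Phi (grid h j.+1) = M.
      apply/eqP; rewrite eq_le; have /andP[_ ->] := PhiM (grid h j.+1).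
      by rewrite -E1; move: D0; rewrite DE subr_ge0.
    by rewrite DE E1 E2 !subrr !mul0r mulr0 !addr0.
  have eps01 : 0 < eps <= 1 by rewrite eps0 eps1.
  have := capped_inequality s01 cf p0 sol OmegaE Mge0 A0 eps01 d0 r0 rM.
  move=> [y [lam]] /=; rewrite -/V -/Phi -/k0 -/(Lam j).
  set e := A * Num.max (r - y) 0 ^+ 2; move=> [y0 eM eV hlam main].
  have e0 : 0 <= e by rewrite mulr_ge0 ?sqr_ge0.
  have yr := close r y eM.
  have rR0 : r <= R0.
    rewrite leNgt; apply/negP => R0r; move: rM; rewrite ltNge => /negP; apply.
    apply: le_trans hR0 _; apply: le_trans (infconv_monoA sol _ ler01 A1) _.
    by apply: (infconv_mono sol) => //; exact: ltW.
  have Vry : V r - V y <= eta1 / 4.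
    have [ry|yr'] := leP r y.
      by have := Vmono _ _ ry; move: eta40; clear; lra.
    apply: le_trans (ler_norm _) _; apply: hw1; first by rewrite rR0 ltW.
    by rewrite gtr0_norm ?subr_gt0//; move: yr ww1; clear; lra.
  have e2 : e <= eta1 / 2 by move: eV Vry de; clear; lra.
  have /andP[q1 q2] := PhiM r; have /andP[q3 q4] := PhiM (grid h j.+1).
  have lamPhi : `|lam - Phi r| <= 3 / 4 * eta1.
    move: hlam; rewrite !ler_norml => /andP[g1 g2].
    by move: g1 g2 e0 e2 de; clear; move=> *; apply/andP; split; lra.
  (* [lam] is within [3/4 eta1] of [Phi r], and [v] within [delta <= eta1 / 4], so uniform
     continuity of [f] applies. *)
  have lamv v : Phi r <= v <= Phi (grid h j.+1) -> `|f lam| - M^-1 <= `|f v|.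
    move=> /andP[v1 v2]; have vd : v - Phi r <= delta.
      have := Phi_delta r; have -> : r + h = grid h j.+1.
        by rewrite /r /grid -[j.+2%:R]natr1 mulrDl mul1r.
      by move: v2; clear; lra.
    have lv : `|lam - v| <= eta.
      move: lamPhi; rewrite !ler_norml => /andP[g1 g2].
      by move: g1 g2 v1 vd deta eta1e eta10; clear; move=> *; apply/andP; split; lra.
    have ll : - 2 <= lam <= M + 2.
      move: lamPhi; rewrite !ler_norml => /andP[g1 g2].
      by move: g1 g2 q1 q2 eta11; clear; move=> *; apply/andP; split; lra.
    have := heta lam v ll lv.
    have : `|f lam| <= `|f lam - f v| + `|f v|.
      by rewrite -{1}(subrK (f v) (f lam)); exact: ler_normD.
    by clear; lra.
  have DM : Phi r <= Phi (grid h j.+1) by rewrite -subr_ge0.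
  have hF := abs_primitive_diff fi DM lamv; rewrite -DE in hF.
  have flam := ler_norm (- f lam); rewrite normrN in flam.
  have yP : P * (1 <= Phi r)%R%:R <= y * (M + 1) `^ p.
    case: (leP 1 (Phi r)) => h1r; last by rewrite mulr0 mulr_ge0 ?powR_ge0// ltW.
    rewrite mulr1 /P ler_wpM2r ?powR_ge0//.
    have : rho < r.
      rewrite ltNge; apply/negP => /Vmono; rewrite leNgt => /negP; apply.
      apply: lt_le_trans hrho _; apply: le_trans h1r _.
      apply: (@le_trans _ _ (infconv hn u A r)); first by rewrite /Phi /capped ge_min lexx orbT.
      exact: (infconv_le_lowest sol).
    by move: yr wrho; clear; lra.
  have per : k0 * Lam j + P * (1 <= Phi r)%R%:R <= 3 * M^-1 + (`|f lam| - M^-1).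
    by move: main yP heps dM flam; rewrite mulrBr; clear; lra.
  have := ler_wpM2l D0 per; rewrite !mulrDr (mulrCA D P).
  move: hF; move: (abs_primitive f _) (abs_primitive f _) (Lam j) => B1 B2 B3.
  by move: (P * (D * _)) (`|f lam|) (D * (k0 * B3)); clear; move=> X1 X2 X3; lra.
have total : \sum_(j < J) (jump Phi h j * (k0 * Lam j) + P * (jump Phi h j * (1 <= Phi (grid h j))%R%:R)) <=
    \sum_(j < J) (jump Phi h j * (3 * M^-1) + (abs_primitive f (Phi (grid h j.+1)) - abs_primitive f (Phi (grid h j)))).
  by apply: ler_sum => j _; exact: step.
have PhiJ : Phi (grid h J) = M by exact: PhiR.
have sJ := sum_jump Phi h J.
have sA : \sum_(j < J) (abs_primitive f (Phi (grid h j.+1)) - abs_primitive f (Phi (grid h j))) <= F.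
  have telescope (B : nat -> R) K : \sum_(j < K) (B j.+1 - B j) = B K - B 0.
    elim: K => [|K IH]; first by rewrite big_ord0 subrr.
    by rewrite big_ord_recr /= IH addrC addrA subrK.
  rewrite (telescope (fun j => abs_primitive f (Phi (grid h j)))).
  have /andP[_ b1] := abs_primitive_bound fi (Phi (grid h J)).
  have /andP[b2 _] := abs_primitive_bound fi (Phi (grid h 0)).
  by rewrite lerBlDr; apply: le_trans b1 _; rewrite lerDl.
have sL := @stair_integral R n hn s s01 Phi M h delta Phi_mono PhiM h0 Phih Phi_delta cPhi J eps eps0.
have sP := sum_jump_above J Phi_mono h0 Phih Phi_delta.
rewrite PhiJ in sP sJ.
rewrite !big_split /= in total.
have E1 : \sum_(j < J) jump Phi h j * (k0 * Lam j) = k0 * \sum_(j < J) jump Phi h j * Lam j.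
  by rewrite mulr_sumr; apply: eq_bigr => j _; rewrite mulrCA.
rewrite sumrN -sumrB E1 -mulr_sumr -mulr_suml sJ in total.
have sL' := ler_wpM2l (ltW k00) sL; rewrite -/c mulrN in sL'.
have sP' := ler_wpM2l P0 sP.
have sM : (M - Phi (grid h 0)) * (3 * M^-1) <= 3.
  have E3 : M * (3 * M^-1) = 3 by field; rewrite gt_eqF.
  have /andP[g1 _] := PhiM (grid h 0).
  by rewrite -[leRHS]E3 ler_wpM2r// ?mulr_ge0 ?(ltW iM0)//; move: g1; clear; lra.
have sP2 : P * (M - 2) <= P * (M - 1 - delta).
  by rewrite ler_wpM2l//; move: d1; clear; lra.
rewrite -/P in hM.
set X := \sum_(j < J) jump Phi h j * Lam j in total sL'.
set Y := \sum_(j < J) jump Phi h j * _%:R in total sP'.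
set Z := \sum_(j < J) (_ - _) in total sA.
have lower : P * (M - 2) - 1 <= k0 * X + P * Y.
  rewrite addrC; apply: lerD; first by apply: le_trans sL'; rewrite lerN2; exact: dW1.
  exact: le_trans sP2 sP'.
have upper : k0 * X + P * Y <= 3 + F by exact: le_trans total (lerD sM sA).
by have := le_trans lower upper; move: hM; clear; lra.
Unshelve. all: by end_near. Qed.

Lemma powR_blowup (R : realType) (q Y : R) : q < 0 -> 0 < Y ->
  exists2 t0 : R, 0 < t0 & forall t, 0 < t <= t0 -> Y <= t `^ q.
Proof.
move=> q0 Y0; exists (Y `^ q^-1); first by rewrite powR_gt0.
move=> t /andP[t_gt0 tt0]; have := ler_powR_neg t_gt0 tt0 (ltW q0).
by rewrite -powRrM mulVf ?lt_eqF// powRr1// ltW.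
Qed.

Section boundary_cases.
Context (R : realType) (n : nat) (hn : (2 <= n)%N) (s p : R) (f : R -> R).
Context (u : 'rV[R]_n -> R -> R) (s01 : 0 < s < 1) (cf : continuous f) (p0 : p < 0).
Local Notation e1 := (delta_mx ord0 (Ordinal (ltnW hn)) : 'rV[R]_n).

(** The boundary point is the pole where [x_1 = 1]; near it the weight is at least [1/2], so [u^p]
    blows up for every [p < 0]. *)
Lemma no_solution_ball : classical_solution hn s p f (@unit_ball R n) u -> False.
Proof.
move=> sol.
apply: (no_solution_boundary s01 cf p0 sol (xb := e1) (e := - e1)).
- by rewrite enormN enorm_delta.
- by rewrite /unit_ball /= enorm_delta ltxx.
- move=> r /andP[r0 r1]; rewrite scalerN opprK -{1}(scale1r e1) -scalerDl /unit_ball /=.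
  by rewrite enormZ enorm_delta mulr1 ger0_norm; [apply/negP; rewrite -leNgt|]; lra.
- move=> r /andP[r0 r1]; rewrite scalerN -{1 3}(scale1r e1) -scalerBl /unit_ball /=.
  rewrite enormZ enorm_delta mulr1 coord1Z ger0_norm; last lra.
  by split; lra.
- move=> N C N0.
  have Y0 : 0 < 2 * (`|C| + 1) by rewrite mulr_gt0// ltr_wpDl.
  have [t0 t00 ht0] := powR_blowup p0 Y0.
  pose r := Num.min 2^-1 (t0 / N).
  have r0 : 0 < r by rewrite lt_min divr_gt0// andbT.
  have [r2 rt] : r <= 2^-1 /\ r <= t0 / N by rewrite !ge_min !lexx orbT.
  have r1 : r < 1 by lra.
  exists r; first by rewrite r0.
  rewrite scalerN -{1}(scale1r e1) -scalerBl coord1Z.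
  have Nr : 0 < N * r ^+ 2 <= t0.
    rewrite mulr_gt0 ?exprn_gt0//=; apply: (@le_trans _ _ (N * r)).
      by rewrite ler_wpM2l ?(ltW N0)// expr2 ler_piMr// ltW.
    by rewrite mulrC -ler_pdivlMr.
  have := ht0 _ Nr; set w := _ `^ p => hw.
  have : 2^-1 * w <= (1 - r) * w by rewrite ler_wpM2r ?powR_ge0//; lra.
  by have := ler_norm C; lra.
Qed.

(** At distance [r] from the origin along the normal the reaction is at least [N^p r^(1 + 2p)]: the
    weight vanishes linearly and [u] at most quadratically, whence the threshold. *)
Lemma no_solution_half_space_lt : p < - 2^-1 ->
  classical_solution hn s p f (@right_half_space R n hn) u -> False.
Proof.
move=> p2 sol.
have c0 : coord1 hn (0 : 'rV[R]_n) = 0 by rewrite /coord1 mxE.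
apply: (no_solution_boundary s01 cf p0 sol (xb := 0) (e := e1)) => //.
- exact: enorm_delta.
- by rewrite /right_half_space /= c0 ltxx.
- move=> r /andP[r0 r1]; rewrite sub0r -scaleNr /right_half_space /= coord1Z oppr_gt0.
  by apply/negP; rewrite -leNgt ltW.
- by move=> r /andP[r0 r1]; rewrite add0r /right_half_space /= coord1Z.
- move=> N C N0.
  have q0 : 1 + 2 * p < 0 by lra.
  have Np : 0 < N `^ p by rewrite powR_gt0.
  have Y0 : 0 < (`|C| + 1) / N `^ p by rewrite divr_gt0// ltr_wpDl.
  have [t0 t00 ht0] := powR_blowup q0 Y0.
  pose r := Num.min 2^-1 t0.
  have r0 : 0 < r by rewrite lt_min t00 andbT.
  have [r2 rt] : r <= 2^-1 /\ r <= t0 by rewrite !ge_min !lexx orbT.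
  exists r; first by rewrite r0; lra.
  rewrite add0r coord1Z powRM ?sqr_ge0 ?(ltW N0)//.
  have -> : r * (N `^ p * (r ^+ 2) `^ p) = r `^ (1 + 2 * p) * N `^ p.
    rewrite -powR_mulrn ?(ltW r0)// -powRrM powRD; last by rewrite (gt_eqF r0) implybT.
    by rewrite powRr1 ?(ltW r0)//; ring.
  have := ht0 r; rewrite r0 rt => /(_ isT); rewrite ler_pdivrMr// => h.
  by have := ler_norm C; lra.
Qed.

End boundary_cases.

Unset Implicit Arguments.

Theorem theorem3p3p1 (R : realType) (n : nat) (hn : (2 <= n)%N) (s p : R)
    (f : R -> R) (Omega : set 'rV[R]_n) :
  0 < s < 1 ->
  continuous f ->
  lebesgue_measure.-integrable [set: R] (EFin \o f) ->
  Omega = @unit_ball R n \/ Omega = @right_half_space R n hn ->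
  p < 0 ->
  ~ exists u : 'rV[R]_n -> R -> R, classical_solution hn s p f Omega u.
Proof.
move=> s01 cf fi OmegaE p0 [u sol].
case: OmegaE => OmegaE; rewrite OmegaE in sol; first exact: (no_solution_ball s01 cf p0 sol).
have [p2|p2] := ltP p (- 2^-1); first exact: (no_solution_half_space_lt s01 cf p0 p2 sol).
have p1 : -1 < p by lra.
exact: (no_solution_half_space s01 cf fi p1 p0 sol).
Qed.
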